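(* Let $0\le k\le n$. For each Le-diagram $D\in\mathrm{Le}_{kn}$ of shape $\lambda$, the map $\mathit{Meas}_D:\mathbb{R}^D_{>0}\to Gr_{kn}$ is a subtraction-free parametrization of a totally nonnegative Grassmann cell $S_\mathcal{M}^{\mathrm{tnn}}=\mathit{Meas}_D(\mathbb{R}^D_{>0})\subseteq Gr_{kn}^{\mathrm{tnn}}$. This gives a bijection $D\mapsto \mathit{Meas}_D(\mathbb{R}^D_{>0})$ between $\mathrm{Le}_{kn}$ and the set of all totally nonnegative Grassmann cells in $Gr_{kn}^{\mathrm{tnn}}$. The diagram $D$ has shape $\lambda$ if and only if the corresponding cell is contained in the Schubert cell $\Omega_\lambda$; the dimension of the cell equals $|D|$; and $\mathit{Meas}_D$ is $I(\lambda)$-polynomial.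
   Context: Grassmannian: $Gr_{kn}$ is the space of $k$-dimensional subspaces of $\mathbb{R}^n$, points represented by full-rank $k\times n$ matrices modulo $GL_k$, Plücker coordinates $\Delta_I$ (maximal minors). $Gr_{kn}^{\mathrm{tnn}}$: points with all $\Delta_I\ge0$. $\mathcal{M}_V=\{I:\Delta_I(V)\ne0\}$; $S_\mathcal{M}^{\mathrm{tnn}}=\{V\in Gr_{kn}^{\mathrm{tnn}}:\mathcal{M}_V=\mathcal{M}\}$, a totally nonnegative Grassmann cell when nonempty. Partitions: a partition $\lambda\subseteq(n-k)^k$ has a Young diagram (English notation, box $(i,j)$ in row $i$, column $j$) fitting in a $k\times(n-k)$ rectangle. Its boundary is a lattice path of $n$ unit steps from the upper right to the lower left corner of the rectangle; label the steps $1,\dots,n$ in order; $I(\lambda)$ is the set of labels of the $k$ vertical steps. The Schubert cell $\Omega_\lambda$ is the set of $V\in Gr_{kn}$ such that $I(\lambda)$ is the lexicographically minimal base of $\mathcal{M}_V$. Le-diagrams: a Le-diagram of shape $\lambda$ is a filling of the boxes of $\lambda$ with $0$s and $1$s such that whenever boxes $(i',j)$, $(i,j')$ with $i<i'$, $j<j'$ both contain $1$, the box $(i',j')$ also contains $1$. $|D|$ is the number of $1$s; $\mathrm{Le}_{kn}$ is the set of Le-diagrams of shapes $\lambda\subseteq(n-k)^k$. A Le-tableau $T$ for $D$ is a function from boxes to $\mathbb{R}_{\ge0}$ with $T(i,j)>0$ exactly at boxes filled with $1$; $\mathbb{R}^D_{>0}\cong\mathbb{R}^{|D|}_{>0}$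 is the set of these. Network $N_T$: put boundary vertices $b_1,\dots,b_n$ at the midpoints of the steps of the boundary lattice path of $\lambda$ (labelled as the steps) and close the path with another curve from the lower left to upper right corner, so the diagram lies inside a closed curve on which $b_1,\dots,b_n$ appear clockwise. For each box with $T(i,j)\ne0$ place an internal vertex at its center and draw the segment going down from it to the boundary (ending at a $b$ on a horizontal step) and the segment going right to the boundary (ending at a $b$ on a vertical step); all intersection points of these segments are also vertices (they lie at boxes with nonzero entries). Orient all edges to the left or downward; $b_i$ for $i\in I(\lambda)$ are sources and the others sinks. The horizontal edge entering (from the right) the vertex in box $(i,j)$ gets weight $T(i,j)$; all vertical edges get weight $1$. Boundary measurements: for this acyclic network, $M_{ij}=\sum_{P:b_i\to b_j}\prod_{e\in P}x_e$ over directed paths; $\mathit{Meas}(N)\in Gr_{kn}$ is the point with $\Delta_{I(\lambda)}\ne0$ and $\Delta_{(I\setminus\{i\})\cup\{j\}}/\Delta_I=M_{ij}$ ($I=I(\lambda)$, $i\in I$, $j\notin I$). $\mathit{Meas}_D(T):=\mathit{Meas}(N_T)$. Parametrizations: a subtraction-free rational parametrization of a cell $S_\mathcal{M}^{\mathrm{tnn}}$ is a bijection $f:\mathbb{R}^d_{>0}\to S_\mathcal{M}^{\mathrm{tnn}}$ such that (1) each ratio $\Delta_J/\Delta_I$, $I,J\in\mathcal{M}$, of $f(x_1,\dots,x_d)$ is a subtraction-free rational expression (quotient of polynomials with nonnegative integer coefficients) in $x_1,\dots,x_d$, and (2) each $x_i$ of $f^{-1}$ is a subtraction-free rational expression in the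 Plücker coordinates. It is $I$-polynomial ($I\in\mathcal{M}$) if all $\Delta_J/\Delta_I$, $J\in\mathcal{M}$, are polynomials in the $x_i$ with nonnegative integer coefficients. *)

(* Defs.v *)
From HB Require Import structures.
From mathcomp Require Import all_boot all_order all_algebra.
From mathcomp Require Import all_classical all_reals all_analysis.
From mathcomp Require mpoly.
(* The notations of mpoly clash with those of mathcomp-analysis. *)
Import -(notations) mpoly.

Set Implicit Arguments.
Unset Strict Implicit.
Unset Printing Implicit Defensive.

Import Order.TTheory GRing.Theory Num.Theory.
Import numFieldNormedType.Exports.

Local Open Scope classical_set_scope.
Local Open Scope ring_scope.

(* Everything is 0-indexed: boundary labels are 0, ..., n - 1, the boxes of the
   k x (n - k) rectangle are the pairs (i, j) : 'I_k * 'I_(n - k). *)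

Section Grassmannian.
Variable R : realType.
Variables k n : nat.

Definition rowspan (A : 'M[R]_(k, n)) : {vspace 'rV[R]_n} :=
  <<[seq row i A | i : 'I_k]>>%VS.

Definition Gr : set {vspace 'rV[R]_n} := [set V | \dim V = k].

Definition represents (A : 'M[R]_(k, n)) (V : {vspace 'rV[R]_n}) : Prop :=
  row_free A /\ rowspan A = V.

(* Quotient topology, from the full-rank matrices modulo GL_k. *)
Definition Gr_open (U : set {vspace 'rV[R]_n}) : Prop :=
  U `<=` Gr /\
  open ([set A | U (rowspan A)]
        : set (subspace [set A : 'M[R]_(k, n) | row_free A])).

(* Minor on the columns of I in increasing order, meaningful for #|I| = k. *)
Definition minor (A : 'M[R]_(k, n)) (I : {set 'I_n}) : R :=
  \det (\matrix_(i < k, j < k) [seq A i c | c <- enum I]`_j).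

(* Plucker coordinates are defined up to a common factor; gr_mx V fixes one
   representative matrix, the invariants below do not depend on this choice. *)
Definition gr_mx (V : {vspace 'rV[R]_n}) : 'M[R]_(k, n) :=
  \matrix_(i < k) (vbasis V)`_i.

Definition plucker (V : {vspace 'rV[R]_n}) (I : {set 'I_n}) : R :=
  minor (gr_mx V) I.

Definition matroid (V : {vspace 'rV[R]_n}) : {set {set 'I_n}} :=
  [set I : {set 'I_n} | (#|I| == k) && (plucker V I != 0)].

Definition Gr_tnn : set {vspace 'rV[R]_n} :=
  [set V | exists A, represents A V /\
     forall I : {set 'I_n}, #|I| = k -> 0 <= minor A I].

Definition tnn_cell (M : {set {set 'I_n}}) : set {vspace 'rV[R]_n} :=
  [set V | Gr_tnn V /\ matroid V = M].

Definition is_tnn_cell (C : set {vspace 'rV[R]_n}) : Prop :=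
  C !=set0 /\ exists M, C = tnn_cell M.

(* C, with the topology induced by Gr, is homeomorphic to R^d. *)
Definition cell_dim (C : set {vspace 'rV[R]_n}) (d : nat) : Prop :=
  exists g : 'rV[R]_d -> {vspace 'rV[R]_n},
    set_bij [set: 'rV[R]_d] C g /\
    forall O : set 'rV[R]_d,
      open O <-> exists2 U, Gr_open U & g @` O = C `&` U.

End Grassmannian.

Arguments tnn_cell R k {n} M.

Section Parametrizations.
Variable R : realType.

Definition orthant (d : nat) : set 'rV[R]_d := [set x | forall i, 0 < x 0 i].

Definition nonneg_coeffs (d : nat) (p : mpoly d int) : Prop :=
  forall m, 0 <= mcoeff m p.

Definition peval (d : nat) (p : mpoly d int) (v : 'I_d -> R) : R :=
  mmap intr v p.

Variables k n : nat.

Definition sf_parametrization (M : {set {set 'I_n}}) (d : nat)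
    (f : 'rV[R]_d -> {vspace 'rV[R]_n}) : Prop :=
  [/\ set_bij (@orthant d) (tnn_cell R k M) f,
      forall I J, I \in M -> J \in M ->
        exists p q : mpoly d int,
          [/\ nonneg_coeffs p, nonneg_coeffs q, q != 0 &
              forall x, orthant x ->
                plucker k (f x) J / plucker k (f x) I
                = peval p (x 0) / peval q (x 0)] &
      (* the expression must not depend on the representative A *)
      forall i : 'I_d,
        exists p q : mpoly #|M| int,
          [/\ nonneg_coeffs p, nonneg_coeffs q, q != 0 &
              forall x, orthant x ->
              forall A : 'M[R]_(k, n), represents A (f x) ->
                let D s := minor A (enum_val s) in
                peval q D != 0 /\ x 0 i = peval p D / peval q D]].

Definition polynomial_parametrization (I : {set 'I_n}) (M : {set {set 'I_n}})
    (d : nat) (f : 'rV[R]_d -> {vspace 'rV[R]_n}) : Prop :=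
  [/\ sf_parametrization M f, I \in M &
      forall J, J \in M ->
        exists p : mpoly d int,
          nonneg_coeffs p /\
          forall x, orthant x ->
            plucker k (f x) J / plucker k (f x) I = peval p (x 0)].

End Parametrizations.

Section Networks.
Variable R : realType.

Record network (n : nat) := Network {
  vertex : finType;
  edge : rel vertex;
  weight : vertex -> vertex -> R;
  bdry : 'I_n -> vertex;
  sources : {set 'I_n}
}.

(* In an acyclic network a directed path has distinct vertices, hence less
   than #|vertex N| edges. *)
Definition bdry_measurement (n : nat) (N : network n) (i j : 'I_n) : R :=
  \sum_(l < #|vertex N|)
    \sum_(p : l.-tuple (vertex N) |
            path (@edge n N) (bdry N i) p && (last (bdry N i) p == bdry N j))
      \prod_(x <- pairmap (@weight n N) (bdry N i) p) x.

(* The unique point with these properties; 0 is a dummy default. *)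
Definition Meas (k n : nat) (N : network n) : {vspace 'rV[R]_n} :=
  let I := sources N in
  xget 0%VS [set V | [/\ Gr k V, plucker k V I != 0 &
    forall i j, i \in I -> j \notin I ->
      plucker k V (j |: (I :\ i)) / plucker k V I = bdry_measurement N i j]].

End Networks.

Section LeDiagrams.

Definition partition_in (k m : nat) : finType :=
  {lam : {ffun 'I_k -> 'I_m.+1} |
    [forall i : 'I_k, forall i' : 'I_k, (i <= i')%N ==> (lam i' <= lam i)%N]}.

Definition diagram (k m : nat) (lam : partition_in k m) :
    {set 'I_k * 'I_m} :=
  [set b : 'I_k * 'I_m | (b.2 < val lam b.1)%N].

Variables k n : nat.

(* Before the vertical step at row i, the path from the upper right corner has
   made i vertical steps and n - k - lam_i horizontal steps. *)
Definition vlabel (lam : partition_in k (n - k)) (i : 'I_k) : nat :=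
  (i + (n - k - val lam i))%N.

(* Before the horizontal step at column j, the path has crossed the columns to
   the right of j, and the rows having a box in column j. *)
Definition hlabel (lam : partition_in k (n - k)) (j : 'I_(n - k)) : nat :=
  ((n - k - j.+1) + #|[set i : 'I_k | (i, j) \in diagram lam]|)%N.

Definition vertical_labels (lam : partition_in k (n - k)) : {set 'I_n} :=
  [set l : 'I_n | [exists i : 'I_k, val l == vlabel lam i]].

Definition Schubert_cell (R : realType) (lam : partition_in k (n - k)) :
    set {vspace 'rV[R]_n} :=
  [set V | [/\ Gr k V, vertical_labels lam \in matroid k V &
     forall J, J \in matroid k V ->
       (enum (vertical_labels lam) <= enum J :> seqlexi 'I_n)%O]].

(* A filling is encoded by the set D of the boxes containing a 1.  As usual for
   Le-diagrams, the condition only concerns boxes (i', j') of the shape. *)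
Definition is_Le (lam : partition_in k (n - k))
    (D : {set 'I_k * 'I_(n - k)}) : bool :=
  (D \subset diagram lam) &&
  [forall i : 'I_k, forall i' : 'I_k,
    forall j : 'I_(n - k), forall j' : 'I_(n - k),
     [&& (i < i')%N, (j < j')%N, (i', j) \in D, (i, j') \in D &
         (i', j') \in diagram lam] ==> ((i', j') \in D)].

Definition Le : finType :=
  {D : partition_in k (n - k) * {set 'I_k * 'I_(n - k)} | is_Le D.1 D.2}.

Definition Le_shape (D : Le) : partition_in k (n - k) := (val D).1.
Definition Le_ones (D : Le) : {set 'I_k * 'I_(n - k)} := (val D).2.

Variable R : realType.

Definition tableau := {ffun 'I_k * 'I_(n - k) -> R}.

Definition Le_tableaux (D : Le) : set tableau :=
  [set T | forall b, 0 <= T b /\ (0 < T b <-> b \in Le_ones D)].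

Section NetworkOfTableau.
Variable lam : partition_in k (n - k).
Variable T : tableau.

(* inl l is the boundary vertex b_l, inr b is the center of the box b; the
   latter is a vertex of the network when T b != 0, and isolated otherwise. *)
Definition net_vertex : finType := ('I_n + 'I_k * 'I_(n - k))%type.

Definition net_edge (u v : net_vertex) : bool :=
  match u, v with
  | inl l, inr (i, j) =>
      [&& val l == vlabel lam i, T (i, j) != 0 &
          [forall j' : 'I_(n - k), (j < j')%N ==> (T (i, j') == 0)]]
  | inr (i, j), inl l =>
      [&& val l == hlabel lam j, T (i, j) != 0 &
          [forall i' : 'I_k, (i < i')%N ==> (T (i', j) == 0)]]
  | inr (i, j), inr (i', j') =>
      [&& T (i, j) != 0, T (i', j') != 0 &
        [&& i == i', (j' < j)%N &
            [forall c : 'I_(n - k), (j' < c < j)%N ==> (T (i, c) == 0)]] ||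
        [&& j == j', (i < i')%N &
            [forall r : 'I_k, (i < r < i')%N ==> (T (r, j) == 0)]]]
  | inl _, inl _ => false
  end.

Definition net_weight (u v : net_vertex) : R :=
  match u, v with
  | inl _, inr b => T b
  | inr b, inr b' => if b.1 == b'.1 then T b' else 1
  | _, _ => 1
  end.

Definition Le_network : network R n :=
  @Network R n net_vertex net_edge net_weight inl (vertical_labels lam).

End NetworkOfTableau.

Definition Meas_Le (D : Le) (T : tableau) : {vspace 'rV[R]_n} :=
  Meas k (Le_network (Le_shape D) T).

Definition Le_cell (D : Le) : set {vspace 'rV[R]_n} :=
  Meas_Le D @` Le_tableaux D.

(* The identification of R_{>0}^{|D|} with R_{>0}^D, for the enumeration of
   the boxes filled with 1. *)
Definition tableau_of (D : Le) (x : 'rV[R]_#|Le_ones D|) : tableau :=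
  [ffun b => \sum_(s < #|Le_ones D| | enum_val s == b) x 0 s].

Definition Meas_coord (D : Le) (x : 'rV[R]_#|Le_ones D|) : {vspace 'rV[R]_n} :=
  Meas_Le D (tableau_of x).

Lemma tableau_of_enum_val (D : Le) (x : 'rV[R]_#|Le_ones D|) s :
  tableau_of x (enum_val s) = x 0 s.
Proof.
rewrite ffunE (bigD1 s) //= big1 ?addr0 // => s' /andP[/eqP/enum_val_inj ->].
by rewrite eqxx.
Qed.

Lemma tableau_of_out (D : Le) (x : 'rV[R]_#|Le_ones D|) b :
  b \notin Le_ones D -> tableau_of x b = 0.
Proof.
move=> bD; rewrite ffunE big1 // => s /eqP sb.
by move: bD; rewrite -sb enum_valP.
Qed.

Lemma tableau_of_bij (D : Le) :
  set_bij (@orthant R #|Le_ones D|) (Le_tableaux D) (@tableau_of D).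
Proof.
split.
- move=> x xp b; case: (boolP (b \in Le_ones D)) => bD.
    rewrite -(enum_rankK_in bD bD) tableau_of_enum_val.
    by split; [exact/ltW/xp|split=> // _; exact: xp].
  by rewrite tableau_of_out //; split=> //; rewrite ltxx.
- move=> x y _ _ xy; apply/rowP => s.
  by rewrite -!tableau_of_enum_val xy.
- move=> T TD; exists (\row_s T (enum_val s)).
    by move=> s; rewrite mxE; apply/(TD _).2/enum_valP.
  apply/ffunP => b; case: (boolP (b \in Le_ones D)) => bD.
    by rewrite -(enum_rankK_in bD bD) tableau_of_enum_val mxE.
  rewrite tableau_of_out //; have [Tb Tp] := TD b.
  apply/esym/eqP; case: eqP => // /eqP Tb0; case/negP: bD; apply/Tp.
  by rewrite lt_neqAle eq_sym Tb0.
Qed.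

End LeDiagrams.

Arguments Schubert_cell {k n} R lam.
Arguments Le_cell {k n} R D.
Arguments Meas_coord {k n} R D x.

(* Main.v *)
Require Import Defs.
From mathcomp Require Import all_boot all_order all_algebra.
From mathcomp Require Import all_classical all_reals all_analysis.
From mathcomp Require Import fingroup perm.
From mathcomp Require Import ring zify.
From mathcomp Require mpoly.
Import -(notations) mpoly.

Set Implicit Arguments.
Unset Strict Implicit.
Unset Printing Implicit Defensive.
Import Order.TTheory GRing.Theory Num.Theory.
Import numFieldNormedType.Exports.

(* Induction on the number of boxes of the shape lambda.  Let c be the last box
   of the last nonempty row; the row and the column of c have consecutive labels
   l and l1 = l + 1.  Let x be the entry of c and I = I(lambda).  Deleting c
   changes only the columns l and l1 of a matrix representing Meas(T):
   (v_l, v_l1) becomes (x v_l - v_l1, v_l1) if x != 0 and (- v_l1, v_l) if x = 0.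
   Moreover x is the ratio of the minors I \ l + l1 and I, so that the entries of
   T can be recovered one at a time.

   The point is that the new matrix is again totally nonnegative.  Its only
   problematic minors are, for J containing l but not l1, the differences
   D_J = x Delta_J - Delta_(J \ l + l1).  If D_J is nonzero, there are e < l not
   in J and b > l1 in J such that Delta_(J \ b + e) is nonzero and, with
   S = J \ {b, l}, a three-term Plucker relation gives
     D_J Delta_(S+e+l) = Delta_J D_(S+e+l) + Delta_(S+e+b) Delta_(S+l+l1).
   By induction on the number of labels of J greater than l1, D_J is a
   subtraction-free expression in the minors and its vanishing only depends on
   the matroid.  When x = 0, the Le condition says that the column or the row
   of c contains no 1, that is, that l is a loop or l1 is a coloop of the new
   matroid; basis exchange and D_J >= 0 show that this always holds. *)

(** * Minors *)

(** The theorem asks for one formula per cell, so the induction carries functions of a matrix, not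
    numbers. From tableaux to matrices these are polynomials with nonnegative coefficients; on the
    tableaux of a given diagram each is identically zero or everywhere positive, so the matroid is
    constant. From matrices to tableaux they are subtraction-free functions on a matroid stratum.

    Lexicographic minimality of I(lambda) is awkward to follow through a column operation. It is
    replaced by minimality in the Gale order, which amounts to an echelon form with pivots in
    I(lambda). The conditions carried by the induction are invariant under GL_k, so the echelon form
    can be assumed where entries are needed.

    Path sums are computed by scanning rows; when a corner is deleted, these scans obey the same
    identities as the minors, which identifies Meas(T).

    The dimension needs continuity both ways: a normalised matrix is polynomial in the parameters,
    the inverse is rational in the minors, and logarithms lead from the orthant to R^d. *)

Section ColumnDeterminants.
Local Open Scope ring_scope.
Variables (R : realType) (k n : nat).
Implicit Types (A : 'M[R]_(k, n)) (s t : 'I_k -> 'I_n) (J : {set 'I_n}).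

Definition upd (T : Type) (s : 'I_k -> T) (p : 'I_k) (u : T) : 'I_k -> T :=
  fun j => if j == p then u else s j.

(** Columns are listed by a function, in any order and with repetitions, so that exchanging a column
    creates no sign; [minor_vdm] returns to sorted columns. *)
Definition dtf A s : R := \det (\matrix_(i < k, j < k) A i (s j)).

Lemma eq_dtf A s t : s =1 t -> dtf A s = dtf A t.
Proof. by move=> st; congr (\det _); apply/matrixP => i j; rewrite !mxE st. Qed.

Lemma dtf_mulmx (G : 'M[R]_k) A s : dtf (G *m A) s = \det G * dtf A s.
Proof.
rewrite /dtf -det_mulmx; congr (\det _); apply/matrixP => i j.
by rewrite !mxE; apply: eq_bigr => a _; rewrite !mxE.
Qed.

Lemma dtf_perm A s (p : 'S_k) : dtf A (s \o p) = (-1) ^+ p * dtf A s.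
Proof.
transitivity (\det (col_perm p (\matrix_(i, j) A i (s j)))).
  by congr (\det _); apply/matrixP => i j; rewrite !mxE.
by rewrite col_permE det_mulmx det_perm odd_permV mulrC.
Qed.

Lemma dtf_noninj A s p q : p != q -> s p = s q -> dtf A s = 0.
Proof.
move=> pq spq; rewrite /dtf -det_tr.
by apply: (determinant_alternate pq) => i; rewrite !mxE spq.
Qed.

Lemma dtf_neq0_inj A s : dtf A s != 0 -> injective s.
Proof.
move=> A0 p q spq; apply/eqP; apply: contraNT A0 => pq.
by rewrite (dtf_noninj _ pq spq).
Qed.

Lemma det_col_linear (M M1 M2 : 'M[R]_k) p a b :
  (forall i, M i p = a * M1 i p + b * M2 i p) ->
  (forall i j, j != p -> M1 i j = M i j) ->
  (forall i j, j != p -> M2 i j = M i j) ->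
  \det M = a * \det M1 + b * \det M2.
Proof.
move=> Mp M1j M2j; rewrite -det_tr -(det_tr M1) -(det_tr M2).
apply: (@determinant_multilinear _ _ _ _ _ p).
- by apply/rowP => i; rewrite !mxE Mp.
- by apply/matrixP => i j; rewrite !mxE M1j // eq_sym neq_lift.
- by apply/matrixP => i j; rewrite !mxE M2j // eq_sym neq_lift.
Qed.

Definition setcol (M : 'M[R]_k) (p : 'I_k) (u : 'I_k -> R) : 'M[R]_k :=
  \matrix_(i, j) if j == p then u i else M i j.

Lemma det_setcol (M : 'M[R]_k) p u :
  \det (setcol M p u) =
  \sum_i u i * \det (setcol M p (fun i' => (i' == i)%:R)).
Proof.
rewrite (expand_det_col _ p); apply: eq_bigr => i _.
rewrite mxE eqxx; congr (_ * _).
rewrite [RHS](expand_det_col _ p) (bigD1 i) //= big1 => [|i' i'i].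
  rewrite mxE !eqxx mul1r addr0 /cofactor; congr (_ * \det _).
  apply/matrixP => a b; rewrite !mxE.
  by rewrite [lift p b == p]eq_sym (negbTE (neq_lift _ _)).
by rewrite mxE eqxx (negbTE i'i) mul0r.
Qed.

Lemma det_setcol1 p u : \det (setcol 1%:M p u) = u p.
Proof.
rewrite det_setcol (bigD1 p) //= big1 ?addr0 => [|i ip].
  rewrite (_ : setcol _ _ _ = 1%:M) ?det1 ?mulr1 //.
  apply/matrixP => a b; rewrite !mxE; case: eqP => [->|//].
  by [].
rewrite -det_tr (@determinant_alternate _ _ _ p i) ?mulr0 1?eq_sym // => a.
by rewrite !mxE eqxx (negbTE ip) eq_sym.
Qed.

(** Replacing two columns of the identity leaves a 2 by 2 determinant; this turns the Plucker
    relation into an identity between entries. *)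
Lemma det_setcol2 p q u v : p != q ->
  \det (setcol (setcol 1%:M p u) q v) = u p * v q - u q * v p.
Proof.
move=> pq; have qp : q != p by rewrite eq_sym.
rewrite det_setcol (bigD1 q) //= (bigD1 p) //= big1 => [|i /andP[iq ip]].
  rewrite addr0 [in RHS]mulrC; congr (_ + _).
    congr (_ * _); rewrite (_ : setcol _ _ _ = setcol 1%:M p u) ?det_setcol1 //.
    apply/matrixP => a b; rewrite !mxE; case: eqP => [->|//].
    by rewrite (negbTE qp).
  rewrite [in RHS]mulrC -mulrN; congr (_ * _).
  rewrite -(det_setcol1 q u) -[in LHS]det_tr -[in RHS]det_tr.
  rewrite (_ : (setcol (setcol _ _ _) _ _)^T =
    row_perm (tperm p q) (setcol 1%:M q u)^T).
    by rewrite row_permE det_mulmx det_perm odd_tperm pq expr1 mulN1r.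
  apply/matrixP => a b; rewrite !mxE.
  case: tpermP => [->|->|/eqP ap /eqP aq].
  - by rewrite (negbTE pq) !eqxx.
  - by rewrite !eqxx (negbTE pq).
  - by rewrite (negbTE ap) (negbTE aq).
rewrite -det_tr (@determinant_alternate _ _ _ q i) ?mulr0 1?eq_sym // => a.
by rewrite !mxE eqxx (negbTE iq) (negbTE ip) eq_sym.
Qed.

(* The representative of [A] which is the identity on the columns of [s]. *)
Definition nrm A s : 'M[R]_(k, n) :=
  invmx (\matrix_(i < k, j < k) A i (s j)) *m A.

Lemma dtf_unit A s : dtf A s != 0 ->
  (\matrix_(i < k, j < k) A i (s j)) \in unitmx.
Proof. by rewrite unitmxE unitfE. Qed.

Lemma nrmE A s i j : dtf A s != 0 -> nrm A s i (s j) = (i == j)%:R.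
Proof.
move=> /dtf_unit Au.
transitivity ((invmx (\matrix_(i < k, j < k) A i (s j)) *m
  (\matrix_(i < k, j < k) A i (s j))) i j); last by rewrite mulVmx // mxE.
by rewrite !mxE; apply: eq_bigr => a _; rewrite !mxE.
Qed.

Lemma dtf_nrm A s t : dtf A s != 0 -> dtf A t = dtf A s * dtf (nrm A s) t.
Proof.
move=> A0; rewrite dtf_mulmx det_inv mulrA mulfV ?mul1r //.
Qed.

Lemma nrmK A s : dtf A s != 0 ->
  A = (\matrix_(i < k, j < k) A i (s j)) *m nrm A s.
Proof. by move=> /dtf_unit Au; rewrite mulmxA mulmxV // mul1mx. Qed.

(** Cramer's rule for the representative normalised on [s]. *)
Lemma dtf_nrm1 A s p u : dtf A s != 0 ->
  dtf (nrm A s) (upd s p u) = nrm A s p u.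
Proof.
move=> A0; rewrite -(det_setcol1 p (fun i => nrm A s i u)).
congr (\det _); apply/matrixP => i j; rewrite !mxE /upd.
by case: ifP => _; rewrite ?mxE // -[RHS](nrmE _ _ A0) mxE.
Qed.

Lemma dtf_nrm2 A s p q u v : p != q -> dtf A s != 0 ->
  dtf (nrm A s) (upd (upd s p u) q v) =
  nrm A s p u * nrm A s q v - nrm A s q u * nrm A s p v.
Proof.
move=> pq A0.
rewrite -(det_setcol2 (fun i => nrm A s i u) (fun i => nrm A s i v) pq).
congr (\det _); apply/matrixP => i j; rewrite !mxE /upd.
case: ifP => _; rewrite ?mxE //.
by case: ifP => _; rewrite ?mxE // -[RHS](nrmE _ _ A0) mxE.
Qed.

Lemma dtf_upd_swap A s p q u v : p != q ->
  dtf A (upd (upd s p u) q v) = - dtf A (upd (upd s p v) q u).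
Proof.
move=> pq; have qp : q != p by rewrite eq_sym.
rewrite -[RHS]mulN1r -[-1]expr1 -[X in _ ^+ X]/(nat_of_bool true).
rewrite -{1}pq -odd_tperm -dtf_perm.
apply: eq_dtf => j; rewrite /upd /=.
by case: tpermP => [->|->|/eqP jp /eqP jq];
  rewrite ?eqxx ?(negbTE pq) ?(negbTE qp) // (negbTE jp) (negbTE jq).
Qed.

(** After normalising on the columns of [t], where [a] and [b] become unit vectors, all the
    determinants are 2 by 2 and the relation is a polynomial identity. *)
Lemma dtf_plucker_aux A s p q a b c d : p != q ->
  let F u v := dtf A (upd (upd s p u) q v) in
  F a b != 0 -> F a b * F c d - F a c * F b d + F a d * F b c = 0.
Proof.
move=> pq F Fab; have qp : q != p by rewrite eq_sym.
pose t := upd (upd s p a) q b.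
have FE u v : F u v = F a b *
    (nrm A t p u * nrm A t q v - nrm A t q u * nrm A t p v).
  rewrite -dtf_nrm2 // -[F a b]/(dtf A t) -dtf_nrm //.
  by apply: eq_dtf => j; rewrite /t /upd; case: eqP => // _; case: eqP.
have tp : t p = a by rewrite /t /upd (negbTE pq) eqxx.
have tq : t q = b by rewrite /t /upd eqxx.
have [pa pb qa qb] : [/\ nrm A t p a = 1, nrm A t p b = 0,
    nrm A t q a = 0 & nrm A t q b = 1].
  by rewrite -tp -tq !nrmE // !eqxx (negbTE pq) (negbTE qp).
rewrite (FE c d) (FE a c) (FE b d) (FE a d) (FE b c) pa pb qa qb. ring.
Qed.

(** [dtf_plucker_aux] needs a nonzero factor. Up to signs the relation is symmetric in [b], [c],
    [d], so any of [F a b], [F a c], [F a d] may serve; if all three vanish, so does every term. *)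
Lemma dtf_plucker A s p q a b c d : p != q ->
  let F u v := dtf A (upd (upd s p u) q v) in
  F a c * F b d = F a b * F c d + F a d * F b c.
Proof.
move=> pq F.
have anti u v : F u v = - F v u by exact: dtf_upd_swap.
have aux := @dtf_plucker_aux A s p q _ _ _ _ pq.
rewrite -/F /= in aux.
have [ab0|ab] := eqVneq (F a b) 0; last first.
  have H := aux a b c d ab.
  apply/eqP; rewrite -subr_eq0 -oppr_eq0; apply/eqP; rewrite -[RHS]H; ring.
have [ac0|ac] := eqVneq (F a c) 0; last first.
  have H := aux a c b d ac; rewrite (anti c b) in H.
  apply/eqP; rewrite -subr_eq0; apply/eqP; rewrite -[RHS]H; ring.
have [ad0|ad] := eqVneq (F a d) 0; first by rewrite ab0 ac0 ad0 !mul0r addr0.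
have H := aux a d b c ad; move: H; rewrite ab0 ac0 !mul0r subr0 addr0 => ->.
by rewrite addr0.
Qed.

End ColumnDeterminants.

Section Minors.
Local Open Scope ring_scope.
Variables (R : realType) (k n : nat).
Implicit Types (A : 'M[R]_(k, n)) (s t : 'I_k -> 'I_n) (J S : {set 'I_n}).

Definition sof J (hJ : #|J| = k) (j : 'I_k) : 'I_n :=
  enum_val (cast_ord (esym hJ) j).

Lemma sof_in J (hJ : #|J| = k) j : sof hJ j \in J.
Proof. exact: enum_valP. Qed.

Lemma sof_inj J (hJ : #|J| = k) : injective (sof hJ).
Proof. by move=> i j /enum_val_inj /cast_ord_inj. Qed.

Lemma sof_onto J (hJ : #|J| = k) c : c \in J -> exists j, sof hJ j = c.
Proof.
move=> cJ; exists (cast_ord hJ (enum_rank_in cJ c)).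
by rewrite /sof cast_ordK enum_rankK_in.
Qed.

Lemma sof_nth c0 J (hJ : #|J| = k) j : sof hJ j = nth c0 (enum J) j.
Proof. exact: enum_val_nth. Qed.

Lemma minor_sof A J (hJ : #|J| = k) : minor A J = dtf A (sof hJ).
Proof.
rewrite /minor /dtf; congr (\det _); apply/matrixP => i j; rewrite !mxE.
have js : (j < size (enum J))%N by rewrite -cardE hJ.
by rewrite (nth_map (sof hJ j)) // [in RHS](sof_nth (sof hJ j)).
Qed.

Lemma sof_lt J (hJ : #|J| = k) (i j : 'I_k) :
  (i < j)%N -> (sof hJ i < sof hJ j)%N.
Proof.
move=> ij; have js : (j < size (enum J))%N by rewrite -cardE hJ.
have so : sorted ltn (map val (enum J)).
  rewrite sorted_map /enum_mem; apply: sorted_filter.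
    by move=> a b c; apply: ltn_trans.
  by rewrite -enumT -sorted_map val_enum_ord iota_ltn_sorted.
have := sorted_ltn_nth ltn_trans 0%N so.
move=> /(_ i j); rewrite !inE size_map => /(_ (ltn_trans ij js) js ij).
rewrite !(nth_map (sof hJ j)) ?(ltn_trans ij js) //.
by rewrite -!sof_nth.
Qed.

(* Its minors are positive, hence the sign of [dtf vdm s] is the signature of the
   permutation sorting [s]. *)
Definition vdm : 'M[R]_(k, n) := \matrix_(i < k, c < n) (c%:R) ^+ i.

Lemma dtf_vdm s : dtf vdm s =
  \prod_(i < k) \prod_(j < k | (i < j)%N) ((s j)%:R - (s i)%:R).
Proof.
have := det_Vandermonde (\row_(j < k) ((s j)%:R : R)).
rewrite (_ : Vandermonde _ _ = \matrix_(i < k, j < k) vdm i (s j)); last first.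
  by apply/matrixP => i j; rewrite !mxE.
rewrite /dtf => ->; apply: eq_bigr => i _; apply: eq_bigr => j _.
by rewrite !mxE.
Qed.

Lemma vdm_incr_gt0 s : (forall i j : 'I_k, (i < j)%N -> (s i < s j)%N) ->
  0 < dtf vdm s.
Proof.
move=> sinc; rewrite dtf_vdm; apply: prodr_gt0 => i _.
by apply: prodr_gt0 => j ij; rewrite subr_gt0 ltr_nat; exact: sinc.
Qed.

Lemma vdm_neq0 s : injective s -> dtf vdm s != 0.
Proof.
move=> sinj; rewrite dtf_vdm; apply/prodf_neq0 => i _.
apply/prodf_neq0 => j ij; rewrite subr_eq0 eqr_nat.
by apply: contraTneq ij => /val_inj/sinj ->; rewrite ltnn.
Qed.

(** Sorting the columns multiplies both determinants by the same signature, and the Vandermonde one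
    is positive once sorted. Questions about signatures thus become questions about products of
    differences. *)
Lemma minor_vdm A J s : #|J| = k -> injective s -> (forall j, s j \in J) ->
  minor A J = dtf A s * Num.sg (dtf vdm s).
Proof.
move=> hJ sinj sJ; rewrite (minor_sof A hJ).
have [p pE] : exists p : 'I_k -> 'I_k, forall j, sof hJ (p j) = s j.
  apply: (@fin_all_exists _ (fun=> 'I_k) (fun j i => sof hJ i = s j)) => j.
  exact: sof_onto (sJ j).
have pinj : injective p by move=> i j pij; apply: sinj; rewrite -!pE pij.
have sE B : dtf B s = (-1) ^+ perm pinj * dtf B (sof hJ).
  by rewrite -dtf_perm; apply: eq_dtf => j /=; rewrite permE pE.
rewrite !sE sgrM [Num.sg (dtf vdm _)]gtr0_sg; last first.
  by apply: vdm_incr_gt0 => i j; exact: sof_lt.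
rewrite mulr1 mulrC mulrA; case: (odd_perm _).
  by rewrite expr1 sgrN sgr1 mulrNN !mul1r.
by rewrite expr0 sgr1 !mul1r.
Qed.

Lemma minor_incr A J s : #|J| = k -> (forall j, s j \in J) ->
  (forall i j : 'I_k, (i < j)%N -> (s i < s j)%N) -> minor A J = dtf A s.
Proof.
move=> hJ sJ sinc; rewrite (@minor_vdm A J s) // ?gtr0_sg ?mulr1 //.
  exact: vdm_incr_gt0.
move=> i j sij; apply/val_inj/eqP; rewrite eqn_leq.
apply/andP; split; rewrite leqNgt; apply/negP => /sinc; by rewrite sij ltnn.
Qed.

Lemma minor_neq0_dtf A J s : #|J| = k -> injective s -> (forall j, s j \in J) ->
  (minor A J != 0) = (dtf A s != 0).
Proof.
move=> hJ sinj sJ; rewrite (minor_vdm A hJ sinj sJ) mulf_eq0 sgr_eq0.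
by rewrite (negbTE (vdm_neq0 sinj)) orbF.
Qed.

Lemma dtf_neq0_minor A s : dtf A s != 0 -> minor A (s @: 'I_k) != 0.
Proof.
move=> A0; have sinj := dtf_neq0_inj A0.
have hJ : #|s @: 'I_k| = k by rewrite card_imset // card_ord.
by rewrite (minor_neq0_dtf A hJ sinj) // => j; apply/imsetP; exists j.
Qed.

(** The factors that do not involve position [p] are common to both determinants and give a square.
    The difference [s j - u] occurs reversed exactly when [s j - v] does, so the orientation
    cancels. *)
Lemma vdm_upd s p u v : exists2 r : R, 0 <= r &
  dtf vdm (upd s p u) * dtf vdm (upd s p v) =
  r * \prod_(j < k | j != p) (((s j)%:R - u%:R) * ((s j)%:R - v%:R)).
Proof.
have split w : dtf vdm (upd s p w) =
    (\prod_(j < k | j != p) (if (p < j)%N then (s j)%:R - w%:R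
                             else w%:R - (s j)%:R)) *
    \prod_(i < k | i != p) \prod_(j < k | (i < j)%N && (j != p))
      ((s j)%:R - (s i)%:R).
  rewrite dtf_vdm (bigD1 p) //=.
  rewrite [X in _ * X](eq_bigr (fun i : 'I_k =>
    (if (p < i)%N then 1 else w%:R - (s i)%:R) *
    \prod_(j < k | (i < j)%N && (j != p)) ((s j)%:R - (s i)%:R))); last first.
    move=> i ip; rewrite /upd (negbTE ip).
    have [pi|ip'] := ltnP p i.
      rewrite mul1r; apply: eq_big => j; last first.
        by case: eqP => // ->; rewrite ltnNge (ltnW pi).
      by case: eqP => [->|]; rewrite ?andbT //= ltnNge (ltnW pi).
    have {}ip' : (i < p)%N 
      by rewrite ltn_neqAle ip' andbT.
    rewrite (bigD1 p) //= eqxx; congr (_ * _); apply: eq_bigr => j.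
    by move=> /andP[_ /negbTE ->].
  rewrite big_split /= mulrA; congr (_ * _).
  rewrite [in LHS](big_mkcond (fun j : 'I_k => (p < j)%N)) /=.
  rewrite (bigD1 p) //= ltnn mul1r -big_split /=.
  apply: eq_bigr => j jp; rewrite /upd eqxx (negbTE jp).
  by case: ifP => _; rewrite ?mulr1 ?mul1r.
set r := \prod_(i < k | i != p) _ in split.
exists (r * r); first exact: sqr_ge0.
rewrite !split mulrACA [RHS]mulrC; congr (_ * _).
rewrite -big_split /=; apply: eq_bigr => j _.
by case: ifP => _ //; rewrite -mulrNN !opprB.
Qed.

Lemma vdm_upd_sg s p u v : injective (upd s p u) -> injective (upd s p v) ->
  (forall j, j != p -> 0 < ((s j)%:R - u%:R) * ((s j)%:R - v%:R) :> R) ->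
  Num.sg (dtf vdm (upd s p u)) = Num.sg (dtf vdm (upd s p v)).
Proof.
move=> /vdm_neq0 u0 /vdm_neq0 v0 uv.
have [r r0 E] := vdm_upd s p u v.
have : 0 < dtf vdm (upd s p u) * dtf vdm (upd s p v).
  rewrite lt_neqAle eq_sym mulf_neq0 //= E mulr_ge0 //.
  by apply: prodr_ge0 => j /uv/ltW.
have [h|h|h] := ltrgt0P (dtf vdm (upd s p u)).
- by rewrite pmulr_rgt0 // => h'; rewrite !gtr0_sg.
- by rewrite nmulr_rgt0 // => h'; rewrite !ltr0_sg.
- by rewrite h mul0r ltxx.
Qed.

(** Pairing the two determinants with column [a], and the two with column [d], produces the same
    product [G] over the other columns twice, hence a square. With [vdm_upd4'], the three products
    of the Plucker relation carry the same sign. *)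
Lemma vdm_upd4 s p q (a b c d : 'I_n) : p != q ->
  let w u v := dtf vdm (upd (upd s p u) q v) in
  (a < b)%N -> (b < c)%N -> (c < d)%N ->
  w a c != 0 -> w b d != 0 -> w a b != 0 -> w c d != 0 ->
  0 < (w a c * w b d) * (w a b * w c d).
Proof.
move=> pq w ab bc cd ac0 bd0 ab0 cd0.
rewrite lt_neqAle eq_sym !mulf_neq0 //=.
have comm u v : upd (upd s p u) q v =1 upd (upd s q v) p u.
  by move=> j; rewrite /upd; case: eqP => // ->; rewrite eq_sym (negbTE pq).
pose G := \prod_(j < k | (j != p) && (j != q))
  (((s j)%:R - b%:R) * ((s j)%:R - c%:R)) : R.
have [r1 r10 E1] : exists2 r : R, 0 <= r & w a c * w a b = r * G.
  have [r r0 E] := vdm_upd (upd s p a) q c b.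
  exists (r * ((a%:R - c%:R) * (a%:R - b%:R))).
    by apply: mulr_ge0 => //; rewrite -mulrNN !opprB mulr_ge0 // subr_ge0 ler_nat; lia.
  rewrite /w E -mulrA; congr (_ * _).
  rewrite (bigD1 p) //= /upd eqxx; congr (_ * _).
  apply: eq_big => [j|j /andP[_ /negbTE ->]]; first by rewrite andbC.
  by rewrite mulrC.
have [r2 r20 E2] : exists2 r : R, 0 <= r & w b d * w c d = r * G.
  have [r r0 E] := vdm_upd (upd s q d) p b c.
  exists (r * ((d%:R - b%:R) * (d%:R - c%:R))).
    by rewrite !mulr_ge0 // subr_ge0 ler_nat; lia.
  rewrite /w !(eq_dtf _ (comm _ _)) E -mulrA; congr (_ * _).
  rewrite (bigD1 q) 1?eq_sym //= /upd eqxx; congr (_ * _).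
  by apply: eq_bigr => j /andP[_ /negbTE ->].
rewrite mulrACA E1 E2 mulrACA; apply: mulr_ge0; first exact: mulr_ge0.
by rewrite -expr2 sqr_ge0.
Qed.


Lemma vdm_upd4' s p q (a b c d : 'I_n) : p != q ->
  let w u v := dtf vdm (upd (upd s p u) q v) in
  (a < b)%N -> (b < c)%N -> (c < d)%N ->
  w a c != 0 -> w b d != 0 -> w a d != 0 -> w b c != 0 ->
  0 < (w a c * w b d) * (w a d * w b c).
Proof.
move=> pq w ab bc cd ac0 bd0 ad0 bc0.
rewrite lt_neqAle eq_sym !mulf_neq0 //=.
have E (u x y : 'I_n) : 0 <= (u%:R - x%:R) * (u%:R - y%:R) :> R ->
    exists2 r : R, 0 <= r & w u x * w u y =
      r * \prod_(j < k | (j != p) && (j != q))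
        (((s j)%:R - x%:R) * ((s j)%:R - y%:R)).
  have [r r0 E] := vdm_upd (upd s p u) q x y.
  exists (r * ((u%:R - x%:R) * (u%:R - y%:R))); first exact: mulr_ge0.
  rewrite /w E -mulrA; congr (_ * _).
  rewrite (bigD1 p) //= /upd eqxx; congr (_ * _).
  by apply: eq_big => [j|j /andP[_ /negbTE -> //]]; rewrite andbC.
have [|r1 r10 E1] := E a c d.
  by rewrite -mulrNN !opprB mulr_ge0 // subr_ge0 ler_nat; lia.
have [|r2 r20 E2] := E b c d.
  by rewrite -mulrNN !opprB mulr_ge0 // subr_ge0 ler_nat; lia.
rewrite mulrACA E1 (mulrC (w b d)) E2 mulrACA; apply: mulr_ge0.
  exact: mulr_ge0.
by rewrite -expr2 sqr_ge0.
Qed.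

End Minors.

(** * Operations on two adjacent columns *)

Section ColumnOperations.
Local Open Scope ring_scope.
Variables (R : realType) (k n : nat).
Implicit Types (A B : 'M[R]_(k, n)) (s t : 'I_k -> 'I_n) (J S : {set 'I_n}).

Lemma upd_inj s p u : injective s -> (forall j, j != p -> s j != u) ->
  injective (upd s p u).
Proof.
move=> sinj su i j; rewrite /upd.
case: eqP => [->|/eqP ip]; case: eqP => [->|/eqP jp] //.
- by move=> uj; have := su _ jp; rewrite -uj eqxx.
- by move=> uj; have := su _ ip; rewrite uj eqxx.
- exact: sinj.
Qed.

Lemma card_exchange J u v : u \in J -> v \notin J -> #|v |: (J :\ u)| = #|J|.
Proof.
move=> uJ vJ; rewrite cardsU1 !inE negb_and vJ orbT /=.
by rewrite (cardsD1 u J) uJ.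
Qed.

Lemma minor_cols A B J : (forall i c, c \in J -> A i c = B i c) ->
  minor A J = minor B J.
Proof.
move=> AB; congr (\det _); apply/matrixP => i j; rewrite !mxE; congr (_`_j).
by apply/eq_in_map => c; rewrite mem_enum => /AB ->.
Qed.

Lemma minor_mulmx (G : 'M[R]_k) A J : #|J| = k ->
  minor (G *m A) J = \det G * minor A J.
Proof. by move=> hJ; rewrite !(minor_sof _ hJ) dtf_mulmx. Qed.

(** No label of [J] lies between [u] and [u'], so the exchanged list is still sorted and no sign
    appears. *)
Lemma minor_upd_adjacent A J (hJ : #|J| = k) p (u' : 'I_n) :
  let u := sof hJ p in
  (val u' == u.+1) || (val u == u'.+1) -> u' \notin J ->
  minor A (u' |: J :\ u) = dtf A (upd (sof hJ) p u').
Proof.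
move=> u uu' u'J; set s := sof hJ.
have sinj : injective s by exact: sof_inj.
have su' j : s j != u' by apply: contraNneq u'J => <-; exact: sof_in.
have s'inj : injective (upd s p u') by exact: upd_inj.
have hJ' : #|u' |: J :\ u| = k by rewrite card_exchange // sof_in.
have updE : upd s p u =1 s by move=> j; rewrite /upd; case: eqP => [->|].
have uinj : injective (upd s p u) by move=> i j; rewrite !updE; exact: sinj.
rewrite (@minor_vdm _ _ _ _ _ (upd s p u')) //; last first.
  move=> j; rewrite /upd !inE; case: (eqVneq j p) => [_|jp].
    by rewrite eqxx.
  by rewrite (inj_eq sinj) jp sof_in orbT.
rewrite (vdm_upd_sg s'inj uinj) => [|j jp].
  rewrite (eq_dtf _ updE) gtr0_sg ?mulr1 //; apply: vdm_incr_gt0 => i j.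
  exact: sof_lt.
have ju : val (s j) != val u by rewrite (inj_eq val_inj) (inj_eq sinj).
have ju' : val (s j) != val u' by rewrite (inj_eq val_inj).
have [lt|ge] := ltnP (s j) u.
  by rewrite -mulrNN !opprB mulr_gt0 // subr_gt0 ltr_nat; move: lt ju ju' uu' => /=; lia.
by rewrite mulr_gt0 // subr_gt0 ltr_nat; move: ge ju ju' uu' => /=; lia.
Qed.

(** Right multiplication by a 2 by 2 block; deleting and adding a corner, for zero and nonzero
    entries, are four instances. *)
Definition act (l l1 : 'I_n) (a b c d : R) A : 'M[R]_(k, n) :=
  \matrix_(i, j) if j == l then a * A i l + b * A i l1
                 else if j == l1 then c * A i l + d * A i l1 else A i j.

Lemma act_mulmx l l1 a b c d (G : 'M[R]_k) A :
  act l l1 a b c d (G *m A) = G *m act l l1 a b c d A.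
Proof.
apply/matrixP => i j; rewrite !mxE.
have dist (x y : R) (u v : 'I_n) : x * \sum_e G i e * A e u +
    y * \sum_e G i e * A e v = \sum_e G i e * (x * A e u + y * A e v).
  by rewrite !mulr_sumr -big_split; apply: eq_bigr => e _ /=; ring.
case: (eqVneq j l) => [jl|jl]; [|case: (eqVneq j l1) => [jl1|jl1]];
  rewrite ?dist; apply: eq_bigr => e _; rewrite mxE.
- by rewrite jl eqxx.
- by rewrite (negbTE jl) jl1 eqxx.
- by rewrite (negbTE jl) (negbTE jl1).
Qed.

Variables (l l1 : 'I_n) (a b c d : R).
Hypothesis ll1 : val l1 = l.+1.

Let l1l : (l1 == l) = false.
Proof. by apply/negbTE/eqP => /(congr1 val); rewrite ll1 => /eqP; rewrite (gtn_eqF (ltnSn _)). Qed.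

Let ll1' : (l == l1) = false. Proof. by rewrite eq_sym. Qed.

Lemma minor_act0 A J : l \notin J -> l1 \notin J ->
  minor (act l l1 a b c d A) J = minor A J.
Proof.
move=> lJ l1J; apply: minor_cols => i e eJ; rewrite mxE.
case: eqP => [el|_]; first by rewrite -el eJ in lJ.
by case: eqP => [el|_] //; rewrite -el eJ in l1J.
Qed.

Lemma minor_actL A J : #|J| = k -> l \in J -> l1 \notin J ->
  minor (act l l1 a b c d A) J = a * minor A J + b * minor A (l1 |: J :\ l).
Proof.
move=> hJ lJ l1J; have [p pl] := sof_onto hJ lJ.
have := @minor_upd_adjacent A J hJ p l1; rewrite pl => ->; rewrite ?ll1 ?eqxx //.
rewrite !(minor_sof _ hJ).
apply: (@det_col_linear _ _ _ _ _ p) => [i|i j jp|i j jp]; rewrite !mxE /upd.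
- by rewrite pl !eqxx.
- have jl : sof hJ j == l = false.
    by rewrite -pl (inj_eq (@sof_inj _ _ _ hJ)); apply/negbTE.
  rewrite jl; case: eqP => // jl1; by rewrite -jl1 sof_in in l1J.
- rewrite (negbTE jp); have jl : sof hJ j == l = false.
    by rewrite -pl (inj_eq (@sof_inj _ _ _ hJ)); apply/negbTE.
  rewrite jl; case: eqP => // jl1; by rewrite -jl1 sof_in in l1J.
Qed.

Lemma minor_actR A J : #|J| = k -> l \notin J -> l1 \in J ->
  minor (act l l1 a b c d A) J = d * minor A J + c * minor A (l |: J :\ l1).
Proof.
move=> hJ lJ l1J; have [p pl] := sof_onto hJ l1J.
have := @minor_upd_adjacent A J hJ p l; rewrite pl => ->; rewrite ?ll1 ?eqxx ?orbT //.
rewrite !(minor_sof _ hJ).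
apply: (@det_col_linear _ _ _ _ _ p) => [i|i j jp|i j jp]; rewrite !mxE /upd.
- by rewrite pl !eqxx l1l addrC.
- have jl : sof hJ j == l1 = false.
    by rewrite -pl (inj_eq (@sof_inj _ _ _ hJ)); apply/negbTE.
  rewrite jl; case: eqP => // jl1; by rewrite -jl1 sof_in in lJ.
- rewrite (negbTE jp); have jl : sof hJ j == l1 = false.
    by rewrite -pl (inj_eq (@sof_inj _ _ _ hJ)); apply/negbTE.
  rewrite jl; case: eqP => // jl1; by rewrite -jl1 sof_in in lJ.
Qed.

Lemma minor_act2 A J : #|J| = k -> l \in J -> l1 \in J ->
  minor (act l l1 a b c d A) J = (a * d - b * c) * minor A J.
Proof.
move=> hJ lJ l1J; have [p pl] := sof_onto hJ lJ; have [q ql1] := sof_onto hJ l1J.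
set s := sof hJ; have sinj : injective s by exact: sof_inj.
have pq : p != q by apply/eqP => pq; move: ll1'; rewrite -pl -ql1 pq eqxx.
rewrite !(minor_sof _ hJ) -/s.
have other j : j != p -> j != q -> (s j == l = false) * (s j == l1 = false).
  by move=> jp jq; rewrite -pl -ql1 -/s !(inj_eq sinj) (negbTE jp) (negbTE jq).
pose M u v : 'M[R]_k := \matrix_(i, j) if j == p then u i else if j == q then v i
  else A i (s j).
have E u v : dtf A (upd (upd s p u) q v) = \det (M (A^~ u) (A^~ v)).
  congr (\det _); apply/matrixP => i j; rewrite !mxE /upd.
  have [->|jq] := eqVneq j q; last by case: ifP.
  by rewrite eq_sym (negbTE pq).
have Eact : dtf (act l l1 a b c d A) s =
    \det (M (fun i => a * A i l + b * A i l1) (fun i => c * A i l + d * A i l1)).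
  congr (\det _); apply/matrixP => i j; rewrite !mxE.
  case: (eqVneq j p) => [->|jp]; first by rewrite [s p]pl eqxx.
  case: (eqVneq j q) => [->|jq]; first by rewrite [s q]ql1 l1l eqxx.
  by rewrite !other.
have lin2 u v w e f : \det (M u (fun i => e * v i + f * w i)) =
    e * \det (M u v) + f * \det (M u w).
  apply: (@det_col_linear _ _ _ _ _ q) => [i|i j|i j]; rewrite !mxE.
  - by rewrite eqxx eq_sym (negbTE pq).
  - by move=> /negbTE ->.
  - by move=> /negbTE ->.
have lin1 u v w e f : \det (M (fun i => e * v i + f * w i) u) =
    e * \det (M v u) + f * \det (M w u).
  apply: (@det_col_linear _ _ _ _ _ p) => [i|i j|i j]; rewrite !mxE.
  - by rewrite eqxx.
  - by move=> /negbTE ->.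
  - by move=> /negbTE ->.
have diag u : dtf A (upd (upd s p u) q u) = 0.
  by apply: (@dtf_noninj _ _ _ _ _ p q) => //; rewrite /upd eqxx; case: ifP; rewrite ?eqxx.
rewrite Eact lin1 !lin2 -!E !diag (@dtf_upd_swap _ _ _ A s p q l1 l) //.
rewrite (_ : dtf A (upd (upd s p l) q l1) = dtf A s); first by ring.
apply: eq_dtf => j; rewrite /upd; case: eqP => [->//|_].
by case: eqP => [->|].
Qed.

End ColumnOperations.

(** * The three-term Plucker relation for sorted columns *)

Section Plucker.
Local Open Scope ring_scope.
Variables (R : realType) (k n : nat).
Implicit Types (A B : 'M[R]_(k, n)) (s t : 'I_k -> 'I_n) (J S : {set 'I_n}).

Lemma minor_plucker A S (a b c d : 'I_n) : #|S|.+2 = k ->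
  (a < b)%N -> (b < c)%N -> (c < d)%N ->
  a \notin S -> b \notin S -> c \notin S -> d \notin S ->
  let D u v := minor A (u |: (v |: S)) in
  D a c * D b d = D a b * D c d + D a d * D b c.
Proof.
move=> hS ab bc cd aS bS cS dS D.
have hJ u v : u \notin S -> v \notin S -> (u < v)%N -> #|u |: (v |: S)| = k.
  move=> uS vS uv; rewrite cardsU1 !inE negb_or uS andbT cardsU1 vS.
  by rewrite (_ : u != v) //; apply/eqP => E; rewrite E ltnn in uv.
have hab := hJ _ _ aS bS ab.
have [p pa] : exists p, sof hab p = a by apply: sof_onto; rewrite !inE eqxx.
have [q qb] : exists q, sof hab q = b by apply: sof_onto; rewrite !inE eqxx orbT.
set s := sof hab in pa qb *; have sinj : injective s by exact: sof_inj.
have pq : p != q by apply/eqP => pq; move: ab; rewrite -{1}pa pq qb ltnn.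
have sS j : j != p -> j != q -> s j \in S.
  move=> jp jq; have := sof_in hab j; rewrite !inE -/s => /or3P[||//].
    by rewrite -[X in _ == X]pa (inj_eq sinj) (negbTE jp).
  by rewrite -[X in _ == X]qb (inj_eq sinj) (negbTE jq).
pose f u v := upd (upd s p u) q v.
have finj u v : u \notin S -> v \notin S -> (u < v)%N -> injective (f u v).
  move=> uS vS uv; have neS w j : w \notin S -> j != p -> j != q -> s j != w.
    by move=> wS jp jq; apply: contraNneq wS => <-; exact: sS.
  move=> i j; rewrite /f /upd.
  have [-> |iq] := eqVneq i q; have [-> // |jq] := eqVneq j q.
  - have [_|jp] := eqVneq j p; first by move=> E; rewrite E ltnn in uv.
    by move=> E; have := neS v _ vS jp jq; rewrite E eqxx.
  - have [_|ip] := eqVneq i p; first by move=> E; rewrite E ltnn in uv.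
    by move=> E; have := neS v _ vS ip iq; rewrite E eqxx.
  have [-> |ip] := eqVneq i p; have [-> // |jp] := eqVneq j p.
  - by move=> E; have := neS u _ uS jp jq; rewrite E eqxx.
  - by move=> E; have := neS u _ uS ip iq; rewrite E eqxx.
  exact: sinj.
have fin u v j : f u v j \in u |: (v |: S).
  rewrite /f /upd !inE; have [_|jq] := eqVneq j q; first by rewrite eqxx orbT.
  by have [_|jp] := eqVneq j p; rewrite ?eqxx // sS ?orbT.
have DE u v : u \notin S -> v \notin S -> (u < v)%N ->
    D u v = dtf A (f u v) * Num.sg (dtf (vdm R k n) (f u v)).
  by move=> uS vS uv; apply: minor_vdm; [exact: hJ|exact: finj|exact: fin].
pose w u v := dtf (vdm R k n) (f u v).
have w0 u v : u \notin S -> v \notin S -> (u < v)%N -> w u v != 0.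
  by move=> uS vS uv; apply/vdm_neq0/finj.
have ac := ltn_trans ab bc; have bd := ltn_trans bc cd.
have ad := ltn_trans ab bd.
have sg2 (x y : R) : 0 < x * y -> Num.sg x = Num.sg y.
  move=> xy; have [h|h|h] := ltrgt0P x.
  - by move: xy; rewrite pmulr_rgt0 // => h'; rewrite !gtr0_sg.
  - by move: xy; rewrite nmulr_rgt0 // => h'; rewrite !ltr0_sg.
  - by move: xy; rewrite h mul0r ltxx.
have sg_ab : Num.sg (w a c * w b d) = Num.sg (w a b * w c d).
  by apply: sg2; apply: vdm_upd4 => //; exact: w0.
have sg_ad : Num.sg (w a c * w b d) = Num.sg (w a d * w b c).
  by apply: sg2; apply: vdm_upd4' => //; exact: w0.
rewrite !DE // -!/(w _ _).
rewrite ![_ * Num.sg _ * (_ * _)]mulrACA -!sgrM -sg_ab -sg_ad -mulrDl.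
by congr (_ * _); apply: dtf_plucker.
Qed.

End Plucker.

(** * Boundary labels of a partition *)

Section Partitions.
Variables (k n : nat).
Hypothesis hkn : (k <= n)%N.
Implicit Types (lam : partition_in k (n - k)) (i : 'I_k) (j : 'I_(n - k)).

Lemma partition_mono lam i i' : i <= i' -> val lam i' <= val lam i.
Proof. by move: (valP lam) => /forallP/(_ i)/forallP/(_ i')/implyP; apply. Qed.

Lemma partition_bound lam i : val lam i <= n - k.
Proof. by rewrite -ltnS ltn_ord. Qed.

Lemma vlabel_ltn lam i : vlabel lam i < n.
Proof.
rewrite /vlabel; have := ltn_ord i; have := partition_bound lam i; lia.
Qed.

Definition vlab lam i : 'I_n := Ordinal (vlabel_ltn lam i).

Lemma vlab_lt lam (i i' : 'I_k) : i < i' -> vlab lam i < vlab lam i'.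
Proof.
move=> ii'; rewrite /= /vlabel; have := partition_mono lam (ltnW ii').
have := partition_bound lam i; lia.
Qed.

Lemma vlab_le lam (i i' : 'I_k) : (vlab lam i <= vlab lam i') = (i <= i').
Proof.
apply/idP/idP => [|]; first by apply: contraTT; rewrite -!ltnNge; exact: vlab_lt.
by rewrite leq_eqVlt => /predU1P[/val_inj -> //|/(vlab_lt lam)/ltnW].
Qed.

Lemma vlab_inj lam : injective (vlab lam).
Proof.
move=> i i' /(congr1 val) /= E; apply/val_inj/eqP.
by rewrite eqn_leq -!(vlab_le lam) /= E leqnn.
Qed.

Lemma vlabE lam : vertical_labels lam = vlab lam @: 'I_k.
Proof.
apply/setP => l; rewrite inE; apply/existsP/imsetP => [[i /eqP li]|[i _ ->]].
  by exists i => //; apply: val_inj.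
by exists i.
Qed.

Lemma vlab_in lam i : vlab lam i \in vertical_labels lam.
Proof. by rewrite vlabE; apply/imsetP; exists i. Qed.

Lemma card_vlab lam : #|vertical_labels lam| = k.
Proof. by rewrite vlabE card_imset ?card_ord //; exact: vlab_inj. Qed.

Lemma minor_vlab (R : realType) (A : 'M[R]_(k, n)) lam :
  minor A (vertical_labels lam) = dtf A (vlab lam).
Proof.
apply: minor_incr; [exact: card_vlab|exact: vlab_in|exact: vlab_lt].
Qed.

Lemma hlabel_eq lam j (i : nat) : i <= k ->
  (forall i' : 'I_k, (j < val lam i') = (i' < i)) ->
  hlabel lam j = n - k - j.+1 + i.
Proof.
move=> ik ji; rewrite /hlabel; congr (_ + _).
have winj : injective (widen_ord ik).
  by move=> x y /(congr1 val) /= E; exact: val_inj.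
rewrite -[RHS](card_ord i) -(card_imset 'I_i winj); apply: eq_card => i'.
apply/idP/imsetP => [|[x _ ->]]; rewrite in_setE /= inE /= ji.
  by move=> ii'; exists (Ordinal ii') => //; apply: val_inj.
exact: (ltn_ord x).
Qed.

(** Row lengths decrease, so the rows having a box in column [j] form an initial segment; its length
    gives [hlabel] in closed form. *)
Lemma hlabel_rows lam j : exists2 i : nat, i <= k &
  forall i' : 'I_k, (j < val lam i') = (i' < i).
Proof.
have [/existsP[i0 Hi0]|/existsPn H] := boolP [exists i : 'I_k, val lam i <= j]; last first.
  exists k => // i'; rewrite ltn_ord ltnNge; exact: H.
case: (@arg_minnP _ i0 (fun i => val lam i <= j) (fun i : 'I_k => val i) Hi0) => i Hi imin.
exists i => [|i']; first exact: ltnW.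
apply/idP/idP; last by rewrite ltnNge => i'i; rewrite ltnNge; apply: contra i'i => /imin.
by apply: contraTT; rewrite -!leqNgt => /(partition_mono lam) h; exact: leq_trans h Hi.
Qed.

Lemma hlabel_vlabel lam i j : hlabel lam j != vlabel lam i.
Proof.
have [r rk hr] := hlabel_rows lam j; rewrite (hlabel_eq rk hr) /vlabel.
have := hr i; have := ltn_ord j; have := partition_bound lam i.
by case: (ltnP j (val lam i)); case: (ltnP i r) => //; lia.
Qed.

Lemma hlabel_inj lam : injective (hlabel lam).
Proof.
have mono j j' : j < j' -> hlabel lam j' < hlabel lam j.
  move=> jj'; have [r rk hr] := hlabel_rows lam j; rewrite (hlabel_eq rk hr).
  have [r' rk' hr'] := hlabel_rows lam j'; rewrite (hlabel_eq rk' hr').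
  have := ltn_ord j'; have : r' <= r; last by lia.
  rewrite leqNgt; apply/negP => rr'.
  have rk2 : r < k by apply: leq_trans rr' rk'.
  have := hr (Ordinal rk2); have := hr' (Ordinal rk2); rewrite /= ltnn rr' => h h'.
  by have := ltn_trans jj' h; rewrite h'.
move=> j j' E; apply: val_inj; case: (ltngtP j j') => [/mono|/mono|//];
  by rewrite E ltnn.
Qed.

(** All rows below [i0] are empty. A path leaving row [i0] downwards therefore reaches the boundary
    at once, and the pivots of the later rows come after both labels being changed. *)
Definition corner lam lam' (i0 : 'I_k) (j0 : 'I_(n - k)) :=
  [/\ val lam i0 = j0.+1 :> nat, forall i, i0 < i -> val lam i = 0 :> nat,
      val lam' i0 = j0 :> nat & forall i, i != i0 -> val lam' i = val lam i].

Lemma cornerP lam : (forall i, val lam i = 0 :> nat) \/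
  exists lam' i0 j0, corner lam lam' i0 j0.
Proof.
have [/existsP[i1 Hi1]|/existsPn H] := boolP [exists i : 'I_k, 0 < val lam i]; last first.
  by left => i; apply/eqP; rewrite -leqn0 leqNgt; exact: H.
right; case: (@arg_maxnP _ i1 (fun i => 0 < val lam i) (fun i : 'I_k => val i) Hi1) => i0 Hi imax.
have Hj : (val lam i0).-1 < n - k by have := partition_bound lam i0; lia.
have Hj' : (val lam i0).-1 < (n - k).+1 by lia.
pose f : {ffun 'I_k -> 'I_(n - k).+1} :=
  [ffun i => if i == i0 then Ordinal Hj' else val lam i].
have zero i : i0 < i -> val lam i = 0 :> nat.
  move=> ii; apply/eqP; rewrite -leqn0 leqNgt; apply/negP => /imax h.
  by have := leq_ltn_trans h ii; rewrite ltnn.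
have fP : [forall i : 'I_k, forall i' : 'I_k, (i <= i') ==> (f i' <= f i)].
  apply/forallP => i; apply/forallP => i'; apply/implyP => ii'; rewrite !ffunE.
  have [ei'|ni'] := eqVneq i' i0; have [ei|ni] := eqVneq i i0 => //=.
  - by apply: leq_trans (leq_pred _) _; rewrite -ei'; exact: partition_mono.
  - rewrite zero // -ei ltn_neqAle ii' andbT ei eq_sym; exact: ni'.
  - exact: partition_mono.
exists (exist _ f fP), i0, (Ordinal Hj); split => //=.
- by rewrite prednK.
- by rewrite /f ffunE eqxx.
- by move=> i /negbTE ii0; rewrite /f ffunE ii0.
Qed.

Section Corner.
Variables (lam lam' : partition_in k (n - k)) (i0 : 'I_k) (j0 : 'I_(n - k)).
Hypothesis hc : corner lam lam' i0 j0.
Let l := vlab lam i0.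
Let l1 := vlab lam' i0.

Lemma corner_succ : val l1 = l.+1.
Proof.
case: hc => c1 _ c3 _; rewrite /= /vlabel c1 c3.
by have := ltn_ord j0; lia.
Qed.

Lemma corner_vlab i : i != i0 -> vlab lam' i = vlab lam i.
Proof. by case: hc => _ _ _ c4 ii; apply: val_inj; rewrite /= /vlabel c4. Qed.

Lemma corner_diagram i j :
  (j < val lam i) = (j < val lam' i) || ((i == i0) && (j == j0)).
Proof.
case: hc => c1 _ c3 c4; have [->|ii] := eqVneq i i0; last by rewrite c4 // orbF.
by rewrite c1 c3 ltnS leq_eqVlt orbC.
Qed.

Lemma corner_hlabel_neq j : j != j0 -> hlabel lam' j = hlabel lam j.
Proof.
move=> jj; rewrite /hlabel; congr (_ + _); apply: eq_card => i.
by apply/idP/idP; rewrite !in_setE /= !inE /= corner_diagram (negbTE jj) andbF orbF.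
Qed.

Lemma corner_hlabel : hlabel lam j0 = l1.
Proof.
case: (hc) => c1 c2 c3 c4.
rewrite (@hlabel_eq _ _ i0.+1) // => [|i'].
  by rewrite /= /vlabel c3; have := ltn_ord j0; lia.
rewrite ltnS; apply/idP/idP; last by move/(partition_mono lam); rewrite c1.
by apply: contraTT; rewrite -ltnNge => /c2 ->.
Qed.

Lemma corner_hlabel' : hlabel lam' j0 = l.
Proof.
case: (hc) => c1 c2 c3 c4.
rewrite (@hlabel_eq _ _ i0) // => [||i']; last 2 first.
- exact: ltnW.
- have := corner_diagram i' j0; rewrite eqxx andbT => E.
  have : (j0 < val lam i') = (i' <= i0).
    apply/idP/idP; last by move/(partition_mono lam); rewrite c1.
    by apply: contraTT; rewrite -ltnNge => /c2 ->.
  rewrite E; have [->|ii] := eqVneq i' i0; first by rewrite c3 !ltnn.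
  by rewrite orbF => ->; rewrite ltn_neqAle (inj_eq val_inj) ii.
by rewrite /= /vlabel c1; have := ltn_ord j0; lia.
Qed.

Lemma corner_notin : l1 \notin vertical_labels lam.
Proof.
rewrite vlabE; apply/imsetP => -[i _] /(congr1 val) E.
by have := hlabel_vlabel lam i j0; rewrite corner_hlabel E eqxx.
Qed.

Lemma corner_notin' : l \notin vertical_labels lam'.
Proof.
rewrite vlabE; apply/imsetP => -[i _] /(congr1 val) E.
by have := hlabel_vlabel lam' i j0; rewrite corner_hlabel' E eqxx.
Qed.

Lemma corner_labels : vertical_labels lam' = l1 |: (vertical_labels lam :\ l).
Proof.
apply/setP => c; rewrite in_setU1 in_setD1 (vlabE lam').
apply/imsetP/idP => [[i _ ->]|].
  have [->|ii] := eqVneq i i0; first by rewrite eqxx.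
  by rewrite corner_vlab // vlab_in andbT orbC (inj_eq (@vlab_inj lam)) ii.
case/predU1P => [->|/andP[cl]]; first by exists i0.
rewrite vlabE => /imsetP[i _ ci]; exists i => //.
by rewrite ci corner_vlab //; apply: contraNneq cl => ii; rewrite ci ii.
Qed.

Lemma corner_sum : (\sum_i val lam i = (\sum_i val lam' i).+1)%N.
Proof.
case: hc => c1 c2 c3 c4.
rewrite (bigD1 i0) //= [in RHS](bigD1 i0) //= c1 c3 addSn; congr (_ + _).+1.
by apply: eq_bigr => i /c4 ->.
Qed.

End Corner.
End Partitions.

(** * Echelon forms and the Gale order *)

Section Echelon.
Local Open Scope ring_scope.
Variables (R : realType) (k n : nat).
Hypothesis hkn : (k <= n)%N.
Implicit Types (A B : 'M[R]_(k, n)) (J S : {set 'I_n}).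
Implicit Types (lam : partition_in k (n - k)).
Notation vl := (vlab hkn).
Notation VL := (@vertical_labels k n).

(** Pointwise comparison of these counts is the Gale order on [k]-subsets: larger counts mean
    smaller labels. *)
Definition cnt J (c : nat) : nat := (\sum_(y in J) (y <= c))%N.

Lemma cnt_exchange J (u v : 'I_n) c : u \in J -> v \notin J ->
  (cnt (v |: J :\ u) c + (u <= c) = cnt J c + (v <= c))%N.
Proof.
move=> uJ vJ; rewrite /cnt big_setU1 /=; last by rewrite !inE negb_and vJ orbT.
by rewrite [in RHS](big_setD1 u uJ) /= addnC addnCA addnC.
Qed.

(** Pivots are not normalised and the entries above them are not cleared: deleting a corner
    preserves this form, but not the reduced one. *)
Definition echelon lam A :=
  (forall i (c : 'I_n), (c < vl lam i)%N -> A i c = 0) /\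
  (forall i, A i (vl lam i) != 0).

(** Minimality of [VL lam] in the Gale order depends only on the matroid and is invariant under
    GL_k, unlike [echelon]. *)
Definition gale lam A := minor A (VL lam) != 0 /\
  forall J, #|J| = k -> minor A J != 0 -> forall c, (cnt J c <= cnt (VL lam) c)%N.

(** The factor [minor A (VL lam)] makes the condition independent of the representative: a change of
    basis multiplies the product by a square. *)
Definition tnn lam A := forall J, #|J| = k -> 0 <= minor A J * minor A (VL lam).

Lemma cnt_vlab lam c : cnt (VL lam) c = (\sum_(i < k) (vl lam i <= c))%N.
Proof. by rewrite (vlabE hkn) /cnt big_imset //= => i j _ _; exact: vlab_inj. Qed.

Lemma echelon_dtf A (s : 'I_k -> 'I_n) :
  (forall i j : 'I_k, (j < i)%N -> A i (s j) = 0) ->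
  dtf A s = \prod_i A i (s i).
Proof.
move=> As; rewrite /dtf -det_tr det_trig.
  by apply: eq_bigr => i _; rewrite !mxE.
by apply/is_trig_mxP => i j ij; rewrite !mxE As.
Qed.

(** A nonzero minor has a nonzero term in its expansion: a bijection sending each row to a column of
    [J] at or after the pivot of that row. Counting labels along it gives the inequality. *)
Lemma echelon_gale lam A : echelon lam A -> gale lam A.
Proof.
case=> A0 A1; split.
  rewrite (minor_vlab hkn) echelon_dtf => [|i j ji]; first exact/prodf_neq0.
  by apply: A0; exact: vlab_lt.
move=> J hJ; rewrite (minor_sof _ hJ) => dJ c.
have [p Hp] : exists p : 'S_k, forall i, A i (sof hJ (p i)) != 0.
  apply: contrapT => /forallNP H; case/eqP: dJ; rewrite /dtf /determinant.
  apply: big1 => p _; have /existsNP[i /negP/negPn/eqP Hi] := H p.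
  by rewrite (bigD1 i) //= mxE Hi mul0r mulr0.
have -> : cnt J c = (\sum_i (sof hJ (p i) <= c))%N.
  rewrite -(reindex_inj (h := p) (F := fun i => nat_of_bool (sof hJ i <= c)%N)
    (P := xpredT) perm_inj) /=.
  have JE : J = sof hJ @: 'I_k.
    apply/setP => y; apply/idP/imsetP => [/(sof_onto hJ)[j <-]|[j _ ->]].
      by exists j.
    exact: sof_in.
  rewrite {1}JE /cnt big_imset //= => i j _ _; exact: sof_inj.
rewrite cnt_vlab; apply: leq_sum => i _.
have : (vl lam i <= sof hJ (p i))%N.
  by rewrite leqNgt; apply: contra (Hp i) => /A0 ->.
case: (leqP (sof hJ (p i)) c) => // h1 h2.
by rewrite (leq_trans h2 h1).
Qed.

Lemma gale_mulmx lam (G : 'M[R]_k) A : G \in unitmx ->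
  gale lam (G *m A) <-> gale lam A.
Proof.
rewrite unitmxE unitfE => G0; rewrite /gale minor_mulmx ?card_vlab //.
have mE J : #|J| = k -> (minor (G *m A) J != 0) = (minor A J != 0).
  by move=> hJ; rewrite minor_mulmx // mulf_eq0 negb_or G0.
split=> -[]; rewrite mulf_eq0 negb_or ?G0 => H1 H2; split=> // J hJ.
  by rewrite -mE //; exact: H2.
by rewrite mE //; exact: H2.
Qed.

Lemma tnn_mulmx lam (G : 'M[R]_k) A : G \in unitmx ->
  tnn lam (G *m A) <-> tnn lam A.
Proof.
rewrite unitmxE unitfE => G0; have GG : 0 < \det G * \det G.
  by rewrite -expr2 exprn_even_gt0.
by split=> H J hJ; have := H J hJ; rewrite !minor_mulmx ?card_vlab //
   mulrACA (pmulr_rge0 _ GG).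
Qed.

Lemma image_upd lam i c : upd (vl lam) i c @: 'I_k = c |: VL lam :\ vl lam i.
Proof.
apply/setP => y; rewrite in_setU1 in_setD1 (vlabE hkn); apply/imsetP/idP => [[j _ ->]|].
  rewrite /upd; case: (eqVneq j i) => [_|ji]; first by rewrite eqxx.
  by rewrite (inj_eq (@vlab_inj _ _ hkn lam)) ji /= orbC imset_f.
case/predU1P => [->|/andP[yi /imsetP[j _ yj]]].
  by exists i; rewrite // /upd eqxx.
exists j => //; rewrite /upd; case: eqP => // ji; by rewrite yj ji eqxx in yi.
Qed.

Lemma nrm_neq0_minor lam A i c : minor A (VL lam) != 0 ->
  nrm A (vl lam) i c != 0 -> (c == vl lam i) || (c \notin VL lam) /\
    minor A (c |: VL lam :\ vl lam i) != 0.
Proof.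
rewrite (minor_vlab hkn) => A0; rewrite -(dtf_nrm1 i c A0) => dc.
have {}dc : dtf A (upd (vl lam) i c) != 0 by rewrite (dtf_nrm _ A0) mulf_neq0.
have := dtf_neq0_minor dc; rewrite image_upd => mc.
have [//|/= cI] := boolP (_ || _).
move: cI; rewrite negb_or negbK => /andP[ci]; rewrite (vlabE hkn) => /imsetP[j _ cj].
have ji : j != i by apply: contraNneq ci => <-; rewrite cj.
have /(_ j i) := dtf_neq0_inj dc; rewrite /upd eqxx (negbTE ji) => /(_ (esym cj)) E.
by rewrite E eqxx in ji.
Qed.

(** By Cramer's rule, a nonzero entry before the pivot of row [i] is a nonzero minor obtained by
    exchanging the pivot for an earlier label [c]; its count at [c] would be too large. *)
Lemma gale_echelon lam A : gale lam A -> echelon lam (nrm A (vl lam)).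
Proof.
case=> A0 Ag; split=> [i c ci|i]; last first.
  by rewrite nrmE ?eqxx ?oner_eq0 // -(minor_vlab hkn).
apply/eqP; apply: contraTT ci => Bc.
have [/predU1P[->|cI] mc] := nrm_neq0_minor A0 Bc; first by rewrite ltnn.
have := Ag _ _ mc c; rewrite card_exchange ?vlab_in // card_vlab // => /(_ erefl).
have := cnt_exchange c (vlab_in hkn lam i) cI; rewrite leqnn.
by rewrite -leqNgt; case: (leqP (vl lam i) c) => //=; lia.
Qed.

Lemma gale_echelonP lam A : gale lam A ->
  exists2 G : 'M[R]_k, G \in unitmx & echelon lam (G *m A).
Proof.
move=> Ag; exists (invmx (\matrix_(i < k, j < k) A i (vl lam j))).
  by rewrite unitmx_inv; apply: dtf_unit; rewrite -(minor_vlab hkn); case: Ag.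
exact: (gale_echelon Ag).
Qed.

End Echelon.

(** * Deleting a corner box *)

Section CornerStep.
Local Open Scope ring_scope.
Variables (R : realType) (k n : nat).
Implicit Types (A B : 'M[R]_(k, n)) (J S : {set 'I_n}).

(* The effect on a representative of deleting, resp. adding, a corner box with
   entry [x]. *)
Definition peel (l l1 : 'I_n) (x : R) A : 'M[R]_(k, n) :=
  if x == 0 then act l l1 0 (-1) 1 0 A else act l l1 x (-1) 0 1 A.

Definition unpeel (l l1 : 'I_n) (x : R) A : 'M[R]_(k, n) :=
  if x == 0 then act l l1 0 1 (-1) 0 A else act l l1 x^-1 x^-1 0 1 A.

Lemma peel_mulmx l l1 x (G : 'M[R]_k) A :
  peel l l1 x (G *m A) = G *m peel l l1 x A.
Proof. by rewrite /peel; case: ifP => _; rewrite act_mulmx. Qed.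

Lemma unpeel_mulmx l l1 x (G : 'M[R]_k) A :
  unpeel l l1 x (G *m A) = G *m unpeel l l1 x A.
Proof. by rewrite /unpeel; case: ifP => _; rewrite act_mulmx. Qed.

Definition delta (l l1 : 'I_n) (x : R) A J :=
  x * minor A J - minor A (l1 |: J :\ l).

Section AdjacentLabels.
Variables (l l1 : 'I_n) (x : R).
Hypothesis ll1 : val l1 = l.+1.

Let l1l : (l1 == l) = false.
Proof. by apply/negbTE/eqP => /(congr1 val); rewrite ll1 => /eqP; rewrite (gtn_eqF (ltnSn _)). Qed.

Lemma peelK A : unpeel l l1 x (peel l l1 x A) = A.
Proof.
rewrite /peel /unpeel; have [x0|x0] := eqVneq x 0; apply/matrixP => i j;
  rewrite !mxE !eqxx l1l; case: eqP => [->|_]; rewrite ?l1l; try (case: eqP => [->|_] //).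
- by ring.
- by ring.
- by field.
- by ring.
Qed.

Lemma unpeelK A : peel l l1 x (unpeel l l1 x A) = A.
Proof.
rewrite /peel /unpeel; have [x0|x0] := eqVneq x 0; apply/matrixP => i j;
  rewrite !mxE !eqxx l1l; case: eqP => [->|_]; rewrite ?l1l; try (case: eqP => [->|_] //).
- by ring.
- by ring.
- by field.
- by ring.
Qed.

Lemma minor_peel0 A J : l \notin J -> l1 \notin J ->
  minor (peel l l1 x A) J = minor A J.
Proof. by move=> lJ l1J; rewrite /peel; case: ifP => _; rewrite minor_act0. Qed.

Lemma minor_peelL A J : #|J| = k -> l \in J -> l1 \notin J ->
  minor (peel l l1 x A) J = delta l l1 x A J.
Proof.
move=> hJ lJ l1J; rewrite /peel /delta; case: eqP => [->|_];
  by rewrite (minor_actL _ _ _ _ ll1) // mulN1r.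
Qed.

Lemma minor_peelR A J : #|J| = k -> l \notin J -> l1 \in J ->
  minor (peel l l1 x A) J =
  if x == 0 then minor A (l |: J :\ l1) else minor A J.
Proof.
move=> hJ lJ l1J; rewrite /peel; case: eqP => _;
  rewrite (minor_actR _ _ _ _ ll1) //; ring.
Qed.

Lemma minor_peel2 A J : #|J| = k -> l \in J -> l1 \in J ->
  minor (peel l l1 x A) J = (if x == 0 then 1 else x) * minor A J.
Proof.
move=> hJ lJ l1J; rewrite /peel; case: eqP => _;
  rewrite (minor_act2 _ _ _ _ ll1) //; ring.
Qed.

Lemma minor_unpeel0 A J : l \notin J -> l1 \notin J ->
  minor (unpeel l l1 x A) J = minor A J.
Proof. by move=> lJ l1J; rewrite /unpeel; case: ifP => _; rewrite minor_act0. Qed.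

Lemma minor_unpeelL A J : #|J| = k -> l \in J -> l1 \notin J ->
  minor (unpeel l l1 x A) J =
  if x == 0 then minor A (l1 |: J :\ l)
  else x^-1 * (minor A J + minor A (l1 |: J :\ l)).
Proof.
move=> hJ lJ l1J; rewrite /unpeel; case: eqP => _;
  rewrite (minor_actL _ _ _ _ ll1) //; ring.
Qed.

(** The minus sign for [x = 0] threatens positivity. For Le-diagrams it is harmless: the minors of
    [A] containing [l] but not [l1] then vanish, by [loops_star]. *)
Lemma minor_unpeelR A J : #|J| = k -> l \notin J -> l1 \in J ->
  minor (unpeel l l1 x A) J =
  if x == 0 then - minor A (l |: J :\ l1) else minor A J.
Proof.
move=> hJ lJ l1J; rewrite /unpeel; case: eqP => _;
  rewrite (minor_actR _ _ _ _ ll1) //; ring.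
Qed.

Lemma minor_unpeel2 A J : #|J| = k -> l \in J -> l1 \in J ->
  minor (unpeel l l1 x A) J = (if x == 0 then 1 else x^-1) * minor A J.
Proof.
move=> hJ lJ l1J; rewrite /unpeel; case: eqP => _;
  rewrite (minor_act2 _ _ _ _ ll1) //; ring.
Qed.

Ltac set_cases H1 H2 :=
  apply/setP => ?; rewrite !inE;
  repeat match goal with
  | |- context [?y == ?e] => is_var y; is_var e;
       case: (eqVneq y e) => [->|_]; rewrite ?H1 ?H2 ?eqxx ?orbT ?andbT ?andbF //=
  end.

Lemma delta_step A J (e b : 'I_n) : #|J| = k -> l \in J -> l1 \notin J ->
  (e < l)%N -> (l1 < b)%N -> b \in J -> e \notin J ->
  delta l l1 x A J * minor A (e |: J :\ b) =
  minor A J * delta l l1 x A (e |: J :\ b) +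
  minor A (e |: J :\ l) * minor A (l1 |: J :\ b).
Proof.
move=> hJ lJ l1J el l1b bJ eJ.
have lel1 : (l < l1)%N by rewrite [X in (_ < X)%N]ll1.
have lb : (l < b)%N by apply: ltn_trans l1b.
have lt_ne (u v : 'I_n) : (u < v)%N -> ((u == v) = false) * ((v == u) = false).
  move=> uv; rewrite [v == u]eq_sym.
  by split; apply/negbTE; rewrite -(inj_eq val_inj) ltn_eqF.
have eE := (lt_ne _ _ el, lt_ne _ _ (ltn_trans el lel1),
  lt_ne _ _ (ltn_trans el lb), lt_ne _ _ lel1, lt_ne _ _ lb, lt_ne _ _ l1b).
pose S := J :\ l :\ b.
have bl : b \in J :\ l by rewrite !inE eE bJ.
have hS : #|S|.+2 = k by rewrite -hJ (cardsD1 l J) lJ (cardsD1 b (J :\ l)) bl.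
have [eS lS l1S bS] : [/\ e \notin S, l \notin S, l1 \notin S & b \notin S].
  by rewrite !inE !eqxx (negbTE eJ) (negbTE l1J) !andbF.
have inJ := (lJ, bJ, negbTE l1J, negbTE eJ).
have J1 : J = l |: (b |: S) by set_cases eE inJ.
have J2 : e |: J :\ b = e |: (l |: S) by set_cases eE inJ.
have J3 : e |: J :\ l = e |: (b |: S) by set_cases eE inJ.
have J4 : l1 |: J :\ b = l |: (l1 |: S) by set_cases eE inJ.
have J5 : l1 |: J :\ l = l1 |: (b |: S) by set_cases eE inJ.
have J6 : l1 |: (e |: J :\ b) :\ l = e |: (l1 |: S) by set_cases eE inJ.
rewrite /delta J3 J4 J5 J6 J2 J1.
have := @minor_plucker R k n A S e l l1 b hS el lel1 l1b eS lS l1S bS => /= H.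
rewrite mulrBl -mulrA.
have -> : minor A (l1 |: (b |: S)) * minor A (e |: (l |: S)) =
   minor A (e |: (l1 |: S)) * minor A (l |: (b |: S)) -
   minor A (e |: (b |: S)) * minor A (l |: (l1 |: S)).
  by rewrite H; ring.
ring.
Qed.

End AdjacentLabels.
End CornerStep.

(** * Total nonnegativity after deleting a corner *)

Section CornerPeel.
Local Open Scope ring_scope.
Variables (R : realType) (k n : nat).
Hypothesis hkn : (k <= n)%N.
Implicit Types (A B : 'M[R]_(k, n)) (J S : {set 'I_n}).
Notation vl := (vlab hkn).
Notation VL := (@vertical_labels k n).
Variables (lam lam' : partition_in k (n - k)) (i0 : 'I_k) (j0 : 'I_(n - k)).
Hypothesis hc : corner lam lam' i0 j0.
Let l := vl lam i0.
Let l1 := vl lam' i0.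
Let ll1 : val l1 = l.+1 := corner_succ hkn hc.
Let l1E : nat_of_ord l1 = l.+1 := ll1.
Let l1I : l1 \notin VL lam := corner_notin hkn hc.

Definition cx A : R := minor A (VL lam') / minor A (VL lam).

Lemma cx_mulmx (G : 'M[R]_k) A : G \in unitmx -> cx (G *m A) = cx A.
Proof.
rewrite unitmxE unitfE => G0; rewrite /cx !minor_mulmx ?(card_vlab hkn) //.
by rewrite -mulf_div mulfV ?mul1r.
Qed.

Lemma delta_mulmx (G : 'M[R]_k) x A J : #|J| = k -> l \in J -> l1 \notin J ->
  delta l l1 x (G *m A) J = \det G * delta l l1 x A J.
Proof.
move=> hJ lJ l1J; rewrite /delta !minor_mulmx ?card_exchange //; ring.
Qed.

(** The pivots of these rows come after [l], and [l1] is not a pivot. *)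
Lemma after_corner (i : 'I_k) (c : nat) : (c <= l1)%N -> (i0 < i)%N -> (c < vl lam i)%N.
Proof.
move=> cl1 ii; apply: leq_ltn_trans cl1 _; rewrite ltn_neqAle [val l1]ll1.
rewrite (vlab_lt hkn lam ii) andbT -ll1; apply: contraNneq l1I => E.
by rewrite (_ : l1 = vl lam i) ?vlab_in //; apply: val_inj.
Qed.

(** Both minors are triangular, hence products of diagonal entries, and these products differ only
    in row [i0]. *)
Lemma echelon_cx A : echelon hkn lam A -> cx A = A i0 l1 / A i0 l.
Proof.
case=> A0 A1; rewrite /cx !(minor_vlab hkn).
rewrite (@echelon_dtf _ _ _ A (vl lam)); last first.
  by move=> i j ji; apply: A0; exact: vlab_lt.
rewrite echelon_dtf; last first.
  move=> i j ji; have [jj|jj] := eqVneq j i0; last first.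
    by apply: A0; rewrite (corner_vlab hkn hc) // vlab_lt.
  by apply: A0; rewrite jj in ji *; exact: after_corner.
rewrite (bigD1 i0) //= [X in _ / X](bigD1 i0) //=.
rewrite (eq_bigr (fun i => A i (vl lam i))) => [|i ii]; last first.
  by rewrite (corner_vlab hkn hc).
rewrite -mulf_div mulfV ?mulr1 //; exact/prodf_neq0.
Qed.

(** The ratio [cx A] is the value of x for which x v_l - v_l1 vanishes in row [i0]; the pivot of
    that row then moves from [l] to [l1]. *)
Lemma peel_echelon A : echelon hkn lam A -> echelon hkn lam' (peel l l1 (cx A) A).
Proof.
move=> Ae; have cE := echelon_cx Ae; case: Ae => A0 A1; set x := cx A in cE *; clearbody x.
have A0l : A i0 l != 0 by exact: A1.
have pE i c : c != l -> c != l1 -> peel l l1 x A i c = A i c.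
  by move=> /negbTE cl /negbTE cl1; rewrite /peel; case: ifP => _; rewrite mxE cl cl1.
have pl i : peel l l1 x A i l = x * A i l - A i l1.
  by rewrite /peel; have [->|_] := eqVneq x 0; rewrite mxE eqxx; ring.
have l1l : (l1 == l) = false by rewrite -(inj_eq val_inj) ll1 gtn_eqF.
have pl1 i : peel l l1 x A i l1 = if x == 0 then A i l else A i l1.
  by rewrite /peel; have [_|_] := eqVneq x 0; rewrite mxE eqxx l1l; ring.
split=> [i c|i].
- have [->|ii] := eqVneq i i0 => [cl1|].
    have [->|cl] := eqVneq c l; first by rewrite pl cE divfK // subrr.
    have c1 : c != l1 by apply: contraTneq cl1 => ->; rewrite ltnn.
    rewrite pE //; apply: A0; move: cl1; rewrite [val (vl lam' i0)]ll1 ltnS.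
    by rewrite leq_eqVlt (inj_eq val_inj) (negbTE cl).
  rewrite (corner_vlab hkn hc) // => ci.
  have il1 : vl lam i != l1 by apply: contraNneq l1I => <-; exact: vlab_in.
  have [cl|cl] := eqVneq c l; last have [cl1|cl1] := eqVneq c l1; last first.
  - by rewrite pE // A0.
  - rewrite cl1 in ci *; rewrite pl1; case: ifP => _; rewrite A0 //.
    by apply: leq_trans ci; rewrite ll1; exact: leqW.
  - rewrite cl in ci *; rewrite pl !A0 ?mulr0 ?subr0 //.
    rewrite ltn_neqAle eq_sym (inj_eq val_inj) il1 andTb.
    by rewrite (_ : nat_of_ord l1 = l.+1).
- have [->|ii] := eqVneq i i0.
    rewrite pl1; have [//|x0] := eqVneq x 0.
    have -> : A i0 l1 = x * A i0 l by rewrite cE divfK.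
    by rewrite mulf_neq0.
  rewrite (corner_vlab hkn hc) // pE //.
    by rewrite (inj_eq (@vlab_inj _ _ _ _)).
  by apply: contraNneq l1I => <-; exact: vlab_in.
Qed.

Lemma gale_peel A : gale lam A -> gale lam' (peel l l1 (cx A) A).
Proof.
move=> /(gale_echelonP hkn)[G Gu Ge].
apply/(gale_mulmx hkn _ _ Gu); rewrite -peel_mulmx -(cx_mulmx _ Gu).
exact/echelon_gale/peel_echelon.
Qed.

(** In dual form: x v_l - v_l1 lies in the span of the columns before [l]. A form [f] killing these
    columns has no coefficient on the rows above [i0]; the rows below vanish at [l] and [l1], and
    row [i0] cancels by the choice of x. *)
Lemma echelon_span A (f : 'I_k -> R) : echelon hkn lam A ->
  (forall c : 'I_n, (c < l)%N -> \sum_i f i * A i c = 0) ->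
  \sum_i f i * (cx A * A i l - A i l1) = 0.
Proof.
move=> Ae fA; have cE := echelon_cx Ae; case: Ae => A0 A1.
have f0 (m : nat) : forall i : 'I_k, (i < m)%N -> (i < i0)%N -> f i = 0.
  elim: m => // m IH i im ii; have := fA (vl lam i) (vlab_lt hkn lam ii).
  rewrite (bigD1 i) //= big1 ?addr0 => [/eqP|j ji].
    by rewrite mulf_eq0 (negbTE (A1 i)) orbF => /eqP.
  have [lt|ge] := ltnP j i.
    rewrite IH ?mul0r //; last exact: ltn_trans lt ii.
    by apply: leq_trans lt _; rewrite -ltnS.
  rewrite A0 ?mulr0 // vlab_lt // ltn_neqAle ge andbT eq_sym; exact: ji.
apply: big1 => i _; case: (ltngtP i i0) => ii.
- by rewrite (f0 i.+1) ?mul0r.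
- rewrite !A0 ?mulr0 ?subrr ?mulr0 //; apply: after_corner => //.
  by rewrite ll1.
- have -> : i = i0 by exact: val_inj.
  by rewrite cE divfK ?subrr ?mulr0 //; exact: A1.
Qed.

(** [A'] has x v_l - v_l1 in place of v_l, and [B] holds the coordinates of the columns of [A] in
    the basis given by the columns [J] of [A']. By [echelon_span], some column [e < l] has a nonzero
    coordinate along the new vector. If no [b] worked for this [e], subtracting a multiple of v_e
    from v_l would leave a combination of columns before [l]; row [i0] vanishes on these and on v_e,
    but not on v_l. *)
Lemma delta_exchange_echelon A J : echelon hkn lam A -> #|J| = k -> l \in J ->
  l1 \notin J -> delta l l1 (cx A) A J != 0 ->
  exists e b : 'I_n, [/\ (e < l)%N, (l1 < b)%N, b \in J, e \notin J &
    minor A (e |: J :\ b) != 0].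
Proof.
move=> Ae hJ lJ l1J; set x := cx A.
pose A' := act l l1 x (-1) 0 1 A; have -> : delta l l1 x A J = minor A' J.
  by rewrite /A' (minor_actL _ _ _ _ ll1) // mulN1r.
rewrite (minor_sof _ hJ); set s := sof hJ => A's0.
have sinj : injective s by exact: sof_inj.
have [p0 sp0] : exists p, s p = l by exact: sof_onto.
set M := \matrix_(i < k, j < k) A' i (s j).
have Mu : M \in unitmx by exact: dtf_unit.
pose G := invmx M; pose B := G *m A.
have NE : nrm A' s = act l l1 x (-1) 0 1 B by rewrite /nrm -act_mulmx.
have sl j : j != p0 -> s j != l by move=> jp; rewrite -sp0 (inj_eq sinj).
have sl1 j : s j != l1 by apply: contraNneq l1J => <-; exact: sof_in.
have Bs i j : j != p0 -> B i (s j) = (i == j)%:R.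
  move=> jp; rewrite -(nrmE i j A's0) NE [RHS]mxE.
  by rewrite (negbTE (sl _ jp)) (negbTE (sl1 _)).
have Bl i : x * B i l - B i l1 = (i == p0)%:R.
  by rewrite -(nrmE i p0 A's0) NE sp0 [RHS]mxE eqxx mulN1r.
have [e el Be] : exists2 e : 'I_n, (e < l)%N & B p0 e != 0.
  apply: contrapT => H; have := Bl p0; rewrite eqxx => /eqP.
  have := @echelon_span A (fun i => G p0 i) Ae; rewrite -/x => span.
  suff -> : x * B p0 l - B p0 l1 = 0 by rewrite eq_sym oner_eq0.
  rewrite -[RHS]span => [|c cl].
    rewrite !mxE mulr_sumr -sumrB; apply: eq_bigr => i _; ring.
  apply/eqP; apply: contrapT => /negP c0; apply: H; exists c => //.
  by rewrite mxE.
have eJ : e \notin J.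
  apply/negP => /(sof_onto hJ)[j]; rewrite -/s => je.
  have jp : j != p0 by apply: contraTneq el => jp; rewrite -je jp sp0 ltnn.
  by move: Be; rewrite -je Bs // [p0 == j]eq_sym (negbTE jp) eqxx.
apply: contrapT => H.
(* Up to the factor [\det G], this is the minor of [J] with [b = s q] replaced by [e]: the columns
   of [J] other than [l] are unit vectors in [B]. *)
have minors0 q : (l1 < s q)%N -> B p0 l * B q e - B q l * B p0 e = 0.
  move=> l1q; apply/eqP; apply: contrapT => /negP d0; apply: H.
  exists e, (s q); split=> //; first exact: sof_in.
  have qp : q != p0.
    apply: contraTneq l1q => ->; rewrite sp0 -leqNgt [X in (_ <= X)%N]ll1; exact: leqnSn.
  have pq : p0 != q by rewrite eq_sym.
  have se j : s j != e by apply: contraNneq eJ => <-; exact: sof_in.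
  rewrite (@minor_neq0_dtf _ _ _ _ _ (upd s q e)).
  - have G0 : \det G != 0 by rewrite -unitfE -unitmxE unitmx_inv.
    rewrite -(mulrI_eq0 _ (lregP G0)) -dtf_mulmx -/B.
    apply: contraNneq d0 => <-.
    rewrite -(det_setcol2 (fun i => B i l) (fun i => B i e) pq).
    apply/eqP; congr (\det _); apply/matrixP => i j.
    apply/esym; rewrite [LHS]mxE [RHS]mxE /upd.
    have [//|jq] := eqVneq j q; rewrite [RHS]mxE.
    have [->|jp] := eqVneq j p0; first by rewrite sp0.
    by rewrite Bs // [RHS]mxE.
  - by rewrite card_exchange // sof_in.
  - exact: upd_inj.
  - move=> j; rewrite /upd !inE; case: (eqVneq j q) => [_|jq]; first by rewrite eqxx.
    by rewrite (inj_eq sinj) jq sof_in orbT.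
have AE : A = M *m B by rewrite mulmxA mulmxV // mul1mx.
have AE' c : A i0 c = \sum_j A' i0 (s j) * B j c.
  by rewrite [in LHS]AE mxE; apply: eq_bigr => j _; rewrite [M _ _]mxE.
(* The coordinates [w] of v_l - t v_e vanish at [p0] by the choice of [t], and at the labels beyond
   [l1] by [minors0]. *)
pose t := B p0 l / B p0 e.
pose w i := B i l - t * B i e.
have wE : A i0 l - t * A i0 e = \sum_j A' i0 (s j) * w j.
  rewrite !AE' mulr_sumr -sumrB; apply: eq_bigr => j _.
  by rewrite /w; ring.
have [A0 A1] := Ae; have := A1 i0; rewrite -/l => /eqP; apply.
suff : A i0 l - t * A i0 e = 0 by rewrite (A0 i0 e) // mulr0 subr0.
rewrite wE; apply: big1 => j _.
have [->|jp] := eqVneq j p0.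
  by rewrite /w /t divfK // subrr mulr0.
case: (ltngtP (s j) l1) => [lt|gt|E]; last by have := sl1 j; rewrite (val_inj E) eqxx.
  rewrite [A' _ _]mxE (negbTE (sl _ jp)) (negbTE (sl1 _)) A0 ?mul0r //.
  by move: lt; rewrite ll1 ltnS leq_eqVlt (inj_eq val_inj) (negbTE (sl _ jp)).
rewrite (_ : w j = 0) ?mulr0 //; apply/eqP; rewrite -(mulrI_eq0 _ (lregP Be)).
rewrite /w /t -oppr_eq0 -(minors0 _ gt); apply/eqP; field.
exact: Be.
Qed.

Lemma delta_exchange A J : gale lam A -> #|J| = k -> l \in J ->
  l1 \notin J -> delta l l1 (cx A) A J != 0 ->
  exists e b : 'I_n, [/\ (e < l)%N, (l1 < b)%N, b \in J, e \notin J &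
    minor A (e |: J :\ b) != 0].
Proof.
move=> /(gale_echelonP hkn)[G Gu Ge] hJ lJ l1J d0.
have G0 : \det G != 0 by rewrite -unitfE -unitmxE.
have [|e [b [el l1b bJ eJ m0]]] := @delta_exchange_echelon (G *m A) J Ge hJ lJ l1J.
  by rewrite cx_mulmx // delta_mulmx // mulf_neq0.
exists e, b; split=> //; move: m0; rewrite minor_mulmx ?card_exchange //.
by rewrite mulf_eq0 negb_or => /andP[].
Qed.

Definition right_part J : nat := #|[pred b in J | (l1 < b)%N]|.

Lemma right_part_exchange J (e b : 'I_n) : (e < l)%N -> (l1 < b)%N -> b \in J ->
  e \notin J -> (right_part (e |: J :\ b) < right_part J)%N.
Proof.
move=> el l1b bJ eJ; apply: proper_card; apply/properP; split.
  apply/fintype.subsetP => y; rewrite !inE => /andP[/predU1P[->|/andP[_ ->] //]].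
  by rewrite ltnNge l1E (leq_trans (ltnW el)) // leqnSn.
exists b; rewrite !inE ?bJ //= eqxx andFb orbF; apply/negP => /andP[/eqP be _].
by rewrite -be bJ in eJ.
Qed.

Lemma exchange_labels J (e b : 'I_n) : (e < l)%N -> (l1 < b)%N -> l \in J ->
  l1 \notin J -> (l \in e |: J :\ b) /\ (l1 \notin e |: J :\ b).
Proof.
move=> el l1b lJ l1J; have lel1 : (l < l1)%N by rewrite ll1.
rewrite !inE lJ (negbTE l1J) andbT andbF orbF; split.
  by rewrite orbC -(inj_eq val_inj) (ltn_eqF (ltn_trans lel1 l1b)).
by rewrite -(inj_eq val_inj) (gtn_eqF (ltn_trans el lel1)).
Qed.

Lemma cx_ge0 A : tnn lam A -> 0 <= cx A.
Proof.
move=> /(_ (VL lam') (card_vlab hkn _)) h; rewrite /cx.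
have [->|m0] := eqVneq (minor A (VL lam)) 0; first by rewrite invr0 mulr0.
rewrite -(pmulr_lge0 _ (_ : 0 < minor A (VL lam) ^+ 2)).
  by rewrite expr2 mulrA divfK.
by rewrite exprn_even_gt0.
Qed.

Lemma delta_ge0 A J : gale lam A -> tnn lam A -> #|J| = k -> l \in J ->
  l1 \notin J -> 0 <= delta l l1 (cx A) A J * minor A (VL lam).
Proof.
move=> Ag At; have [m mJ] := ubnP (right_part J).
elim: m J mJ => // m IH J mJ hJ lJ l1J.
have [->|d0] := eqVneq (delta l l1 (cx A) A J) 0; first by rewrite mul0r.
have [e [b [el l1b bJ eJ m0]]] := delta_exchange Ag hJ lJ l1J d0.
have st := delta_step (cx A) ll1 A hJ lJ l1J el l1b bJ eJ.
have hJ' : #|e |: J :\ b| = k by rewrite card_exchange.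
have [lJ' l1J'] := exchange_labels el l1b lJ l1J.
set V := minor A (VL lam) in IH *; have V0 : V != 0 by case: Ag.
have mpos : 0 < minor A (e |: J :\ b) * V.
  by rewrite lt_neqAle eq_sym mulf_neq0 //=; exact: At.
rewrite -(pmulr_lge0 _ mpos) mulrACA st mulrDl; apply: addr_ge0.
  rewrite mulrACA; apply: mulr_ge0; first exact: At.
  by apply: IH => //; rewrite -ltnS; apply: leq_trans mJ; rewrite ltnS right_part_exchange.
by rewrite mulrACA; apply: mulr_ge0; apply: At; rewrite card_exchange.
Qed.

Lemma minor_peel_base A : gale lam A -> minor (peel l l1 (cx A) A) (VL lam') =
  (if cx A == 0 then 1 else cx A) * minor A (VL lam).
Proof.
move=> [A0 _]; rewrite (minor_peelR (cx A) ll1 A (card_vlab hkn lam')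
  (corner_notin' hkn hc) (vlab_in hkn lam' i0)).
have lI : l \in VL lam by exact: vlab_in.
case: eqP => _; last by rewrite /cx divfK.
rewrite mul1r (corner_labels hkn hc) -/l -/l1; congr (minor _ _).
apply/setP => y; rewrite !in_setU1 !in_setD1 in_setU1 in_setD1.
have l1l : (l == l1) = false by rewrite -(inj_eq val_inj) ll1 ltn_eqF.
have [->|yl] := eqVneq y l; first by rewrite lI.
have [->|yl1] := eqVneq y l1; first by rewrite (negbTE l1I).
by [].
Qed.

Lemma tnn_peel A : gale lam A -> tnn lam A -> tnn lam' (peel l l1 (cx A) A).
Proof.
move=> Ag At J hJ; rewrite minor_peel_base //.
set y := if _ then _ else _; have y0 : 0 <= y.
  by rewrite /y; case: ifP => // _; exact: cx_ge0.
rewrite mulrCA; apply: mulr_ge0 => //.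
have [lJ|lJ] := boolP (l \in J); have [l1J|l1J] := boolP (l1 \in J).
- by rewrite minor_peel2 // -/y -mulrA mulr_ge0 // At.
- by rewrite minor_peelL // delta_ge0.
- by rewrite minor_peelR //; case: ifP => _; apply: At; rewrite ?card_exchange.
- by rewrite minor_peel0 // At.
Qed.

End CornerPeel.

(** * Boundary measurements *)

Section Scan.
Local Open Scope ring_scope.
Variable R : realType.
Implicit Types (r v : nat -> R).

(* If [r] is a row of a tableau and [v j] the weight of the paths leaving this
   row downwards in column [j], then [hscan r v j] is the weight of the paths
   moving left along this row from the right of column [j.-1], and [vscan r v j]
   that of the paths coming down onto the row in column [j]. *)
Fixpoint hscan r v (j : nat) : R :=
  if j is j'.+1 then
    if r j' == 0 then hscan r v j' else r j' * (v j' + hscan r v j')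
  else 0.

Definition vscan r v (j : nat) : R := if r j == 0 then v j else v j + hscan r v j.

Lemma hscan_ext r r' v v' J : (forall j, (j < J)%N -> r j = r' j) ->
  (forall j, (j < J)%N -> v j = v' j) -> hscan r v J = hscan r' v' J.
Proof.
elim: J => // J IH rE vE /=; rewrite rE // vE // IH // => j jJ.
  by apply: rE; exact: leqW.
by apply: vE; exact: leqW.
Qed.

Lemma hscan_tail r v J J' : (J <= J')%N -> (forall j, (J <= j)%N -> r j = 0) ->
  hscan r v J' = hscan r v J.
Proof.
move=> JJ' r0; rewrite -(subnKC JJ'); elim: (J' - J)%N => [|d IH].
  by rewrite addn0.
by rewrite addnS /= r0 ?leq_addr // eqxx.
Qed.

Lemma hscan0 r v J : (forall j, (j < J)%N -> v j = 0) -> hscan r v J = 0.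
Proof.
elim: J => // J IH v0 /=; rewrite v0 // IH => [|j jJ]; last by apply: v0; exact: leqW.
by rewrite addr0 mulr0; case: ifP.
Qed.

Lemma hscan_comb r v v1 v2 c J : (forall j, v j = v1 j + c * v2 j) ->
  hscan r v J = hscan r v1 J + c * hscan r v2 J.
Proof.
move=> vE; elim: J => [|J IH] /=; first by rewrite mulr0 addr0.
by case: ifP => _ //; rewrite IH vE; ring.
Qed.

Variables (k n : nat).
Local Notation tableau := (tableau k n R).
Implicit Types (T : tableau) (lam : partition_in k (n - k)).

(** Entries indexed by natural numbers and extended by zero, so that the scans can recurse on
    them. *)
Definition tn T (i j : nat) : R :=
  oapp (fun i' => oapp (fun j' => T (i', j')) 0 (insub j)) 0 (insub i).

Lemma tn_ord T (i : 'I_k) (j : 'I_(n - k)) : tn T i j = T (i, j).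
Proof. by rewrite /tn !valK. Qed.

Lemma tn_out T i j : (n - k <= j)%N -> tn T i j = 0.
Proof.
by rewrite leqNgt => jm; rewrite /tn insubN //; case: (insub i).
Qed.

Lemma tn_eq0 T (i : 'I_k) (J : nat) :
  (forall j : 'I_(n - k), (J <= j)%N -> T (i, j) = 0) ->
  forall j, (J <= j)%N -> tn T i j = 0.
Proof.
move=> H j Jj; have [jm|jm] := ltnP j (n - k); last exact: tn_out.
by rewrite -[j]/(val (Ordinal jm)) tn_ord H.
Qed.

(** Rows are read from the bottom: [vrow T v0 d] gives, column by column, the weight of the paths
    that enter the last [d] rows from above, when [v0] gives the weights at the bottom. *)
Fixpoint vrow T v0 (d : nat) : nat -> R :=
  if d is d'.+1 then vscan (tn T (k - d'.+1)) (vrow T v0 d') else v0.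

(** The scans are linear in the weights below, so a relation at level [d0] propagates through all
    higher rows on which the tableaux agree. *)
Lemma vrow_comb T T' v1 v2 v3 c d0 d : (d0 <= d)%N ->
  (forall i j, (i < k - d0)%N -> tn T i j = tn T' i j) -> (d <= k)%N ->
  (forall j, vrow T v1 d0 j = vrow T' v2 d0 j + c * vrow T' v3 d0 j) ->
  forall j, vrow T v1 d j = vrow T' v2 d j + c * vrow T' v3 d j.
Proof.
move=> d0d TT' dk E; elim: d d0d dk => [|d IH].
  by rewrite leqn0 => /eqP d00; rewrite -d00.
rewrite leq_eqVlt => /predU1P[<- //|]; rewrite ltnS => d0d dk j /=.
have {}IH := IH d0d (ltnW dk).
have rE i : tn T (k - d.+1) i = tn T' (k - d.+1) i by apply: TT'; lia.
rewrite /vscan rE; case: ifP => _; first exact: IH.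
rewrite IH (hscan_comb _ _ IH).
have hE v : hscan (tn T (k - d.+1)) v j = hscan (tn T' (k - d.+1)) v j.
  by apply: hscan_ext => j' _.
by rewrite !hE; ring.
Qed.

Definition vbase lam (t : 'I_n) (j : nat) : R :=
  oapp (fun j' : 'I_(n - k) => (val t == hlabel lam j')%:R) 0 (insub j).

Lemma vbase_ord lam t (j : 'I_(n - k)) :
  vbase lam t j = (val t == hlabel lam j)%:R.
Proof. by rewrite /vbase valK. Qed.

Lemma vbase_out lam t j : (n - k <= j)%N -> vbase lam t j = 0.
Proof. by rewrite leqNgt => jm; rewrite /vbase insubN. Qed.

(** For a sink [t] this is the boundary measurement from the source of row [i], by
    [Le_bdry_measurement]. The recursive form is the one that follows the deletion of a corner. *)
Definition hmeas lam T t (i : 'I_k) : R :=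
  hscan (tn T i) (vrow T (vbase lam t) (k - i.+1)) (n - k).

Definition supported lam T := forall b, T b != 0 -> b \in diagram lam.

Definition clear (b : 'I_k * 'I_(n - k)) T : tableau :=
  [ffun b' => if b' == b then 0 else T b'].

Hypothesis hkn : (k <= n)%N.
Variables (lam lam' : partition_in k (n - k)) (i0 : 'I_k) (j0 : 'I_(n - k)).
Hypothesis hc : corner lam lam' i0 j0.
Variable T : tableau.
Hypothesis hT : supported lam T.
Let T' := clear (i0, j0) T.
Let x := T (i0, j0).
Let l := vlab hkn lam i0.
Let l1 := vlab hkn lam' i0.

Lemma clear_supported : supported lam' T'.
Proof.
move=> b; rewrite /T' ffunE; have [_|bc] := eqVneq b (i0, j0); first by rewrite eqxx.
move/hT.
rewrite !inE (corner_diagram hc) => /orP[//|/andP[/eqP b1 /eqP b2]].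
by case/eqP: bc; case: b b1 b2 => b1 b2 /= -> ->.
Qed.

Lemma tn_below (i j : nat) : (i0 < i)%N -> tn T i j = 0 /\ tn T' i j = 0.
Proof.
move=> ii; have [ik|ik] := ltnP i k; last first.
  have iN : insub i = None :> option 'I_k by apply: insubN; rewrite -leqNgt.
  by rewrite /tn iN.
have [jm|jm] := ltnP j (n - k); last by rewrite !tn_out.
rewrite -[i]/(val (Ordinal ik)) -[j]/(val (Ordinal jm)) !tn_ord ffunE.
have T0 : T (Ordinal ik, Ordinal jm) = 0.
  apply/eqP; apply: contraT => /hT; rewrite inE /=.
  by case: hc => _ -> //.
by rewrite T0; case: ifP.
Qed.

Lemma tn_other (i j : nat) : i != i0 -> tn T i j = tn T' i j.
Proof.
move=> ii; have [ik|ik] := ltnP i k; last first.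
  have iN : insub i = None :> option 'I_k by apply: insubN; rewrite -leqNgt.
  by rewrite /tn iN.
have [jm|jm] := ltnP j (n - k); last by rewrite !tn_out.
rewrite -[i]/(val (Ordinal ik)) -[j]/(val (Ordinal jm)) !tn_ord ffunE.
case: eqP => // -[] /(congr1 val) /= E; by rewrite E eqxx in ii.
Qed.

Lemma vrow_below T1 v d : (forall i j, (i0 < i)%N -> tn T1 i j = 0) ->
  (d < k - i0)%N -> vrow T1 v d = v.
Proof.
move=> T10; elim: d => //= d IH dk; rewrite IH ?(ltn_trans _ dk) //.
by apply/funext => j; rewrite /vscan T10 ?eqxx //; lia.
Qed.

Let d0 := (k - i0.+1)%N.
Let d0k : (k - d0.+1 = i0)%N. Proof. by have := ltn_ord i0; rewrite /d0; lia. Qed.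
Let d0d : (d0 < k - i0)%N. Proof. by have := ltn_ord i0; rewrite /d0; lia. Qed.

Lemma hmeas_below t (i : 'I_k) : (i0 < i)%N ->
  hmeas lam T t i = 0 /\ hmeas lam' T' t i = 0.
Proof.
move=> ii; rewrite /hmeas; split; rewrite (@hscan_tail _ _ 0%N) //= => j _;
  by case: (tn_below j ii).
Qed.

Lemma tn_row_lt (j : nat) : (j < j0)%N -> tn T i0 j = tn T' i0 j.
Proof.
move=> jj; have jm : (j < n - k)%N := ltn_trans jj (ltn_ord j0).
rewrite -[j]/(val (Ordinal jm)) !tn_ord ffunE.
case: eqP => // -[] /(congr1 val) /= E; by rewrite E ltnn in jj.
Qed.

Lemma tn_row_gt (j : nat) : (j0 < j)%N -> tn T i0 j = 0.
Proof.
apply: tn_eq0 => j' jj'; apply/eqP; apply: contraT => /hT; rewrite inE /=.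
by case: hc => -> _ _ _; rewrite ltnS leqNgt jj'.
Qed.

Lemma tn_row_ge' (j : nat) : (j0 <= j)%N -> tn T' i0 j = 0.
Proof.
apply: tn_eq0 => j' jj'; apply/eqP; apply: contraT => /clear_supported; rewrite inE /=.
by case: hc => _ _ -> _; rewrite ltnNge jj'.
Qed.

Lemma vbase_corner t (j : nat) : j != j0 -> vbase lam t j = vbase lam' t j.
Proof.
move=> jj; have [jm|jm] := ltnP j (n - k); last by rewrite !vbase_out.
rewrite -[j]/(val (Ordinal jm)) !vbase_ord (corner_hlabel_neq hc) //.
Qed.

Lemma vbase_l1 (j : nat) : vbase lam l1 j = (j == j0)%:R.
Proof.
have [jm|jm] := ltnP j (n - k); last first.
  by rewrite vbase_out // gtn_eqF // (leq_trans (ltn_ord j0)).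
rewrite -[j]/(val (Ordinal jm)) vbase_ord (_ : val l1 = hlabel lam j0); last by rewrite (corner_hlabel hkn hc).
by rewrite (inj_eq (@hlabel_inj _ _ hkn lam)) eq_sym.
Qed.

Lemma vbase_l (j : nat) : vbase lam' l j = (j == j0)%:R.
Proof.
have [jm|jm] := ltnP j (n - k); last first.
  by rewrite vbase_out // gtn_eqF // (leq_trans (ltn_ord j0)).
rewrite -[j]/(val (Ordinal jm)) vbase_ord (_ : val l = hlabel lam' j0); last by rewrite (corner_hlabel' hkn hc).
by rewrite (inj_eq (@hlabel_inj _ _ hkn lam')) eq_sym.
Qed.

Lemma vbase_j0 t : vbase lam t j0 = (t == l1)%:R /\ vbase lam' t j0 = (t == l)%:R.
Proof.
by rewrite !vbase_ord (corner_hlabel hkn hc) (corner_hlabel' hkn hc) !(inj_eq val_inj).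
Qed.

Lemma hscan_j0 t : hscan (tn T i0) (vbase lam t) j0 = hmeas lam' T' t i0.
Proof.
rewrite /hmeas -/d0 vrow_below //; last by move=> i j ii; case: (tn_below j ii).
rewrite [RHS](@hscan_tail _ _ j0) ?(ltnW (ltn_ord j0)) //; last exact: tn_row_ge'.
apply: hscan_ext => j jj; first exact: tn_row_lt.
by apply: vbase_corner; rewrite ltn_eqF.
Qed.

(** If [x] is nonzero, every path from the source of row [i0] first enters the corner, with weight
    [x]; it then goes down to [l1], or continues to the left as if it started in the network without
    the corner. *)
Lemma hmeas_corner t : hmeas lam T t i0 =
  if x == 0 then hmeas lam' T' t i0 else x * ((t == l1)%:R + hmeas lam' T' t i0).
Proof.
rewrite {1}/hmeas -/d0 vrow_below //; last by move=> i j ii; case: (tn_below j ii).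
rewrite [LHS](@hscan_tail _ _ j0.+1) //; last exact: tn_row_gt.
by rewrite /= tn_ord -/x hscan_j0; case: (vbase_j0 t) => ->.
Qed.

Lemma hmeas_l1 : hmeas lam' T' l1 i0 = 0.
Proof.
rewrite -hscan_j0; apply: hscan0 => j jj; by rewrite vbase_l1 ltn_eqF.
Qed.

Lemma vrow_corner t j : vrow T (vbase lam t) d0.+1 j =
  if j == j0 :> nat then (t == l1)%:R + (if x == 0 then 0 else hmeas lam' T' t i0)
  else vrow T' (vbase lam' t) d0.+1 j.
Proof.
rewrite /= d0k !vrow_below //; try by move=> i j' ii; case: (tn_below j' ii).
rewrite /vscan; case: (ltngtP j j0) => jj.
- rewrite tn_row_lt //; have E : vbase lam t j = vbase lam' t j.
    by apply: vbase_corner; rewrite ltn_eqF.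
  rewrite E; case: ifP => // _; congr (_ + _); apply: hscan_ext => j' jj'.
    by apply: tn_row_lt; exact: ltn_trans jj.
  by apply: vbase_corner; rewrite ltn_eqF // (ltn_trans jj').
- by rewrite tn_row_gt // tn_row_ge' ?(ltnW jj) // eqxx vbase_corner // gtn_eqF.
- rewrite jj tn_ord -/x hscan_j0; case: (vbase_j0 t) => -> _.
  by case: ifP => //; rewrite addr0.
Qed.

Lemma vrow_corner' t : vrow T' (vbase lam' t) d0.+1 j0 = (t == l)%:R.
Proof.
rewrite /= d0k vrow_below //; last by move=> i j' ii; case: (tn_below j' ii).
by rewrite /vscan tn_row_ge' // eqxx; case: (vbase_j0 t) => _ ->.
Qed.

Lemma vrow_corner_l j : vrow T' (vbase lam' l) d0.+1 j = (j == j0)%:R.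
Proof.
rewrite /= d0k vrow_below //; last by move=> i j' ii; case: (tn_below j' ii).
rewrite /vscan vbase_l; case: ifP => // /negbT.
case: (leqP j0 j) => jj; first by rewrite tn_row_ge' // eqxx.
move=> _; rewrite hscan0 ?addr0 // => j' jj'.
by rewrite vbase_l ltn_eqF // (ltn_trans jj').
Qed.

Lemma hmeas_above t t' c (i : 'I_k) : (i < i0)%N ->
  (forall j, vrow T (vbase lam t) d0.+1 j = vrow T' (vbase lam' t') d0.+1 j +
     c * vrow T' (vbase lam' l) d0.+1 j) ->
  hmeas lam T t i = hmeas lam' T' t' i + c * hmeas lam' T' l i.
Proof.
move=> ii E; rewrite /hmeas.
have rE j : tn T i j = tn T' i j by apply: tn_other; rewrite ltn_eqF.
rewrite (hscan_ext (r' := tn T' i) (v' := vrow T (vbase lam t) (k - i.+1))) //.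
apply: hscan_comb => j; apply: vrow_comb E j.
- by have := ltn_ord i0; rewrite /d0; lia.
- move=> i' j' ii'; apply: tn_other; rewrite ltn_eqF //.
  by move: ii'; rewrite d0k.
- exact: leq_subr.
Qed.

(** The product counts the paths that turn left at the corner. Their first part comes down column
    [j0], which ends at [l] after the deletion; their second part is a path from the source of row
    [i0]. *)
Lemma hmeas_neq t (i : 'I_k) : i != i0 -> t != l -> t != l1 ->
  hmeas lam T t i = hmeas lam' T' t i +
    (if x == 0 then 0 else hmeas lam' T' t i0) * hmeas lam' T' l i.
Proof.
move=> ii tl tl1; case: (ltngtP i i0) => ii'; last by rewrite (val_inj ii') eqxx in ii.
  apply: hmeas_above => // j; rewrite vrow_corner vrow_corner_l (negbTE tl1) add0r.
  case: eqP => [->|_]; last by rewrite mulr0 addr0.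
  by rewrite vrow_corner' (negbTE tl) add0r mulr1.
case: (hmeas_below t ii') => -> ->; case: (hmeas_below l ii') => _ ->.
by rewrite mulr0 addr0.
Qed.

(** Such paths leave through the bottom of column [j0], whose label becomes [l] after the
    deletion. *)
Lemma hmeas_neq_l1 (i : 'I_k) : i != i0 -> hmeas lam T l1 i = hmeas lam' T' l i.
Proof.
move=> ii; case: (ltngtP i i0) => ii'; last by rewrite (val_inj ii') eqxx in ii.
  rewrite -[RHS]addr0 -[X in _ + X](mul0r (hmeas lam' T' l i)).
  apply: hmeas_above => // j; rewrite vrow_corner vrow_corner_l mul0r addr0 eqxx hmeas_l1.
  case: eqP => [_|/eqP jj]; first by case: ifP; rewrite addr0.
  rewrite /= d0k vrow_below //; last by move=> i' j' ii2; case: (tn_below j' ii2).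
  have [jm|jm] := ltnP j j0; last first.
    by rewrite /vscan tn_row_ge' // eqxx -vbase_corner // vbase_l1 (negbTE jj).
  have v0 j' : (j' < j0)%N -> vbase lam' l1 j' = 0.
    by move=> jj'; rewrite -vbase_corner ?vbase_l1 ltn_eqF.
  rewrite /vscan hscan0 => [|j' jj']; last by apply: v0; exact: ltn_trans jm.
  by rewrite addr0 v0 //; case: ifP.
case: (hmeas_below l1 ii') => -> _; by case: (hmeas_below l ii') => _ ->.
Qed.

End Scan.

(** * Path sums in an acyclic network *)

Section AcyclicNetwork.
Local Open Scope ring_scope.
Variables (R : realType) (n : nat) (N : network R n).
Local Notation V := (vertex N).
Local Notation E := (@edge R n N).
Local Notation wt := (@weight R n N).

Definition walks (tv : V) (l : nat) (u : V) : R :=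
  \sum_(p : l.-tuple V | path E u p && (last u p == tv))
    \prod_(x <- pairmap wt u p) x.

Lemma walks0 tv u : walks tv 0 u = (u == tv)%:R.
Proof.
rewrite /walks; have [->|ut] := eqVneq u tv.
  rewrite (bigD1 [tuple]) //= ?eqxx // big_nil big1 ?addr0 // => p /andP[_] /eqP [].
  by rewrite [p]tuple0.
by rewrite big1 // => p; rewrite tuple0 /= (negbTE ut).
Qed.

Lemma walksS tv l u :
  walks tv l.+1 u = \sum_(w | E u w) wt u w * walks tv l w.
Proof.
rewrite /walks.
pose h (wp : V * l.-tuple V) : l.+1.-tuple V := [tuple of wp.1 :: wp.2].
rewrite (reindex h) /=; last first.
  exists (fun p => (thead p, [tuple of behead p])) => [[w p] _|p _] /=.
    by congr (_, _); apply: val_inj.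
  by rewrite [RHS]tuple_eta; apply: val_inj.
rewrite (eq_bigr (fun w => \sum_(p : l.-tuple V | path E w p && (last w p == tv))
    wt u w * \prod_(x <- pairmap wt w p) x)); last by move=> w _; rewrite mulr_sumr.
rewrite pair_big_dep /=; apply: eq_big => [[w p]|[w p] _] /=; first by rewrite andbA.
by rewrite big_cons.
Qed.

(** The rank decreases along edges and so bounds the length of paths: summing over lengths below
    [#|V|] loses nothing, and splitting off the first edge determines the sum. *)
Lemma bdry_measurement_solution (S : V -> R) (rk : V -> nat) (i j : 'I_n) :
  (forall u w, E u w -> rk w < rk u)%N -> (rk (bdry N i) < #|V|)%N ->
  (forall u, S u = (u == bdry N j)%:R + \sum_(w | E u w) wt u w * S w) ->
  bdry_measurement N i j = S (bdry N i).
Proof.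
move=> rkE rki SE.
rewrite -[bdry_measurement N i j]/(\sum_(l < #|V|) walks (bdry N j) l (bdry N i)).
move: #|V| (bdry N i) rki => L; elim: L => // L IH u ruL.
rewrite big_ord_recl walks0 SE; congr (_ + _).
under eq_bigr do rewrite walksS.
rewrite exchange_big /=; apply: eq_bigr => w uw; rewrite -mulr_sumr IH //.
by rewrite -ltnS; apply: leq_trans ruL; rewrite ltnS rkE.
Qed.

End AcyclicNetwork.

(** * Path sums in the network of a tableau *)

Section LeNetwork.
Local Open Scope ring_scope.
Variables (R : realType) (k n : nat).
Hypothesis hkn : (k <= n)%N.
Local Notation tableau := (tableau k n R).
Variables (lam : partition_in k (n - k)) (T : tableau) (t : 'I_n).
Local Notation V := (vrow T (vbase R lam t)).

Let hr (i : 'I_k) (j : nat) : R := hscan (tn T i) (V (k - i.+1)) j.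

Definition box_value (i : 'I_k) (j : 'I_(n - k)) : R :=
  V (k - i.+1) j + hr i j.

(** The sum has at most one term, the nearest nonzero box to the left. This converts the box-by-box
    scan into the edges of the network; [vrow_sum] does the same downwards, with a boundary term for
    a column without further nonzero boxes. *)
Lemma hscan_sum (i : 'I_k) (J : nat) : (J <= n - k)%N ->
  hr i J = \sum_(j : 'I_(n - k) | [&& (j < J)%N, T (i, j) != 0 &
      [forall c : 'I_(n - k), (j < c < J)%N ==> (T (i, c) == 0)]])
    T (i, j) * box_value i j.
Proof.
elim: J => [|J IH] Jm; first by rewrite big_pred0.
pose oJ := Ordinal Jm; rewrite /hr /= -[J]/(val oJ) tn_ord -/(hr _ _).
have [T0|T0] := eqVneq (T (i, oJ)) 0.
  rewrite [LHS](IH (ltnW Jm)); apply: eq_bigl => j.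
  rewrite ltnS; case: (ltngtP j oJ) => jJ //=; last by rewrite (val_inj jJ) T0 eqxx.
  congr (_ && _); apply/forallP/forallP => H c; apply/implyP => /andP[jc cJ].
    have [E|cJ'] := eqVneq c oJ; first by rewrite E T0.
    apply: (implyP (H c)); rewrite jc /= ltn_neqAle -ltnS cJ andbT; exact: cJ'.
  by apply: (implyP (H c)); rewrite jc /= ltnS ltnW.
rewrite (bigD1 oJ) /=; last first.
  rewrite ltnSn T0 /=; apply/forallP => c; apply/implyP => /andP[c1 c2].
  by move: c1; rewrite ltnNge -ltnS c2.
rewrite big1 ?addr0 // => j /andP[/and3P[jJ _ /forallP/(_ oJ) H] joJ].
move: H; rewrite (negbTE T0) implybF => /negP; case.
by rewrite /= ltnSn andbT ltn_neqAle -ltnS jJ andbT; exact: joJ.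
Qed.

Lemma vrow_sum (d : nat) (j : 'I_(n - k)) : (d <= k)%N ->
  V d j = \sum_(i : 'I_k | [&& (k - d <= i)%N, T (i, j) != 0 &
      [forall r : 'I_k, (k - d <= r < i)%N ==> (T (r, j) == 0)]]) box_value i j
    + (if [forall r : 'I_k, (k - d <= r)%N ==> (T (r, j) == 0)]
       then (val t == hlabel lam j)%:R else 0).
Proof.
elim: d => [|d IH] dk.
  rewrite big_pred0 ?add0r => [|i]; last by rewrite subn0 leqNgt ltn_ord.
  rewrite /= vbase_ord ifT //; apply/forallP => r.
  by rewrite subn0 leqNgt ltn_ord.
have Hi : (k - d.+1 < k)%N by lia.
pose oi := Ordinal Hi.
have le_oi (i : nat) : (k - d.+1 <= i)%N = (i == oi) || (k - d <= i)%N.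
  by rewrite /=; lia.
have oi_lt (i : nat) : (k - d <= i)%N -> (oi < i)%N by rewrite /=; lia.
rewrite /= /vscan -[in tn _ _](_ : val oi = (k - d.+1)%N) // tn_ord.
have [T0|T0] := eqVneq (T (oi, j)) 0.
  rewrite [LHS](IH (ltnW dk)); congr (_ + _).
    apply: eq_bigl => i; rewrite le_oi.
    have [->|ioi] := eqVneq i oi.
      by rewrite T0 eqxx /= !andbF.
    rewrite -(inj_eq val_inj) in ioi; rewrite (negbTE ioi) /=.
    case: (boolP (k - d <= i)%N) => //= di; congr (_ && _).
    apply/forallP/forallP => H r; apply/implyP => /andP[dr ri].
      move: dr; rewrite le_oi => /predU1P[E|dr]; first by rewrite (val_inj E) T0.
      by apply: (implyP (H r)); rewrite dr.
    by apply: (implyP (H r)); rewrite le_oi dr orbT.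
  congr (if _ then _ else _); apply/forallP/forallP => H r; apply/implyP => dr.
    move: dr; rewrite le_oi => /predU1P[E|dr]; first by rewrite (val_inj E) T0.
    exact: (implyP (H r)).
  by apply: (implyP (H r)); rewrite le_oi dr orbT.
rewrite (bigD1 oi) /=; last first.
  rewrite leqnn T0 /=; apply/forallP => r; apply/implyP => /andP[c1 c2].
  by move: c1; rewrite leqNgt c2.
rewrite big1 ?addr0 => [|i /andP[/and3P[di _ /forallP/(_ oi) H] ioi]]; last first.
  move: H; rewrite (negbTE T0) implybF => /negP; case; rewrite /= leqnn /=.
  by rewrite ltn_neqAle di andbT eq_sym; exact: ioi.
rewrite ifF ?addr0; last first.
  by apply/negbTE/negP => /forallP/(_ oi); rewrite (negbTE T0) implybF leqnn.
rewrite /box_value /hr (_ : (k - oi.+1 = d)%N) //=; lia.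
Qed.

(** Boundary vertices carry only a label, so the row of a source is recovered by a sum with at most
    one nonzero term. Zero boxes are isolated vertices, of value 0. *)
Definition net_value (u : net_vertex k n) : R :=
  match u with
  | inl l => (l == t)%:R + \sum_(i < k) (val l == vlabel lam i)%:R * hmeas lam T t i
  | inr (i, j) => if T (i, j) == 0 then 0 else box_value i j
  end.

(** Moving left or down decreases [j + (k - i)], which is positive and below [n], so sources get
    rank [n] and sinks 0. As [n] must be less than the number [n + k * (n - k)] of vertices, the
    empty rectangle is treated apart. *)
Definition net_rank (u : net_vertex k n) : nat :=
  match u with
  | inl l => if (0 < k * (n - k))%N && (l \in vertical_labels lam) then n else 0
  | inr (i, j) => (j + (k - i))%N
  end.

Hypothesis tI : t \notin vertical_labels lam.

Lemma net_value_solution (u : net_vertex k n) :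
  net_value u = (u == inl t)%:R +
    \sum_(w | net_edge lam T u w) net_weight T u w * net_value w.
Proof.
rewrite big_sumType /=; case: u => [l|[i j]] /=.
  congr (_ + _); rewrite [X in X + _]big_pred0 // add0r.
  rewrite (eq_bigr (fun i : 'I_k => \sum_(j : 'I_(n - k) |
      [&& val l == vlabel lam i, T (i, j) != 0 &
       [forall j' : 'I_(n - k), (j < j')%N ==> (T (i, j') == 0)]])
       T (i, j) * box_value i j)).
    rewrite pair_big_dep /=; apply: eq_big => [[i j]|[i j] /and3P[_ T0 _]] //=.
    by rewrite (negbTE T0).
  move=> i _; have [li|li] := eqVneq; last by rewrite mul0r big_pred0.
  rewrite mul1r /hmeas -/(hr _ _) hscan_sum //; apply: eq_bigl => j.
  rewrite ltn_ord /=; congr (_ && _); apply: eq_forallb => c.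
  by rewrite ltn_ord andbT.
have [T0|T0] := eqVneq (T (i, j)) 0.
  rewrite big_pred0 => [|l]; last by rewrite /= andbF.
  by rewrite big_pred0 ?addr0 // => -[i' j'].
rewrite add0r /box_value.
have -> : \sum_(l < n | [&& val l == hlabel lam j, true &
      [forall i' : 'I_k, (i < i')%N ==> (T (i', j) == 0)]])
     1 * ((l == t)%:R + \sum_(i1 < k) (val l == vlabel lam i1)%:R * hmeas lam T t i1) =
  if [forall r : 'I_k, (k - (k - i.+1) <= r)%N ==> (T (r, j) == 0)]
       then (val t == hlabel lam j)%:R else 0 :> R.
  have -> : [forall r : 'I_k, (k - (k - i.+1) <= r)%N ==> (T (r, j) == 0)] =
      [forall i' : 'I_k, (i < i')%N ==> (T (i', j) == 0)].
    by apply: eq_forallb => r; have := ltn_ord i; rewrite subKn.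
  case: ifP => _; last by rewrite big_pred0 // => l; rewrite !andbF.
  rewrite (eq_bigr (fun l => (l == t)%:R)) => [|l /and3P[/eqP lj _ _]]; last first.
    rewrite mul1r big1 ?addr0 // => i' _; rewrite lj.
    by rewrite (negbTE (hlabel_vlabel hkn lam i' j)) mul0r.
  have [tj|tj] := eqVneq (val t) (hlabel lam j).
    rewrite (bigD1 t) /= ?tj ?eqxx //= big1 ?addr0 // => l /andP[_ /negbTE ->] //.
  by rewrite big1 // => l /and3P[/eqP lj _ _]; 
    rewrite (_ : (l == t) = false) //; apply: contraNF tj => /eqP <-; rewrite lj.
rewrite (vrow_sum j (leq_subr _ _)) addrAC [RHS]addrC; congr (_ + _).
rewrite addrC.
rewrite (hscan_sum i (ltnW (ltn_ord j))).
rewrite [RHS](bigID (fun b : 'I_k * 'I_(n - k) => b.1 == i)) /=; congr (_ + _).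
- rewrite (reindex_onto (fun j' => (i, j')) (fun b => b.2)) /=; last first.
    by move=> [i' j'] /= /andP[_ /eqP ->].
  apply: eq_big => [j'|j' /and3P[_ T0' _]]; rewrite ?eqxx ?andbT /=.
    by rewrite ltnn andbF orbF /=; case: (T (i, j') == 0) => //=; rewrite ?andbF.
  by rewrite (negbTE T0').
- rewrite (reindex_onto (fun i' => (i', j)) (fun b => b.1)) /=; last first.
    by move=> [i' j'] /= /andP[/andP[_ /orP[/and3P[/eqP <- _ _]|/and3P[/eqP <- _ _]]]];
      rewrite ?eqxx.
  apply: eq_big => [i'|i' /and3P[ii T0' _]].
    rewrite !eqxx !andbT ltnn andbF /= subKn //.
    have [->|ii] := eqVneq i' i; first by rewrite ltnn !andbF.
    by rewrite andbT andbCA.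
  rewrite (negbTE T0') ifF ?mul1r //; apply/eqP => ii'; move: ii.
  by rewrite -ii' subKn // ltnn.
Qed.

Lemma Le_bdry_measurement (i : 'I_k) :
  bdry_measurement (Le_network lam T) (vlab hkn lam i) t = hmeas lam T t i.
Proof.
pose N := Le_network lam T.
rewrite (@bdry_measurement_solution R n N net_value net_rank).
- rewrite /= (_ : vlab _ _ _ == t = false) ?add0r; last first.
    by apply: contraNF tI => /eqP <-; exact: vlab_in.
  rewrite (bigD1 i) //= eqxx mul1r big1 ?addr0 // => i' i'i.
  rewrite (_ : _ == _ = false) ?mul0r //; apply/negbTE.
  apply: contraNneq i'i => E; apply/eqP/(@vlab_inj _ _ hkn lam).
  exact: val_inj.
- move=> [l|[a b]] [l'|[a' b']] //=.
  + case/and3P => /eqP lE _ _; rewrite (_ : l \in _); last first.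
      by rewrite inE; apply/existsP; exists a'; apply/eqP.
    by have := ltn_ord a'; have := ltn_ord b'; rewrite muln_gt0; case: ifP; lia.
  + case/and3P => /eqP lE _ _; rewrite (_ : l' \in _ = false) ?andbF.
      by have := ltn_ord a; lia.
    apply/negbTE; rewrite inE; apply/existsP => -[i' /eqP E].
    by have := hlabel_vlabel hkn lam i' b => /eqP; apply; rewrite -E; exact/esym.
  + case/and3P => _ _ /orP[/and3P[/eqP <- bb _]|/and3P[/eqP <- aa _]].
      by rewrite ltn_add2r.
    by rewrite ltn_add2l; have := ltn_ord a'; lia.
- rewrite /= card_sum card_prod !card_ord.
  by have := ltn_ord t; case: ifP => [/andP[h _]|_]; lia.
- exact: net_value_solution.
Qed.

End LeNetwork.

(** * Matrices representing a subspace *)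

Section Representatives.
Local Open Scope ring_scope.
Variables (R : realType) (k n : nat).
Implicit Types (A B : 'M[R]_(k, n)) (J : {set 'I_n}) (V : {vspace 'rV[R]_n}).

Lemma rowspanE (m : nat) (A : 'M[R]_(m, n)) : rowspan A = <<map_tuple (fun i => row i A) (ord_tuple m)>>%VS.
Proof. by []. Qed.

Lemma mem_rowspan (m : nat) (A : 'M[R]_(m, n)) (v : 'rV[R]_n) : (v \in rowspan A) = (v <= A)%MS.
Proof.
apply/idP/submxP => [|[u ->]].
  rewrite rowspanE => /coord_span ->.
  exists (\row_i coord (map_tuple (fun i => row i A) (ord_tuple m)) i v).
  rewrite mulmx_sum_row; apply: eq_bigr => i _; rewrite mxE.
  by rewrite (nth_map i) ?size_tuple // nth_ord_enum.
rewrite mulmx_sum_row; apply: memv_suml => i _; apply: memvZ; apply: memv_span.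
by apply/mapP; exists i => //; rewrite mem_enum.
Qed.

Lemma rowspan_mulmx (G : 'M[R]_k) A : G \in unitmx -> rowspan (G *m A) = rowspan A.
Proof.
move=> Gu; apply/vspaceP => v; rewrite !mem_rowspan.
by rewrite (eqmxMfull A (_ : row_full G)) // row_full_unit.
Qed.

Lemma rowspan_eq A B : row_free A -> row_free B -> rowspan A = rowspan B ->
  exists2 G : 'M[R]_k, G \in unitmx & B = G *m A.
Proof.
move=> Af Bf AB.
have /submxP[D BD] : (B <= A)%MS.
  by apply/row_subP => i; rewrite -mem_rowspan AB mem_rowspan row_sub.
exists D => //; rewrite -row_free_unit -row_leq_rank.
by have := mulmx_max_rank D A; rewrite -BD => _; move: Bf; rewrite -row_leq_rank BD => /leq_trans; apply; exact: mxrankM_maxl.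
Qed.

Lemma rowspan_dim A : row_free A -> \dim (rowspan A) = k.
Proof.
move=> Af; rewrite rowspanE.
suff /eqP -> : free (map_tuple (fun i => row i A) (ord_tuple k)) by rewrite size_tuple.
apply/freeP => c c0 i.
have /(row_free_inj Af)/rowP/(_ i) : (\row_i c i) *m A = 0 *m A.
  rewrite mul0mx -[RHS]c0 mulmx_sum_row; apply: eq_bigr => j _; rewrite mxE.
  by rewrite (nth_map j) ?size_tuple // nth_ord_enum.
by rewrite !mxE.
Qed.

Lemma minor_row_free A J : #|J| = k -> minor A J != 0 -> row_free A.
Proof.
move=> hJ; rewrite (minor_sof _ hJ) => /dtf_unit; rewrite -row_free_unit -!row_leq_rank.
move=> /leq_trans; apply.
rewrite (_ : \matrix_(i, j) _ = A *m \matrix_(c < n, j < k) (c == sof hJ j)%:R).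
  exact: mxrankM_maxl.
apply/matrixP => i j; rewrite !mxE (bigD1 (sof hJ j)) //= !mxE eqxx mulr1.
by rewrite big1 ?addr0 // => c /negbTE cj; rewrite mxE cj mulr0.
Qed.

Lemma gr_mx_represents V : Gr k V -> represents (gr_mx k V) V.
Proof.
move=> Vk; have VE : rowspan (gr_mx k V) = V.
  rewrite -[RHS](span_basis (vbasisP V)); apply: eq_span => v.
  apply/mapP/idP => [[i _ ->]|].
    by rewrite rowK; apply: mem_nth; rewrite size_tuple [\dim V]Vk.
  move=> /(nthP 0)[i is_ <-]; have ik : (i < k)%N by rewrite -[X in (_ < X)%N]Vk -(size_tuple (vbasis V)).
  by exists (Ordinal ik); rewrite ?mem_enum // rowK.
split=> //; rewrite -row_leq_rank.
(* [row_base] spans the same space with as many rows as the rank, so the dimension [k] bounds the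
   rank from below. *)
have E : rowspan (gr_mx k V) = rowspan (row_base (gr_mx k V)).
  by apply/vspaceP => v; rewrite !mem_rowspan eq_row_base.
have := dim_span (map_tuple (fun i => row i (row_base (gr_mx k V))) (ord_tuple _)).
by rewrite size_tuple -rowspanE -E VE [\dim V]Vk.
Qed.

End Representatives.

Section Measures.
Local Open Scope ring_scope.
Local Open Scope classical_set_scope.
Variables (R : realType) (k n : nat).
Hypothesis hkn : (k <= n)%N.
Implicit Types (A B : 'M[R]_(k, n)) (I J : {set 'I_n}) (V : {vspace 'rV[R]_n}).
Implicit Types (lam : partition_in k (n - k)) (T : tableau k n R).
Notation vl := (vlab hkn).
Notation VL := (@vertical_labels k n).

Lemma represents_Gr A V : represents A V -> Gr k V.
Proof. by case=> Af <-; exact: rowspan_dim. Qed.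

Lemma plucker_represents A V : represents A V ->
  exists2 c : R, c != 0 & forall J, #|J| = k -> plucker k V J = c * minor A J.
Proof.
move=> AV; have [Bf BV] := gr_mx_represents (represents_Gr AV).
case: AV => Af AV.
have [G Gu GE] := rowspan_eq Af Bf (etrans AV (esym BV)).
exists (\det G); first by rewrite -unitfE -unitmxE.
by move=> J hJ; rewrite /plucker GE minor_mulmx.
Qed.

Lemma plucker_ratio A V I J : represents A V -> #|I| = k -> #|J| = k ->
  plucker k V J / plucker k V I = minor A J / minor A I.
Proof.
move=> /plucker_represents[c c0 cE] hI hJ; rewrite !cE // -mulf_div mulfV //.
by rewrite mul1r.
Qed.

Lemma plucker_neq0 A V J : represents A V -> #|J| = k ->
  (plucker k V J != 0) = (minor A J != 0).
Proof.
by move=> /plucker_represents[c c0 cE] hJ; rewrite cE // mulf_eq0 (negbTE c0).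
Qed.

Lemma matroid_represents A V J : represents A V ->
  (J \in matroid k V) = (#|J| == k) && (minor A J != 0).
Proof.
by move=> AV; rewrite inE; case: eqP => //= hJ; rewrite (plucker_neq0 AV hJ).
Qed.

(** The sign of moving [c] from the place of the [i]-th label to its sorted place. *)
Definition cramer_sign lam (i : 'I_k) (c : 'I_n) : R :=
  Num.sg (dtf (vdm R k n) (upd (vl lam) i c)).

Lemma nrm_cramer A lam i c : minor A (VL lam) != 0 ->
  nrm A (vl lam) i c = if c \in VL lam then (c == vl lam i)%:R
    else cramer_sign lam i c * (minor A (c |: VL lam :\ vl lam i) / minor A (VL lam)).
Proof.
move=> A0; have dA0 : dtf A (vl lam) != 0 by rewrite -minor_vlab.
case: ifP => [|/negbT cI].
  rewrite {1}(vlabE hkn) => /imsetP[j _ ->].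
  by rewrite nrmE // (inj_eq (@vlab_inj _ _ _ _)) eq_sym.
have inj : injective (upd (vl lam) i c).
  apply: upd_inj => [|j _]; first exact: vlab_inj.
  by apply: contraNneq cI => <-; exact: vlab_in.
rewrite (@minor_vdm _ _ _ A _ (upd (vl lam) i c)) //; first last.
- move=> j; rewrite /upd in_setU1 in_setD1; case: (eqVneq j i) => [_|ji].
    by rewrite eqxx.
  by rewrite (inj_eq (@vlab_inj _ _ _ _)) ji vlab_in orbT.
- by rewrite card_exchange ?vlab_in // card_vlab.
rewrite (minor_vlab hkn) (dtf_nrm (upd _ _ _) dA0) dtf_nrm1 // /cramer_sign.
set s := Num.sg _; have ss : s * s = 1.
  by rewrite -expr2 sqr_sg vdm_neq0.
rewrite -[LHS]mul1r -ss; field; exact: dA0.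
Qed.

(** The equations defining [Meas], with denominators cleared, for an arbitrary representative. *)
Definition MR lam T A := minor A (VL lam) != 0 /\ forall i t, t \notin VL lam ->
  minor A (t |: VL lam :\ vl lam i) = hmeas lam T t i * minor A (VL lam).

Lemma MR_mulmx lam T (G : 'M[R]_k) A : G \in unitmx ->
  MR lam T (G *m A) <-> MR lam T A.
Proof.
rewrite unitmxE unitfE => G0; rewrite /MR.
have mE J : #|J| = k -> minor (G *m A) J = \det G * minor A J.
  by move=> hJ; rewrite minor_mulmx.
have hI := card_vlab hkn lam.
split=> -[A0 AE]; split.
- by move: A0; rewrite mE // mulf_eq0 negb_or => /andP[].
- move=> i t tI; have := AE i t tI; rewrite !mE ?card_exchange ?vlab_in // mulrCA.
  exact: mulfI.
- by rewrite mE // mulf_neq0.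
- by move=> i t tI; rewrite !mE ?card_exchange ?vlab_in // AE // mulrCA.
Qed.

(** By Cramer's rule, these ratios are, up to common signs, the entries of the normalised
    representative outside the base. *)
Lemma nrm_eq_rowspan A B lam : minor A (VL lam) != 0 -> minor B (VL lam) != 0 ->
  (forall i c, c \notin VL lam -> minor A (c |: VL lam :\ vl lam i) / minor A (VL lam) =
    minor B (c |: VL lam :\ vl lam i) / minor B (VL lam)) ->
  exists2 G : 'M[R]_k, G \in unitmx & B = G *m A.
Proof.
move=> A0 B0 AB; have E : nrm A (vl lam) = nrm B (vl lam).
  apply/matrixP => i c; rewrite !nrm_cramer //; case: ifP => // /negbT cI.
  by rewrite AB.
have dA0 : dtf A (vl lam) != 0 by rewrite -minor_vlab.
have dB0 : dtf B (vl lam) != 0 by rewrite -minor_vlab.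
exists (\matrix_(i < k, j < k) B i (vl lam j) *m
  invmx (\matrix_(i < k, j < k) A i (vl lam j))).
  by rewrite unitmx_mul unitmx_inv !dtf_unit.
by rewrite -mulmxA -/(nrm A (vl lam)) E -nrmK.
Qed.

Lemma MR_uniq lam T A B : MR lam T A -> MR lam T B ->
  exists2 G : 'M[R]_k, G \in unitmx & B = G *m A.
Proof.
move=> [A0 AE] [B0 BE]; apply: (nrm_eq_rowspan A0 B0) => i c cI.
by rewrite AE // BE // !mulfK.
Qed.

Lemma MR_represents lam T A : MR lam T A ->
  represents A (Meas k (Le_network lam T)).
Proof.
move=> [A0 AE]; have Af : row_free A := minor_row_free (card_vlab hkn lam) A0.
split=> //; apply/esym; rewrite /Meas.
have hI := card_vlab hkn lam.
(* [xget] returns the intended point because the defining conditions have a solution, and only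
   one. *)
apply: xget_subset1.
  have Ar : represents A (rowspan A) by [].
  split; first exact: represents_Gr Ar.
    by rewrite (plucker_neq0 Ar).
  move=> i j /=; rewrite (vlabE hkn) => /imsetP[r _ ->]; rewrite -(vlabE hkn) => jI.
  rewrite (plucker_ratio Ar) ?card_exchange ?vlab_in //.
  by rewrite AE // mulfK // Le_bdry_measurement.
move=> V W [VG V0 VE] [WG W0 WE].
have Vr := gr_mx_represents VG; have Wr := gr_mx_represents WG.
have [|||G Gu GE] := @nrm_eq_rowspan (gr_mx k V) (gr_mx k W) lam.
- by rewrite -(plucker_neq0 Vr).
- by rewrite -(plucker_neq0 Wr).
- move=> i c cI; rewrite -(plucker_ratio Vr) ?card_exchange ?vlab_in //.
  rewrite -(plucker_ratio Wr) ?card_exchange ?vlab_in //.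
  by rewrite VE ?WE //; exact: vlab_in.
by case: Vr => _ <-; case: Wr => _ <-; rewrite GE rowspan_mulmx.
Qed.

End Measures.

(** * Boundary measurements after adding a corner *)

Section UnpeelMeasures.
Local Open Scope ring_scope.
Variables (R : realType) (k n : nat).
Hypothesis hkn : (k <= n)%N.
Implicit Types (A B : 'M[R]_(k, n)) (J : {set 'I_n}).
Notation vl := (vlab hkn).
Notation VL := (@vertical_labels k n).
Variables (lam lam' : partition_in k (n - k)) (i0 : 'I_k) (j0 : 'I_(n - k)).
Hypothesis hc : corner lam lam' i0 j0.
Let l := vl lam i0.
Let l1 := vl lam' i0.
Let ll1 : val l1 = l.+1 := corner_succ hkn hc.
Let l1E : nat_of_ord l1 = l.+1 := ll1.
Let l1I : l1 \notin VL lam := corner_notin hkn hc.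
Let lI : l \in VL lam := vlab_in hkn lam i0.
Let hI : #|VL lam| = k := card_vlab hkn lam.
Let hI' : #|VL lam'| = k := card_vlab hkn lam'.
Let IE : VL lam' = l1 |: VL lam :\ l := corner_labels hkn hc.
Let lI' : l \notin VL lam' := corner_notin' hkn hc.
Let l1I' : l1 \in VL lam' := vlab_in hkn lam' i0.
Let neql : (l == l1 = false) * (l1 == l = false).
Proof. by rewrite [l1 == l]eq_sym -(inj_eq val_inj) ll1 ltn_eqF. Qed.

Lemma unpeel_echelon x A : echelon hkn lam' A -> echelon hkn lam (unpeel l l1 x A).
Proof.
case=> A0 A1.
have A0l1 : A i0 l1 != 0 by exact: A1.
have pE i c : c != l -> c != l1 -> unpeel l l1 x A i c = A i c.
  by move=> /negbTE cl /negbTE cl1; rewrite /unpeel; case: ifP => _; rewrite mxE cl cl1.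
have pl i : unpeel l l1 x A i l = if x == 0 then A i l1 else x^-1 * (A i l + A i l1).
  by rewrite /unpeel; case: ifP => _; rewrite mxE eqxx; ring.
have pl1 i : unpeel l l1 x A i l1 = if x == 0 then - A i l else A i l1.
  by rewrite /unpeel; case: ifP => _; rewrite mxE eqxx neql; ring.
have vE i : i != i0 -> vl lam' i = vl lam i := @corner_vlab _ _ hkn _ _ _ _ hc i.
split=> [i c ci|i].
- have [ii|ii] := eqVneq i i0.
    have cl : (c < l)%N by rewrite -[l]/(vl lam i0) -ii.
    rewrite pE.
    + by apply: A0; rewrite ii; apply: ltn_trans cl _; rewrite l1E.
    + by apply: contraTneq cl => ->; rewrite ltnn.
    + by apply: contraTneq cl => ->; rewrite l1E ltnNge leqnSn.
  rewrite -vE // in ci.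
  have il1 : vl lam' i != l1 by rewrite (inj_eq (@vlab_inj _ _ _ _)).
  have [cl|cl] := eqVneq c l.
    have l1i : (l1 < vl lam' i)%N.
      by rewrite ltn_neqAle eq_sym (inj_eq val_inj) il1 andTb l1E -[l]/l -cl.
    have li : (l < vl lam' i)%N by rewrite -cl.
    by rewrite cl pl !A0 // addr0 mulr0; case: ifP.
  have [cl1|cl1] := eqVneq c l1; last by rewrite pE // A0.
  have li : (l < vl lam' i)%N by apply: leq_trans ci; rewrite cl1 l1E; exact: leqW.
  by rewrite cl1 in ci *; rewrite pl1 !A0 // oppr0; case: ifP.
- have [->|ii] := eqVneq i i0.
    rewrite pl (A0 i0 l) ?add0r; last by rewrite -/l1 l1E.
    by have [//|x0] := eqVneq x 0; rewrite mulf_neq0 ?invr_neq0.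
  rewrite pE -?vE //.
    by apply: contraNneq lI' => <-; exact: vlab_in.
  by rewrite (inj_eq (@vlab_inj _ _ _ _)).
Qed.

Lemma gale_unpeel x A : gale lam' A -> gale lam (unpeel l l1 x A).
Proof.
move=> /(gale_echelonP hkn)[G Gu Ge].
apply/(gale_mulmx hkn _ _ Gu); rewrite -unpeel_mulmx.
exact/echelon_gale/unpeel_echelon.
Qed.

Lemma gale_eq0 A J c : gale lam' A -> #|J| = k ->
  (cnt (VL lam') c < cnt J c)%N -> minor A J = 0.
Proof.
move=> [_ Ag] hJ; apply: contraTeq => /(Ag J hJ) /(_ c).
by rewrite leqNgt.
Qed.

Lemma gale_exchange0 A (u v : 'I_n) : gale lam' A -> u \in VL lam' ->
  v \notin VL lam' -> (v < u)%N -> minor A (v |: VL lam' :\ u) = 0.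
Proof.
move=> Ag uI vI vu; apply: (@gale_eq0 _ _ v) => //; first by rewrite card_exchange.
have := cnt_exchange v uI vI; rewrite leqnn leqNgt vu /=.
by rewrite addn0 addn1 => ->.
Qed.

(** For y < l < l1 < t, with [y = vl lam i], this is the Plucker relation: its third term contains
    the base of [lam'] with [l1] lowered to [l], which vanishes by Gale minimality. In every other
    order both sides vanish for the same reason. *)
Lemma double_exchange A (i : 'I_k) (t : 'I_n) : gale lam' A -> i != i0 ->
  t \notin VL lam -> t != l1 ->
  minor A (t |: VL lam :\ vl lam i) * minor A (VL lam') =
  minor A (l |: VL lam' :\ vl lam' i) * minor A (t |: VL lam' :\ l1).
Proof.
move=> Ag ii tI tl1; rewrite (corner_vlab hkn hc) //; set y := vl lam i.
have yI : y \in VL lam by exact: vlab_in.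
have yl : y != l by rewrite (inj_eq (@vlab_inj _ _ _ _)).
have yl1 : y != l1 by apply: contraNneq l1I => <-.
have tl : t != l by apply: contraNneq tI => ->.
have ty : t != y by apply: contraNneq tI => ->.
have yI' : y \in VL lam' by rewrite IE in_setU1 in_setD1 yl yI orbT.
have tI' : t \notin VL lam' by rewrite IE in_setU1 in_setD1 negb_or tl1 (negbTE tI) andbF.
pose S := VL lam :\ y :\ l.
have ns (u v : 'I_n) : u != v -> (u == v = false) * (v == u = false).
  by move=> /negbTE uv; rewrite [v == u]eq_sym uv.
have eqs := (neql, ns _ _ yl, ns _ _ yl1, ns _ _ tl, ns _ _ tl1, ns _ _ ty).
have inI := (lI, yI, negbTE l1I, negbTE tI).
have [lS l1S yS tS] : [/\ l \notin S, l1 \notin S, y \notin S & t \notin S].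
  by rewrite !in_setD1 !eqxx !eqs !inI !andbF.
have hS : #|S|.+2 = k.
  by rewrite -hI (cardsD1 y (VL lam)) yI (cardsD1 l (VL lam :\ y)) !in_setD1 eqs lI.
have cases_ext (X Y : {set 'I_n}) : (l \in X) = (l \in Y) -> (l1 \in X) = (l1 \in Y) ->
    (y \in X) = (y \in Y) -> (t \in X) = (t \in Y) ->
    (forall c, c != l -> c != l1 -> c != y -> c != t -> (c \in X) = (c \in Y)) -> X = Y.
  move=> h1 h2 h3 h4 h5; apply/setP => c; have [->//|n1] := eqVneq c l.
  have [->//|n2] := eqVneq c l1; have [->//|n3] := eqVneq c y.
  by have [->//|n4] := eqVneq c t; exact: h5.
have tac (X Y : {set 'I_n}) : X = Y -> minor A X = minor A Y by move=> ->.
have E1 : t |: VL lam :\ y = l |: (t |: S).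
  by apply: cases_ext => [||||c /negbTE c1 /negbTE c2 /negbTE c3 /negbTE c4];
    rewrite !in_setU1 !in_setD1 ?in_setU1 ?in_setD1 ?eqxx ?eqs ?inI ?c1 ?c2 ?c3 ?c4.
have E2 : VL lam' = y |: (l1 |: S).
  by rewrite IE; apply: cases_ext => [||||c /negbTE c1 /negbTE c2 /negbTE c3 /negbTE c4];
    rewrite !in_setU1 !in_setD1 ?in_setU1 ?in_setD1 ?eqxx ?eqs ?inI ?c1 ?c2 ?c3 ?c4 ?orbT.
have E3 : l |: VL lam' :\ y = l |: (l1 |: S).
  by rewrite IE; apply: cases_ext => [||||c /negbTE c1 /negbTE c2 /negbTE c3 /negbTE c4];
    rewrite !in_setU1 !in_setD1 ?in_setU1 ?in_setD1 ?eqxx ?eqs ?inI ?c1 ?c2 ?c3 ?c4 ?orbT.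
have E4 : t |: VL lam' :\ l1 = y |: (t |: S).
  by rewrite IE; apply: cases_ext => [||||c /negbTE c1 /negbTE c2 /negbTE c3 /negbTE c4];
    rewrite !in_setU1 !in_setD1 ?in_setU1 ?in_setD1 ?eqxx ?eqs ?inI ?c1 ?c2 ?c3 ?c4 ?orbT.
have E5 : l |: VL lam' :\ l1 = y |: (l |: S).
  by rewrite IE; apply: cases_ext => [||||c /negbTE c1 /negbTE c2 /negbTE c3 /negbTE c4];
    rewrite !in_setU1 !in_setD1 ?in_setU1 ?in_setD1 ?eqxx ?eqs ?inI ?c1 ?c2 ?c3 ?c4 ?orbT.
have cntS (u v : 'I_n) c : u \notin v |: S -> v \notin S ->
    cnt (u |: (v |: S)) c = ((u <= c) + ((v <= c) + cnt S c))%N.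
  by move=> uS vS; rewrite /cnt big_setU1 // big_setU1.
have yl1S : y \notin l1 |: S by rewrite in_setU1 eqs (negbTE yS).
have ltS : l \notin t |: S by rewrite in_setU1 eqs (negbTE lS).
have h4 : #|t |: VL lam :\ y| = k by rewrite card_exchange.
have zero c : ((y <= c) + (l1 <= c) < (l <= c) + (t <= c))%N ->
    minor A (t |: VL lam :\ y) = 0.
  move=> h; apply: (@gale_eq0 _ _ c) => //; by rewrite E1 E2 !cntS // !addnA ltn_add2r.
have [ly|ly] := ltnP l y.
  rewrite (@zero l) ?mul0r; last by rewrite leqnn [(y <= l)%N]leqNgt ly l1E ltnn.
  by rewrite (gale_exchange0 Ag yI' lI' ly) mul0r.
have {}ly : (y < l)%N by rewrite ltn_neqAle ly andbT.
have [tl1'|l1t] := ltnP t l1.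
  rewrite (gale_exchange0 Ag l1I' tI' tl1') mulr0.
  rewrite (@zero l) ?mul0r // leqnn l1E ltnn (ltnW ly).
  by rewrite (_ : (t <= l)%N) // -ltnS -l1E.
have {}l1t : (l1 < t)%N by rewrite ltn_neqAle eq_sym tl1 l1t.
rewrite E1 {1}E2 E3 E4.
have := @minor_plucker R k n A S y l l1 t hS ly _ l1t yS lS l1S tS.
rewrite l1E => /(_ (leqnn _)) /=.
rewrite -E5 (gale_exchange0 Ag l1I' lI') ?l1E // mul0r add0r => H.
by rewrite [LHS]mulrC H mulrC.
Qed.

Variable T : tableau k n R.
Hypothesis hT : supported lam T.
Let T' := clear (i0, j0) T.
Let x := T (i0, j0).

Lemma minor_unpeel_base A : gale lam' A -> minor (unpeel l l1 x A) (VL lam) =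
  (if x == 0 then 1 else x^-1) * minor A (VL lam').
Proof.
move=> Ag; rewrite (minor_unpeelL x ll1 A hI lI l1I) -IE.
have -> : minor A (VL lam) = 0.
  have E : VL lam = l |: VL lam' :\ l1.
    rewrite IE; apply/setP => c; rewrite !in_setU1 !in_setD1 !in_setU1 !in_setD1.
    have [->|c1] := eqVneq c l; first by rewrite lI.
    have [->|c2] := eqVneq c l1; first by rewrite (negbTE l1I).
    by [].
  by rewrite E (gale_exchange0 Ag) // l1E.
by rewrite add0r; case: ifP; rewrite ?mul1r.
Qed.

(** Minors and path sums change by the same rules when the corner is added, according to whether
    [t = l1] and whether [i = i0]. When neither holds, [double_exchange] turns the extra minor into
    the product that counts the paths turning at the corner. *)
Lemma MR_unpeel A : gale lam' A -> MR hkn lam' T' A -> MR hkn lam T (unpeel l l1 x A).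
Proof.
move=> Ag [A0 AE]; have base := minor_unpeel_base Ag.
have y0 : (if x == 0 then 1 else x^-1) != 0 :> R.
  by have [//|x0] := eqVneq x 0; rewrite ?oner_neq0 ?invr_neq0.
split; first by rewrite base mulf_neq0.
move=> i t tI; rewrite base; set J := t |: _.
have hJ : #|J| = k by rewrite card_exchange ?vlab_in.
have tl : t != l by apply: contraNneq tI => ->.
set m := minor A (VL lam') in A0 AE *.
have [ti|ti] := eqVneq t l1; have [ii|ii] := eqVneq i i0.
- have JE : J = VL lam' by rewrite /J IE ti ii.
  rewrite JE (minor_unpeelR x ll1 A hI' lI' l1I') ii (hmeas_corner hkn hc hT).
  rewrite ti (hmeas_l1 hkn hc hT) eqxx addr0 mulr1 (gale_exchange0 Ag l1I' lI') ?l1E //.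
  have [x0|x0] := eqVneq x 0; first by rewrite oppr0 mul0r.
  by rewrite mulrA divff // mul1r.
- have yl : vl lam i != l by rewrite (inj_eq (@vlab_inj _ _ _ _)).
  have lJ : l \in J by rewrite in_setU1 in_setD1 lI andbT [l == vl _ _]eq_sym yl orbT.
  have l1J : l1 \in J by rewrite in_setU1 ti eqxx.
  have JE : J = l |: VL lam' :\ vl lam' i.
    rewrite (corner_vlab hkn hc) // IE; apply/setP => c.
    rewrite !in_setU1 !in_setD1 !in_setU1 !in_setD1 ti.
    have [->|c1] := eqVneq c l; first by rewrite neql lI eq_sym yl.
    have [->|c2] := eqVneq c l1; last by [].
    rewrite /= andbT; apply/esym; apply: contraNneq l1I => E.
    by rewrite E; exact: vlab_in.
  rewrite (minor_unpeel2 x ll1 A hJ lJ l1J) JE AE // ti.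
  by rewrite (hmeas_neq_l1 hkn hc hT) // mulrCA.
- have JE : J = t |: VL lam' :\ l1.
    rewrite IE /J ii; apply/setP => c.
    rewrite !in_setU1 !in_setD1 !in_setU1 !in_setD1.
    have [->|c2] := eqVneq c l1; last by [].
    by rewrite (negbTE l1I) andbF.
  have tI' : t \notin VL lam' by rewrite IE in_setU1 in_setD1 negb_or ti (negbTE tI) andbF.
  have lJ : l \notin J by rewrite JE in_setU1 in_setD1 (negbTE lI') andbF orbF eq_sym.
  have l1J : l1 \notin J by rewrite JE in_setU1 in_setD1 eqxx orbF eq_sym.
  rewrite (minor_unpeel0 _ _ lJ l1J) JE (AE i0) // ii (hmeas_corner hkn hc hT).
  rewrite -/T' -/x (negbTE ti) add0r; have [x0|x0] := eqVneq x 0; first by rewrite mul1r.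
  by rewrite mulrACA divff // mul1r.
- have yl : vl lam i != l by rewrite (inj_eq (@vlab_inj _ _ _ _)).
  have tI' : t \notin VL lam' by rewrite IE in_setU1 in_setD1 negb_or ti (negbTE tI) andbF.
  have lJ : l \in J by rewrite in_setU1 in_setD1 lI andbT [l == vl _ _]eq_sym yl orbT.
  have l1J : l1 \notin J by rewrite in_setU1 in_setD1 (negbTE l1I) andbF orbF eq_sym.
  have JE : l1 |: J :\ l = t |: VL lam' :\ vl lam' i.
    rewrite (corner_vlab hkn hc) // IE; apply/setP => c.
    rewrite !in_setU1 !in_setD1 !in_setU1 !in_setD1.
    have [->|c1] := eqVneq c l; first by rewrite neql eq_sym (negbTE tl) andbF.
    have [->|c2] := eqVneq c l1; last by [].
    rewrite /= andbT; apply/esym/orP; right; apply: contraNneq l1I => E.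
    by rewrite E; exact: vlab_in.
  have := double_exchange Ag ii tI ti; rewrite -/m -/J AE // (AE i0) // => DE.
  rewrite (minor_unpeelL x ll1 A hJ lJ l1J) JE AE //.
  rewrite (hmeas_neq hc hT) // -/T' -/x.
  have [x0|x0] := eqVneq x 0; first by rewrite mul0r addr0 mul1r.
  have -> : minor A J = hmeas lam' T' l i * hmeas lam' T' t i0 * m.
    by apply: (mulIf A0); rewrite DE; ring.
  by ring.
Qed.

End UnpeelMeasures.

(** * Matrices of a Le-diagram *)

Section PositivePolynomials.
Local Open Scope ring_scope.
Variables (R : realType) (k n : nat).
Implicit Types (T : tableau k n R) (D : {set 'I_k * 'I_(n - k)}).

(** Polynomials with nonnegative integer coefficients, as functions of the whole tableau: the set of
    variables would otherwise change with the diagram along the induction. *)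
Inductive polf : (tableau k n R -> R) -> Prop :=
| polf0 : polf (fun=> 0)
| polf1 : polf (fun=> 1)
| polf_var b : polf (fun T => T b)
| polfD F G : polf F -> polf G -> polf (fun T => F T + G T)
| polfM F G : polf F -> polf G -> polf (fun T => F T * G T).

Lemma polf_clear F b : polf F -> polf (fun T => F (clear b T)).
Proof.
elim=> [||b'|F1 F2 _ IH1 _ IH2|F1 F2 _ IH1 _ IH2].
- exact: polf0.
- exact: polf1.
- have [->|bb] := eqVneq b' b.
    rewrite (_ : (fun T => _) = fun=> 0); first exact: polf0.
    by apply/funext => T; rewrite ffunE eqxx.
  rewrite (_ : (fun T => _) = fun T => T b'); first exact: polf_var.
  by apply/funext => T; rewrite ffunE (negbTE bb).
- exact: polfD.
- exact: polfM.
Qed.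

Definition tab D T := forall b, 0 <= T b /\ (0 < T b <-> b \in D).

Lemma tab_eq0 D T b : tab D T -> (T b == 0) = (b \notin D).
Proof.
move=> /(_ b)[T0 TD]; apply/eqP/idP => [E|]; first by apply/negP => /TD; rewrite E ltxx.
move=> bD; apply/eqP; apply: contraNT bD => Tb; apply/TD.
by rewrite lt_neqAle eq_sym Tb.
Qed.

(** Nonnegative coefficients exclude cancellation. Hence the set of nonvanishing minors depends on
    the diagram only. *)
Lemma polf_sign F D : polf F -> (forall T, tab D T -> F T = 0) \/
  (forall T, tab D T -> 0 < F T).
Proof.
elim=> [||b|F1 F2 _ IH1 _ IH2|F1 F2 _ IH1 _ IH2].
- by left.
- by right => T _; exact: ltr01.
- have [bD|bD] := boolP (b \in D); [right|left] => T TD.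
    by apply/(TD b).2.
  by apply/eqP; rewrite (tab_eq0 b TD).
- case: IH1 => H1; case: IH2 => H2; [left|right|right|right] => T TD.
  + by rewrite H1 ?H2 ?addr0.
  + by rewrite H1 ?add0r ?H2.
  + by rewrite (H2 T) ?addr0 ?H1.
  + by rewrite addr_gt0 ?H1 ?H2.
- case: IH1 => H1; first by left => T TD; rewrite H1 ?mul0r.
  case: IH2 => H2; first by left => T TD; rewrite H2 ?mulr0.
  by right => T TD; rewrite mulr_gt0 ?H1 ?H2.
Qed.

End PositivePolynomials.

Section LeDiagramPeel.
Variables (k n : nat).
Variables (lam lam' : partition_in k (n - k)) (i0 : 'I_k) (j0 : 'I_(n - k)).
Hypothesis hc : corner lam lam' i0 j0.
Implicit Types D : {set 'I_k * 'I_(n - k)}.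
Let c := (i0, j0).

Lemma is_LeP (mu : partition_in k (n - k)) D : reflect (D \subset diagram mu /\
   forall (i i' : 'I_k) (j j' : 'I_(n - k)), (i < i')%N -> (j < j')%N -> (i', j) \in D -> (i, j') \in D ->
     (i', j') \in diagram mu -> (i', j') \in D) (is_Le mu D).
Proof.
apply: (iffP andP) => -[Dl DLe]; split=> //.
  move=> i i' j j' ii jj h1 h2 h3.
  move/forallP: DLe => /(_ i)/forallP/(_ i')/forallP/(_ j)/forallP/(_ j')/implyP.
  by apply; rewrite ii jj h1 h2 h3.
apply/forallP => i; apply/forallP => i'; apply/forallP => j; apply/forallP => j'.
by apply/implyP => /and5P[]; exact: DLe.
Qed.

Lemma diagram_corner : diagram lam = c |: diagram lam'.
Proof.
apply/setP => -[i j]; rewrite in_setU1 !inE /= (corner_diagram hc) orbC.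
by rewrite xpair_eqE.
Qed.

Lemma corner_notin_diagram : c \notin diagram lam'.
Proof. by rewrite inE /=; case: hc => _ _ -> _; rewrite ltnn. Qed.

Lemma is_Le_peel D : is_Le lam D -> is_Le lam' (D :\ c).
Proof.
move=> /is_LeP[Dl DLe]; apply/is_LeP; split.
  apply/fintype.subsetP => b; rewrite in_setD1 => /andP[bc /(fintype.subsetP Dl)].
  by rewrite diagram_corner in_setU1 (negbTE bc).
move=> i i' j j' ii jj; rewrite !in_setD1 => /andP[_ h1] /andP[_ h2] h3.
rewrite (DLe i i' j j') //; last by rewrite diagram_corner in_setU1 h3 orbT.
by rewrite andbT; apply: contraNneq corner_notin_diagram => <-.
Qed.

(** The Le condition enters here: a 1 above the corner and a 1 to its left would force a 1 in the
    corner. *)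
Lemma is_Le_unpeel0 D : is_Le lam D -> c \notin D ->
  (forall i, (i, j0) \notin D) \/ (forall j, (i0, j) \notin D).
Proof.
move=> /is_LeP[Dl DLe] cD; apply: contrapT => /not_orP[/existsNP[i /negP/negPn iD]].
move=> /existsNP[j /negP/negPn jD]; case/negP: cD.
have inl b : b \in D -> (b \in diagram lam') || (b == c).
  by move=> /(fintype.subsetP Dl); rewrite diagram_corner in_setU1 orbC.
have [E|ic] := eqVneq (i, j0) c; first by rewrite -E.
have [E|jc] := eqVneq (i0, j) c; first by rewrite -E.
have := inl _ iD; have := inl _ jD; rewrite (negbTE ic) (negbTE jc) !orbF.
rewrite !inE /=; case: (hc) => c1 c2 c3 c4; rewrite c3 => jj.
have [->|ii] := eqVneq i i0; first by rewrite c3 ltnn.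
rewrite c4 // => hi; apply: (DLe i i0 j j0) => //.
  rewrite ltnNge leq_eqVlt (inj_eq val_inj) eq_sym (negbTE ii) /=.
  by apply/negP => /c2 E; rewrite E in hi.
by rewrite diagram_corner in_setU1 eqxx.
Qed.

(** No box of [lam] lies to the right of the corner or in a lower row, so a 1 there imposes nothing
    on other boxes. *)
Lemma is_Le_add D : is_Le lam' D -> is_Le lam (c |: D).
Proof.
move=> /is_LeP[Dl DLe]; apply/is_LeP; split.
  by rewrite diagram_corner; apply: finset.setUS.
case: (hc) => c1 c2 c3 c4.
move=> i i' j j' ii jj; rewrite !in_setU1 diagram_corner in_setU1.
have [//|/negbTE nc] := boolP ((i', j') == c); rewrite !orFb.
move=> /predU1P[[ei' ej]|h1].
  move=> _; rewrite inE /= ei'; rewrite ej in jj.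
  by rewrite c3 ltnNge (ltnW jj).
move=> /predU1P[[ei ej']|h2]; last exact: DLe h1 h2.
by rewrite inE /= ei in ii *; rewrite c4 ?c2 //; apply: contraTneq ii => ->; rewrite ltnn.
Qed.

Lemma is_Le_keep D : is_Le lam' D ->
  (forall i, (i, j0) \notin D) \/ (forall j, (i0, j) \notin D) -> is_Le lam D.
Proof.
move=> /is_LeP[Dl DLe] emp; apply/is_LeP; split.
  apply: (fintype.subset_trans Dl); rewrite diagram_corner.
  by apply/fintype.subsetP => b bD; rewrite in_setU1 bD orbT.
move=> i i' j j' ii jj h1 h2; rewrite diagram_corner in_setU1 => /predU1P[[ei' ej']|].
  by case: emp => [/(_ i)|/(_ j)]; rewrite -?ej' -?ei' ?h1 ?h2.
exact: DLe h1 h2.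
Qed.

Lemma tab_clear (R : realType) D (T : tableau k n R) :
  tab D T -> tab (D :\ c) (clear c T).
Proof.
move=> TD b; rewrite ffunE in_setD1; case: eqP => _ //=.
  by rewrite ltxx; split.
Qed.

Lemma tab_supported (R : realType) D (T : tableau k n R) : is_Le lam D ->
  tab D T -> supported lam T.
Proof.
move=> /is_LeP[Dl _] TD b Tb; apply: (fintype.subsetP Dl).
by move: Tb; rewrite (tab_eq0 b TD) negbK.
Qed.

End LeDiagramPeel.

(** * From tableaux to matrices *)

Section Forward.
Local Open Scope ring_scope.
Variables (R : realType) (k n : nat).
Hypothesis hkn : (k <= n)%N.
Implicit Types (A B : 'M[R]_(k, n)) (J : {set 'I_n}).
Implicit Types (T : tableau k n R) (D : {set 'I_k * 'I_(n - k)}).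
Implicit Types (lam : partition_in k (n - k)) (i : 'I_k) (j : 'I_(n - k)).
Notation vl := (vlab hkn).
Notation VL := (@vertical_labels k n).

Lemma minor_col0 A J (c : 'I_n) : #|J| = k -> c \in J -> (forall i, A i c = 0) ->
  minor A J = 0.
Proof.
move=> hJ cJ Ac; have [p pc] := sof_onto hJ cJ.
rewrite (minor_sof _ hJ) /dtf (expand_det_col _ p) big1 // => i _.
by rewrite mxE pc Ac mul0r.
Qed.

(* Empty columns of a Le-diagram are loops, empty rows are coloops. *)
Record loops lam D A : Prop := Loops {
  loop_col : forall j, (forall i, (i, j) \notin D) ->
    forall J (c : 'I_n), #|J| = k -> c \in J -> val c = hlabel lam j -> minor A J = 0;
  coloop_row : forall i, (forall j, (i, j) \notin D) ->
    forall J, #|J| = k -> vl lam i \notin J -> minor A J = 0;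
  nonloop_col : forall i j, (i, j) \in D -> exists J (c : 'I_n),
    [/\ #|J| = k, c \in J, val c = hlabel lam j & minor A J != 0];
  noncoloop_row : forall i j, (i, j) \in D -> exists J,
    [/\ #|J| = k, vl lam i \notin J & minor A J != 0] }.

Section Step.
Variables (lam lam' : partition_in k (n - k)) (i0 : 'I_k) (j0 : 'I_(n - k)).
Hypothesis hc : corner lam lam' i0 j0.
Let l := vl lam i0.
Let l1 := vl lam' i0.
Let c := (i0, j0).
Let ll1 : val l1 = l.+1 := corner_succ hkn hc.
Let l1I : l1 \notin VL lam := corner_notin hkn hc.
Let hI' : #|VL lam'| = k := card_vlab hkn lam'.
Let lI' : l \notin VL lam' := corner_notin' hkn hc.
Let l1I' : l1 \in VL lam' := vlab_in hkn lam' i0.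
Let neql : (l == l1 = false) * (l1 == l = false).
Proof. by rewrite [l1 == l]eq_sym -(inj_eq val_inj) ll1 ltn_eqF. Qed.

Lemma minor_unpeel_eq0 x A J : #|J| = k -> minor A J = 0 ->
  (l \in J -> l1 \notin J -> minor A (l1 |: J :\ l) = 0) ->
  (l \notin J -> l1 \in J -> minor A (l |: J :\ l1) = 0) ->
  minor (unpeel l l1 x A) J = 0.
Proof.
move=> hJ J0 J1 J2.
have [lJ|lJ] := boolP (l \in J); have [l1J|l1J] := boolP (l1 \in J).
- by rewrite minor_unpeel2 // J0 mulr0.
- by rewrite minor_unpeelL // J0 J1 // addr0 mulr0; case: ifP.
- by rewrite minor_unpeelR // J0 J2 // oppr0; case: ifP.
- by rewrite minor_unpeel0.
Qed.

(** Since [peel] undoes [unpeel], a minor of [A] is a combination of minors of the new matrix on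
    sets that differ from [J] only at [l] and [l1]; one of these is nonzero. *)
Lemma minor_unpeel_neq0 x A J : #|J| = k -> minor A J != 0 ->
  exists J', [/\ #|J'| = k, minor (unpeel l l1 x A) J' != 0 &
    forall y, y != l -> y != l1 -> (y \in J') = (y \in J)].
Proof.
rewrite -{1}(unpeelK x ll1 A); set B := unpeel _ _ _ _ => hJ.
have swap y u v : y != l -> y != l1 -> u \in [:: l; l1] -> v \in [:: l; l1] ->
    (y \in v |: J :\ u) = (y \in J).
  move=> yl yl1; rewrite !inE => /orP[/eqP->|/eqP->] /orP[/eqP->|/eqP->];
    by rewrite ?(negbTE yl) ?(negbTE yl1).
have [lJ|lJ] := boolP (l \in J); have [l1J|l1J] := boolP (l1 \in J).
- rewrite minor_peel2 // mulf_eq0 negb_or => /andP[_ B0].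
  by exists J.
- rewrite minor_peelL // /delta.
  have [->|B0 _] := eqVneq (minor B J) 0; last by exists J.
  rewrite mulr0 sub0r oppr_eq0 => B0; exists (l1 |: J :\ l).
  by split=> [|//|y yl yl1]; [rewrite card_exchange|apply: swap; rewrite ?inE ?eqxx ?orbT].
- rewrite minor_peelR //; case: ifP => _ B0; last by exists J.
  exists (l |: J :\ l1).
  by split=> [|//|y yl yl1]; [rewrite card_exchange|apply: swap; rewrite ?inE ?eqxx ?orbT].
- by rewrite minor_peel0 // => B0; exists J.
Qed.

Variable D : {set 'I_k * 'I_(n - k)}.
Hypothesis hD : is_Le lam D.
Let D' := D :\ c.

(** A zero in the corner makes [l] a loop or [l1] a coloop of [A], and either one kills these
    minors. *)
Lemma loops_star A J : c \notin D -> loops lam' D' A -> #|J| = k ->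
  l \in J -> l1 \notin J -> minor A J = 0.
Proof.
move=> cD [lo co _ _] hJ lJ l1J.
have D'E b : b \notin D -> b \notin D' by rewrite in_setD1 negb_and => ->; rewrite orbT.
have [H|H] := is_Le_unpeel0 hc hD cD.
  apply: (lo j0 _ J l) => //; first by move=> i; exact: D'E.
  by rewrite (corner_hlabel' hkn hc).
by apply: (co i0) => // j; exact: D'E.
Qed.

Lemma loops_unpeel A T : tab D T -> gale lam' A -> loops lam' D' A ->
  loops lam D (unpeel l l1 (T c) A).
Proof.
move=> TD Ag Alo; case: (Alo) => lo co nlo nco.
have star J cD := @loops_star A J cD Alo.
have cDE : (T c == 0) = (c \notin D) by exact: tab_eq0.
have D'E b : b != c -> (b \in D') = (b \in D) by rewrite in_setD1 => ->.
have hE j : j != j0 -> hlabel lam' j = hlabel lam j by exact: (corner_hlabel_neq hc).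
have hl1 : hlabel lam j0 = l1 by exact: (corner_hlabel hkn hc).
have hl : hlabel lam' j0 = l by exact: (corner_hlabel' hkn hc).
have col_neq j (y : 'I_n) : j != j0 -> val y = hlabel lam j -> (y != l) && (y != l1).
  move=> jj yj; apply/andP; split; apply/eqP => E; case/eqP: (jj).
    apply: (@hlabel_inj _ _ hkn lam'); rewrite hl -E.
    by rewrite hE.
  by apply: (@hlabel_inj _ _ hkn lam); rewrite hl1 -E -yj.
have row_neq i : i != i0 -> (vl lam i != l) && (vl lam i != l1).
  move=> ii; rewrite (inj_eq (@vlab_inj _ _ _ _)) ii /=.
  by apply: contraNneq l1I => <-; exact: vlab_in.
(* The set [VL lam'] contains [l1] and misses [l], so it shows both that [l1] is not a loop and that
   [l] is not a coloop. *)
have base0 : c \in D -> minor (unpeel l l1 (T c) A) (VL lam') != 0.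
  move=> cD; rewrite minor_unpeelR // cDE cD /=; by case: Ag.
split.
- move=> j Hj J y hJ yJ yj.
  have [jj|jj] := eqVneq j j0.
    have cD : c \notin D by rewrite /c -jj.
    have y1 : y = l1 by apply: val_inj; rewrite yj jj hl1.
    rewrite y1 in yJ; have Hl (X : {set 'I_n}) : #|X| = k -> l \in X -> minor A X = 0.
      move=> hX lX; apply: (lo j0 _ X l) => // i.
      by rewrite in_setD1 negb_and -jj Hj orbT.
    have [lJ|lJ] := boolP (l \in J).
      by rewrite minor_unpeel2 // Hl // mulr0.
    rewrite minor_unpeelR // cDE cD Hl ?oppr0 ?card_exchange //.
    by rewrite in_setU1 eqxx.
  have /andP[yl yl1] := col_neq _ _ jj yj.
  have Hy (X : {set 'I_n}) : #|X| = k -> y \in X -> minor A X = 0.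
    move=> hX yX; apply: (lo j _ X y) => //; last by rewrite hE.
    by move=> i; rewrite D'E ?Hj // xpair_eqE (negbTE jj) andbF.
  apply: minor_unpeel_eq0 => // [|h1 h2|h1 h2]; rewrite Hy ?card_exchange //;
    by rewrite in_setU1 in_setD1 ?yl ?yl1 yJ orbT.
- move=> i Hi J hJ yJ.
  have [ii|ii] := eqVneq i i0.
    have cD : c \notin D by rewrite /c -ii.
    rewrite ii -/l in yJ.
    have Hl1 (X : {set 'I_n}) : #|X| = k -> l1 \notin X -> minor A X = 0.
      move=> hX lX; apply: (co i0 _ X) => // j.
      by rewrite in_setD1 negb_and -ii Hi orbT.
    have [l1J|l1J] := boolP (l1 \in J); last by rewrite minor_unpeel0 // Hl1.
    rewrite minor_unpeelR // cDE cD Hl1 ?oppr0 ?card_exchange //.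
    by rewrite in_setU1 in_setD1 eqxx neql.
  have /andP[yl yl1] := row_neq _ ii.
  have Hy (X : {set 'I_n}) : #|X| = k -> vl lam i \notin X -> minor A X = 0.
    move=> hX yX; apply: (co i _ X) => //; last by rewrite (corner_vlab hkn hc).
    by move=> j; rewrite D'E ?Hi // xpair_eqE (negbTE ii).
  apply: minor_unpeel_eq0 => // [|h1 h2|h1 h2]; rewrite Hy ?card_exchange //;
    by rewrite in_setU1 in_setD1 negb_or ?yl ?yl1 (negbTE yJ) andbF.
- move=> i j ijD; have [jj|jj] := eqVneq j j0.
    have [cD|cD] := boolP (c \in D).
      exists (VL lam'), l1; split=> //; [by rewrite jj hl1|exact: base0].
    have ijc : (i, j) != c by apply: contraNneq cD => <-.
    have [J [y [hJ yJ yj J0]]] : exists J (y : 'I_n),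
        [/\ #|J| = k, y \in J, val y = hlabel lam' j & minor A J != 0].
      by apply: (nlo i); rewrite D'E.
    have y1 : y = l by apply: val_inj; rewrite yj jj hl.
    rewrite y1 in yJ; have l1J : l1 \in J.
      by apply: contraNT J0 => l1J; rewrite star.
    exists J, l1; split=> //; first by rewrite jj hl1.
    by rewrite minor_unpeel2 // cDE cD mul1r.
  have [J [y [hJ yJ yj J0]]] : exists J (y : 'I_n),
      [/\ #|J| = k, y \in J, val y = hlabel lam' j & minor A J != 0].
    by apply: (nlo i); rewrite D'E // xpair_eqE (negbTE jj) andbF.
  have [J' [hJ' J'0 J'E]] := minor_unpeel_neq0 (T c) hJ J0.
  rewrite hE // in yj; exists J', y; split=> //.
  by have /andP[yl yl1] := col_neq _ _ jj yj; rewrite J'E.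
- move=> i j ijD; have [ii|ii] := eqVneq i i0.
    rewrite ii -/l; have [cD|cD] := boolP (c \in D).
      exists (VL lam'); split=> //; exact: base0.
    have ijc : (i, j) != c by apply: contraNneq cD => <-.
    have [J [hJ yJ J0]] : exists J,
        [/\ #|J| = k, vl lam' i \notin J & minor A J != 0].
      by apply: (nco i j); rewrite D'E.
    rewrite ii -/l1 in yJ; have lJ : l \notin J.
      by apply: contraNN J0 => lJ; rewrite star.
    by exists J; split=> //; rewrite minor_unpeel0.
  have [J [hJ yJ J0]] : exists J,
      [/\ #|J| = k, vl lam' i \notin J & minor A J != 0].
    by apply: (nco i j); rewrite D'E // xpair_eqE (negbTE ii).
  have [J' [hJ' J'0 J'E]] := minor_unpeel_neq0 (T c) hJ J0.
  rewrite (corner_vlab hkn hc) // in yJ; exists J'; split=> //.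
  by have /andP[yl yl1] := row_neq _ ii; rewrite J'E.
Qed.

End Step.

Record realizes lam D (P : {set 'I_n} -> tableau k n R -> R) T A : Prop := Realizes {
  realizes_MR : MR hkn lam T A;
  realizes_gale : gale lam A;
  realizes_minor : forall J, #|J| = k -> minor A J = P J T * minor A (VL lam);
  realizes_loops : loops lam D A }.

(** The family [P] is chosen before the tableau: the same polynomials give the minors, relative to
    the one at [VL lam], for all tableaux of the diagram. *)
Lemma forward lam D : is_Le lam D -> exists P : {set 'I_n} -> tableau k n R -> R,
  (forall J, polf (P J)) /\
  forall T, tab D T -> exists A, realizes lam D P T A.
Proof.
have [m lm] := ubnP (\sum_i val lam i)%N.
elim: m lam lm D => // m IH lam lm D hD.
have [lam0|[lam' [i0 [j0 hc]]]] := cornerP hkn lam.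
  have D0 b : b \notin D.
    apply/negP => bD; case/is_LeP: hD => /fintype.subsetP/(_ b bD).
    by rewrite inE lam0 ltn0.
  exists (fun J _ => (J == VL lam)%:R); split=> [J|T TD].
    by case: eqP => _; [exact: polf1|exact: polf0].
  pose A : 'M[R]_(k, n) := \matrix_(i, c) (c == vl lam i)%:R.
  have Ae : echelon hkn lam A.
    split=> [i c ci|i]; rewrite mxE ?eqxx ?oner_neq0 //.
    by rewrite -(inj_eq val_inj) ltn_eqF.
  have A1 : minor A (VL lam) = 1.
    rewrite (minor_vlab hkn) echelon_dtf => [|i j ji].
      by rewrite big1 // => i _; rewrite mxE eqxx.
    by case: Ae => -> //; exact: vlab_lt.
  have AJ J (c : 'I_n) : #|J| = k -> c \in J -> c \notin VL lam -> minor A J = 0.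
    move=> hJ cJ cI; apply: (minor_col0 hJ cJ) => i; rewrite mxE.
    by case: eqP => // ci; rewrite ci vlab_in in cI.
  have AJ' J : #|J| = k -> minor A J = (J == VL lam)%:R.
    move=> hJ; have [->//|JI] := eqVneq J (VL lam).
    have : ~~ (J \subset VL lam).
      apply: contra JI => JI; rewrite finset.eqEcard JI /=.
      by rewrite hJ (card_vlab hkn).
    by case/fintype.subsetPn => c cJ cI; exact: (AJ J c).
  have T0 b : T b = 0 by apply/eqP; rewrite (tab_eq0 b TD).
  exists A; split.
  - split=> [|i t tI]; first by rewrite A1 oner_neq0.
    rewrite (AJ _ t) ?card_exchange ?vlab_in // ?(card_vlab hkn) ?in_setU1 ?eqxx //.
    rewrite /hmeas (@hscan_tail _ _ _ 0%N) //= ?mul0r // => j _.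
    by apply: (@tn_eq0 _ _ _ _ _ 0%N).
  - exact: echelon_gale.
  - by move=> J hJ; rewrite A1 mulr1 AJ'.
  - split=> [j _ J c hJ cJ cj|i _ J hJ iJ|i j|i j].
    + apply: (AJ J c) => //; apply/negP; rewrite (vlabE hkn) => /imsetP[i _ ci].
      by have := hlabel_vlabel hkn lam i j; rewrite -cj ci eqxx.
    + by rewrite AJ' //; case: eqP => // JI; rewrite JI vlab_in in iJ.
    + by rewrite (negbTE (D0 _)).
    + by rewrite (negbTE (D0 _)).
have lm' : (\sum_i val lam' i < m)%N by rewrite -ltnS -(corner_sum hc).
have [P' [P'p P'r]] := IH lam' lm' (D :\ (i0, j0)) (is_Le_peel hc hD).
pose l := vl lam i0; pose l1 := vl lam' i0; pose c := (i0, j0).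
have ll1 : val l1 = l.+1 := corner_succ hkn hc.
have l1I : l1 \notin VL lam := corner_notin hkn hc.
(* These are the minors of [unpeel] divided by the one at [VL lam]. For a nonzero entry that base
   minor contains [(T c)^-1], so the division clears all denominators; for a zero entry the only
   negative minor is 0 by [loops_star]. *)
pose P J T : R := if c \in D then
    if l \in J then if l1 \in J then P' J (clear c T)
      else P' J (clear c T) + P' (l1 |: J :\ l) (clear c T)
    else T c * P' J (clear c T)
  else if l \in J then if l1 \in J then P' J (clear c T)
      else P' (l1 |: J :\ l) (clear c T)
    else if l1 \in J then 0 else P' J (clear c T).
exists P; split=> [J|T TD].
  rewrite /P; case: (c \in D); case: (l \in J); case: (l1 \in J);
    try exact: polf_clear; try exact: polf0.
  - by apply: polfD; exact: polf_clear.
  - by apply: polfM; [exact: polf_var|exact: polf_clear].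
  - by apply: polfM; [exact: polf_var|exact: polf_clear].
have [A' [A'M A'g A'm A'l]] := P'r _ (tab_clear i0 j0 TD).
have hT := tab_supported hD TD.
exists (unpeel l l1 (T c) A'); split.
- exact: MR_unpeel.
- exact: (gale_unpeel hkn hc (T c) A'g).
- move=> J hJ; rewrite (minor_unpeel_base hkn hc) // /P.
  have cDE : (T c == 0) = (c \notin D) by exact: tab_eq0.
  rewrite cDE; set mI := minor A' (VL lam') in A'm *.
  have [cD|cD] /= := boolP (c \in D).
    have x0 : T c != 0 by rewrite cDE cD.
    have [lJ|lJ] := boolP (l \in J); have [l1J|l1J] := boolP (l1 \in J).
    + by rewrite minor_unpeel2 // (negbTE x0) A'm // mulrCA.
    + rewrite minor_unpeelL // (negbTE x0) !A'm ?card_exchange //; ring.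
    + by rewrite minor_unpeelR // (negbTE x0) A'm // mulrACA divff // mul1r.
    + by rewrite minor_unpeel0 // A'm // mulrACA divff // mul1r.
  have x0 : T c == 0 by rewrite cDE.
  have star := loops_star hc hD cD A'l.
  rewrite mul1r.
  have [lJ|lJ] := boolP (l \in J); have [l1J|l1J] := boolP (l1 \in J).
  + by rewrite minor_unpeel2 // x0 mul1r A'm.
  + by rewrite minor_unpeelL // x0 A'm ?card_exchange.
  + rewrite minor_unpeelR // x0 star ?oppr0 ?mul0r ?card_exchange //.
      by rewrite in_setU1 eqxx.
    by rewrite in_setU1 in_setD1 eqxx -(inj_eq val_inj) ll1 gtn_eqF.
  + by rewrite minor_unpeel0 // A'm.
- exact: loops_unpeel.
Qed.

End Forward.

(** * The tableau of a matrix *)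

Section Inverse.
Local Open Scope ring_scope.
Variables (R : realType) (k n : nat).
Hypothesis hkn : (k <= n)%N.
Implicit Types (A B : 'M[R]_(k, n)) (J : {set 'I_n}) (M : {set {set 'I_n}}).
Implicit Types (T : tableau k n R) (D : {set 'I_k * 'I_(n - k)}).
Implicit Types (lam : partition_in k (n - k)) (i : 'I_k) (j : 'I_(n - k)).
Notation vl := (vlab hkn).
Notation VL := (@vertical_labels k n).

(** The measurements determine [A] up to GL_k, so [A] may be replaced by the [unpeel] of a matrix
    that [forward] provides for the smaller diagram. *)
Lemma MR_peel lam lam' i0 j0 D T A : corner lam lam' i0 j0 -> is_Le lam D ->
  tab D T -> MR hkn lam T A -> cx lam lam' A = T (i0, j0) /\
  MR hkn lam' (clear (i0, j0) T) (peel (vl lam i0) (vl lam' i0) (T (i0, j0)) A).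
Proof.
move=> hc hD TD TA; have hT := tab_supported hD TD; split.
  rewrite /cx (corner_labels hkn hc); case: TA => A0 ->; last exact: corner_notin hc.
  rewrite mulfK // (hmeas_corner hkn hc hT) (hmeas_l1 hkn hc hT) eqxx addr0 mulr1.
  by case: eqP => // ->.
have [P [_ /(_ _ (tab_clear i0 j0 TD))[B [BM Bg _ _]]]] := forward R hkn (is_Le_peel hc hD).
have [G Gu ->] := MR_uniq (MR_unpeel hc hT Bg BM) TA.
by rewrite peel_mulmx unpeelK ?(corner_succ hkn hc) //; apply/MR_mulmx.
Qed.

Lemma le_empty lam D b : (forall i, val lam i = 0 :> nat) -> is_Le lam D -> b \notin D.
Proof.
move=> lam0 /is_LeP[/fintype.subsetP hD _]; apply/negP => /hD.
by rewrite inE lam0 ltn0.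
Qed.

Lemma MR_inj lam D1 D2 T1 T2 A : is_Le lam D1 -> is_Le lam D2 ->
  tab D1 T1 -> tab D2 T2 -> MR hkn lam T1 A -> MR hkn lam T2 A -> T1 = T2.
Proof.
have [m lm] := ubnP (\sum_i val lam i)%N.
elim: m lam lm D1 D2 T1 T2 A => // m IH lam lm D1 D2 T1 T2 A h1 h2 t1 t2 m1 m2.
have [lam0|[lam' [i0 [j0 hc]]]] := cornerP hkn lam.
  apply/ffunP => b; transitivity (0 : R).
    by apply/eqP; rewrite (tab_eq0 b t1) (le_empty b lam0 h1).
  by apply/esym/eqP; rewrite (tab_eq0 b t2) (le_empty b lam0 h2).
have [x1 p1] := MR_peel hc h1 t1 m1; have [x2 p2] := MR_peel hc h2 t2 m2.
have lm' : (\sum_i val lam' i < m)%N by rewrite -ltnS -(corner_sum hc).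
have E := IH lam' lm' _ _ _ _ _ (is_Le_peel hc h1) (is_Le_peel hc h2)
  (tab_clear i0 j0 t1) (tab_clear i0 j0 t2) p1.
rewrite -x1 x2 in E; have {}E := E p2.
apply/ffunP => b; have [->|bc] := eqVneq b (i0, j0); first by rewrite -x1 x2.
by have := congr1 (fun T : tableau k n R => T b) E; rewrite !ffunE (negbTE bc).
Qed.

(* Subtraction-free rational functions of the minors, on the domain [X]. *)
Inductive sff (X : 'M[R]_(k, n) -> Prop) : ('M[R]_(k, n) -> R) -> Prop :=
| sff0 : sff X (fun=> 0)
| sff1 : sff X (fun=> 1)
| sff_minor J : #|J| = k -> sff X (fun A => minor A J)
| sffD F G : sff X F -> sff X G -> sff X (fun A => F A + G A)
| sffM F G : sff X F -> sff X G -> sff X (fun A => F A * G A)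
| sffV F G : sff X F -> sff X G -> (forall A, X A -> G A != 0) ->
    sff X (fun A => F A / G A)
| sff_ext F G : sff X F -> (forall A, X A -> F A = G A) -> sff X G.

Lemma sff_comp (X X' : 'M[R]_(k, n) -> Prop) f F :
  (forall A, X A -> X' (f A)) ->
  (forall J, #|J| = k -> sff X (fun A => minor (f A) J)) ->
  sff X' F -> sff X (fun A => F (f A)).
Proof.
move=> fX fm; elim=> [||J hJ|F1 F2 _ h1 _ h2|F1 F2 _ h1 _ h2|F1 F2 _ h1 _ h2 h3|F1 F2 _ h1 h2].
- exact: sff0.
- exact: sff1.
- exact: fm.
- exact: sffD.
- exact: sffM.
- by apply: sffV => // A /fX; exact: h3.
- by apply: (sff_ext h1) => A /fX; exact: h2.
Qed.

Definition stratum lam M A := [/\ gale lam A, tnn lam A &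
  forall J, #|J| = k -> (minor A J != 0) = (J \in M)].

Lemma stratum_mulmx lam M (G : 'M[R]_k) A : G \in unitmx ->
  stratum lam M A -> stratum lam M (G *m A).
Proof.
move=> Gu [h1 h2 h3]; split; [exact/gale_mulmx|exact/tnn_mulmx|move=> J hJ].
rewrite minor_mulmx // mulf_eq0 negb_or h3 //.
by rewrite -unitfE -unitmxE Gu.
Qed.

(** The column [u] is nonzero because [J1] is a base. It therefore has a nonzero coordinate in the
    base [J2], and can replace the corresponding column. *)
Lemma basis_exchange A J1 J2 (u v : 'I_n) : #|J1| = k -> #|J2| = k -> u != v ->
  minor A J1 != 0 -> minor A J2 != 0 -> u \in J1 -> v \notin J2 ->
  exists J, [/\ #|J| = k, u \in J, v \notin J & minor A J != 0].
Proof.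
move=> h1 h2 uv m1 m2 uJ vJ.
have [uJ2|uJ2] := boolP (u \in J2); first by exists J2.
have d2 : dtf A (sof h2) != 0 by rewrite -minor_sof.
have [p Np] : exists p, nrm A (sof h2) p u != 0.
  apply: contrapT => /forallNP H; case/eqP: m1.
  apply: (minor_col0 h1 uJ) => i; rewrite (nrmK d2) mxE big1 // => p _.
  by have /negP/negPn/eqP -> := H p; rewrite mulr0.
have d : dtf A (upd (sof h2) p u) != 0 by rewrite (dtf_nrm _ d2) dtf_nrm1 ?mulf_neq0.
exists (upd (sof h2) p u @: 'I_k); split.
- by rewrite card_imset ?card_ord //; exact: dtf_neq0_inj d.
- by apply/imsetP; exists p => //; rewrite /upd eqxx.
- apply/imsetP => -[q _]; rewrite /upd; case: eqP => _ E; first by rewrite E eqxx in uv.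
  by rewrite E sof_in in vJ.
- exact: dtf_neq0_minor.
Qed.

Section Step.
Variables (lam lam' : partition_in k (n - k)) (i0 : 'I_k) (j0 : 'I_(n - k)).
Hypothesis hc : corner lam lam' i0 j0.
Let l := vl lam i0.
Let l1 := vl lam' i0.
Let ll1 : val l1 = l.+1 := corner_succ hkn hc.
Let hI : #|VL lam| = k := card_vlab hkn lam.
Let hI' : #|VL lam'| = k := card_vlab hkn lam'.
Variable M : {set {set 'I_n}}.
Notation Y := (stratum lam M).
Let f A := peel l l1 (cx lam lam' A) A.

Lemma stratum_cx A : Y A -> (cx lam lam' A == 0) = (VL lam' \notin M).
Proof.
move=> [[A0 _] _ <- //]; rewrite negbK /cx mulf_eq0 invr_eq0 (negbTE A0).
by rewrite orbF.
Qed.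

Lemma sff_cx : sff Y (cx lam lam').
Proof.
apply: sffV; [exact: sff_minor|exact: sff_minor|by move=> A [[]]].
Qed.

(** The second clause makes the matroid of the peeled matrix the same on the whole stratum; it has
    to be proved together with the first, since nonvanishing makes later divisions legitimate. *)
Definition dichotomy (F : 'M[R]_(k, n) -> R) := sff Y F /\
  ((forall A, Y A -> F A = 0) \/ (forall A, Y A -> F A != 0)).

Lemma dichotomy_ext F G : dichotomy F -> (forall A, Y A -> F A = G A) -> dichotomy G.
Proof.
move=> [h1 h2] FG; split; first exact: sff_ext FG.
by case: h2 => h; [left|right] => A YA; rewrite -FG ?h.
Qed.

Lemma dichotomy_minor J : #|J| = k -> dichotomy (fun A => minor A J).
Proof.
move=> hJ; split; first exact: sff_minor.
have [JM|JM] := boolP (J \in M); [right|left] => A [_ _ /(_ J hJ) E].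
  by rewrite E.
by apply/eqP; rewrite -[_ == _]negbK E.
Qed.

Lemma dichotomyM F G : dichotomy F -> dichotomy G -> dichotomy (fun A => F A * G A).
Proof.
move=> [h1 h2] [h3 h4]; split; first exact: sffM.
case: h2 => h2; first by left => A YA; rewrite h2 ?mul0r.
case: h4 => h4; first by left => A YA; rewrite h4 ?mulr0.
by right => A YA; rewrite mulf_neq0 ?h2 ?h4.
Qed.

Lemma dichotomy_delta J : #|J| = k -> l \in J -> l1 \notin J ->
  dichotomy (fun A => delta l l1 (cx lam lam' A) A J).
Proof.
have [m mJ] := ubnP (right_part hkn lam' i0 J).
elim: m J mJ => // m IH J mJ hJ lJ l1J.
have [H|/existsNP[A0 /not_implyP[YA0 /eqP d0]]] :=
    pselect (forall A, Y A -> delta l l1 (cx lam lam' A) A J = 0).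
  split; last by left.
  by apply: (sff_ext (sff0 _)) => A /H ->.
have [A0g A0t A0M] := YA0.
(* The labels [e] and [b] come from the single matrix [A0]. They serve the whole stratum, since the
   nonvanishing of the denominator is membership of [J1] in [M]. *)
have [e [b [el l1b bJ eJ m0]]] := delta_exchange hc A0g hJ lJ l1J d0.
pose J1 := e |: J :\ b.
have hJ1 : #|J1| = k by rewrite card_exchange.
have [lJ1 l1J1] := exchange_labels hc el l1b lJ l1J.
have J1m : (right_part hkn lam' i0 J1 < m)%N.
  by rewrite -ltnS; apply: leq_trans mJ; rewrite ltnS (right_part_exchange hc).
have [d1s d1] := IH J1 J1m hJ1 lJ1 l1J1.
have hJ2 : #|e |: J :\ l| = k by rewrite card_exchange.
have hJ3 : #|l1 |: J :\ b| = k by rewrite card_exchange.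
have J1M : J1 \in M by rewrite -A0M.
have J10 A : Y A -> minor A J1 != 0 by move=> [_ _ ->].
have st A := delta_step (cx lam lam' A) ll1 A hJ lJ l1J el l1b bJ eJ.
have dE A : Y A -> (minor A J * delta l l1 (cx lam lam' A) A J1 +
    minor A (e |: J :\ l) * minor A (l1 |: J :\ b)) / minor A J1 =
    delta l l1 (cx lam lam' A) A J.
  by move=> YA; rewrite -st mulfK ?J10.
split.
  apply: sff_ext dE; apply: sffV => //; last exact: sff_minor.
  by apply: sffD; apply: sffM => //; exact: sff_minor.
have [_ t1] := dichotomyM (dichotomy_minor hJ) (IH J1 J1m hJ1 lJ1 l1J1).
have [_ t2] := dichotomyM (dichotomy_minor hJ2) (dichotomy_minor hJ3).
right => A YA; rewrite -dE // mulf_neq0 ?invr_eq0 ?J10 //.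
have [Ag At AM] := YA; have V0 : minor A (VL lam) != 0 by case: Ag.
have V2 : 0 < minor A (VL lam) * minor A (VL lam).
  by rewrite -expr2 exprn_even_gt0.
set X1 := minor A J * _; set X2 := minor A (e |: J :\ l) * _.
have p1 : 0 <= X1.
  rewrite -(pmulr_lge0 _ V2) mulrACA; apply: mulr_ge0; first exact: At.
  exact: (delta_ge0 hc).
have p2 : 0 <= X2.
  by rewrite -(pmulr_lge0 _ V2) mulrACA; apply: mulr_ge0; exact: At.
(* Each of the two nonnegative summands is identically zero or never zero, and [A0] excludes that
   both are identically zero. *)
case: t1 => t1; last first.
  by rewrite gt_eqF // ltr_wpDr // lt_neqAle eq_sym p1 (t1 _ YA).
case: t2 => t2; last first.
  by rewrite gt_eqF // ltr_wpDl // lt_neqAle eq_sym p2 (t2 _ YA).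
by case/eqP: d0; rewrite -dE // t1 // t2 // addr0 mul0r.
Qed.

Lemma dichotomy_peel J : #|J| = k -> dichotomy (fun A => minor (f A) J).
Proof.
move=> hJ.
have [lJ|lJ] := boolP (l \in J); have [l1J|l1J] := boolP (l1 \in J).
- have [I'M|I'M] := boolP (VL lam' \in M); last first.
    apply: (dichotomy_ext (dichotomy_minor hJ)) => A YA.
    by rewrite /f minor_peel2 // stratum_cx // I'M mul1r.
  apply: (dichotomy_ext (F := fun A => cx lam lam' A * minor A J)).
    apply: dichotomyM; last exact: dichotomy_minor.
    split; first exact: sff_cx.
    by right => A YA; rewrite stratum_cx // I'M.
  by move=> A YA; rewrite /f minor_peel2 // stratum_cx // I'M.
- apply: (dichotomy_ext (dichotomy_delta hJ lJ l1J)) => A YA.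
  by rewrite /f minor_peelL.
- have [I'M|I'M] := boolP (VL lam' \in M).
    apply: (dichotomy_ext (dichotomy_minor hJ)) => A YA.
    by rewrite /f minor_peelR // stratum_cx // I'M.
  apply: (dichotomy_ext (F := fun A => minor A (l |: J :\ l1))).
    by apply: dichotomy_minor; rewrite card_exchange.
  by move=> A YA; rewrite /f minor_peelR // stratum_cx // I'M.
- apply: (dichotomy_ext (dichotomy_minor hJ)) => A YA.
  by rewrite /f minor_peel0.
Qed.

(** On a nonempty stratum, [dichotomy_peel] makes nonvanishing at one matrix equivalent to
    nonvanishing at all. *)
Definition peel_matroid : {set {set 'I_n}} :=
  finset (fun J => `[< forall A, Y A -> minor (f A) J != 0 >]).

Lemma stratum_peel A : Y A -> stratum lam' peel_matroid (f A).
Proof.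
move=> YA; have [Ag At AM] := YA; split; [exact: (gale_peel hkn hc Ag)|exact: (tnn_peel hkn hc Ag At)|].
move=> J hJ; rewrite inE; have [_ [H|H]] := dichotomy_peel hJ.
  rewrite H // eqxx; apply/esym/negbTE/negP => /asboolP/(_ A YA).
  by rewrite H // eqxx.
by rewrite H //; apply/esym/asboolP.
Qed.

Lemma stratum_emptiness A D T : Y A -> VL lam' \notin M -> is_Le lam' D ->
  tab D T -> MR hkn lam' T (f A) ->
  (forall i, (i, j0) \notin D) \/ (forall j, (i0, j) \notin D).
Proof.
move=> YA I'M hD TD TM; have [Ag At _] := YA.
apply: contrapT => /not_orP[/existsNP[i /negP/negPn iD] /existsNP[j /negP/negPn jD]].
have [P [_ /(_ _ TD)[B [BM _ _ Blo]]]] := forward R hkn hD.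
have [G Gu GE] := MR_uniq TM BM.
have nz J : #|J| = k -> minor B J != 0 -> minor (f A) J != 0.
  by move=> hJ; rewrite GE minor_mulmx // mulf_eq0 negb_or => /andP[].
have [J1 [y [h1 yJ yl m1]]] := nonloop_col Blo iD.
have {}yl : y = l by apply: val_inj; rewrite yl (corner_hlabel' hkn hc).
rewrite yl in yJ.
have [J2 [h2 l1J m2]] := noncoloop_row Blo jD.
have ll : l != l1 by rewrite -(inj_eq val_inj) ll1 ltn_eqF.
have [J [hJ lJ {}l1J mJ]] := basis_exchange h1 h2 ll (nz _ h1 m1) (nz _ h2 m2) yJ l1J.
case/eqP: mJ; rewrite /f minor_peelL //.
have x0 : cx lam lam' A = 0 by apply/eqP; rewrite stratum_cx.
(* With [x = 0] the difference D_J is minus a minor of [A]: relative to the base minor it is both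
   nonnegative and nonpositive, hence 0. *)
have := delta_ge0 hc Ag At hJ lJ l1J.
rewrite x0 /delta mul0r sub0r => h.
have V0 : minor A (VL lam) != 0 by case: Ag.
have h' : 0 <= minor A (l1 |: J :\ l) * minor A (VL lam).
  by apply: At; rewrite card_exchange.
apply: (mulIf V0); rewrite mul0r; apply/eqP; rewrite eq_le h andbT.
by rewrite mulNr oppr_le0.
Qed.

End Step.

Lemma parametrize lam M : (exists A, stratum lam M A) ->
  exists D (F : 'I_k * 'I_(n - k) -> 'M[R]_(k, n) -> R),
  [/\ is_Le lam D, forall b, sff (stratum lam M) (F b) &
    forall A, stratum lam M A ->
      tab D [ffun b => F b A] /\ MR hkn lam [ffun b => F b A] A].
Proof.
have [m lm] := ubnP (\sum_i val lam i)%N.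
elim: m lam lm M => // m IH lam lm M [A0 YA0].
have [lam0|[lam' [i0 [j0 hc]]]] := cornerP hkn lam.
  exists finset.set0, (fun _ _ => 0); split.
  - apply/is_LeP; split; first exact: finset.sub0set.
    by move=> i i' j j' _ _; rewrite finset.in_set0.
  - by move=> b; exact: sff0.
  move=> A [Ag _ _]; split.
    by move=> b; rewrite ffunE finset.in_set0 ltxx; split.
  split; first by case: Ag.
  move=> i t tI; rewrite /hmeas (@hscan_tail _ _ _ 0%N) //= ?mul0r; last first.
    by move=> j _; apply: (@tn_eq0 _ _ _ _ _ 0%N) => // j' _; rewrite ffunE.
  (* For the empty shape the base consists of the last [k] labels, so any other label precedes all
     of them and every exchange minor vanishes. *)
  apply: (gale_exchange0 hkn Ag) => //; first exact: vlab_in.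
  rewrite ltnNge; apply: contra tI => it; rewrite (vlabE hkn).
  have tn := ltn_ord t; have tk : (t - (n - k) < k)%N.
    by move: it; rewrite /= /vlabel lam0; lia.
  apply/imsetP; exists (Ordinal tk) => //; apply: val_inj.
  by rewrite /vlab /= /vlabel lam0 subn0 /=; move: it; rewrite /vlab /= /vlabel lam0 subn0; clear; lia.
have lm' : (\sum_i val lam' i < m)%N by rewrite -ltnS -(corner_sum hc).
pose f A := peel (vl lam i0) (vl lam' i0) (cx lam lam' A) A.
have fY A : stratum lam M A -> stratum lam' (peel_matroid lam lam' i0 M) (f A).
  exact: (stratum_peel hc).
have [|D' [F' [hD' F's F'P]]] := IH lam' lm' (peel_matroid lam lam' i0 M).
  by exists (f A0); exact: fY.
pose c := (i0, j0).
have cD' : c \notin D'.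
  apply: contra (corner_notin_diagram hc); case/is_LeP: hD' => /fintype.subsetP h _.
  exact: h.
(* The corner entry is the ratio of the minors at [VL lam'] and [VL lam], so the corner contains a 1
   exactly when [VL lam'] is a base. *)
pose D := if VL lam' \in M then c |: D' else D'.
pose F b A := if b == c then cx lam lam' A else F' b (f A).
have tabF A : stratum lam M A -> tab D [ffun b => F b A].
  move=> YA b; rewrite ffunE /F.
  have [tD _] := F'P _ (fY _ YA).
  have := stratum_cx lam' YA; have [_ At _] := YA => xE.
  have [->|bc] := eqVneq b c.
    split; first exact: cx_ge0 At.
    rewrite lt_neqAle eq_sym xE negbK /D (cx_ge0 hkn lam' At) andbT.
    by case: ifP => _; rewrite ?in_setU1 ?eqxx // (negbTE cD').
  have := tD b; rewrite ffunE /D; case: ifP => // _.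
  by rewrite in_setU1 (negbTE bc).
have clearF A : stratum lam M A ->
    clear c [ffun b => F b A] = [ffun b => F' b (f A)].
  move=> YA; apply/ffunP => b; rewrite !ffunE /F; case: eqP => // ->.
  have [tD _] := F'P _ (fY _ YA).
  by apply/esym/eqP; have := tab_eq0 c tD; rewrite ffunE cD'.
have hD : is_Le lam D.
  rewrite /D; case: ifP => [_|/negbT I'M]; first exact: (is_Le_add hc).
  apply: (is_Le_keep hc hD').
  have [tD tM] := F'P _ (fY _ YA0).
  exact: (stratum_emptiness hc YA0 I'M hD' tD tM).
exists D, F; split=> //.
  move=> b; rewrite /F; case: eqP => _; first exact: sff_cx.
  apply: (@sff_comp _ (stratum lam' (peel_matroid lam lam' i0 M)) f) => //.
  by move=> J hJ; case: (dichotomy_peel hc M hJ).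
move=> A YA; split; first exact: tabF.
have [tD tM] := F'P _ (fY _ YA).
have hT := tab_supported hD (tabF _ YA).
have [Ag' _ _] := fY _ YA.
have := @MR_unpeel _ _ _ hkn _ _ _ _ hc _ hT _ Ag'.
rewrite clearF // => /(_ tM); rewrite ffunE /F eqxx peelK //.
exact: (corner_succ hkn hc).
Qed.

End Inverse.

(** * Schubert cells *)

Section Schubert.
Local Open Scope ring_scope.
Variables (R : realType) (k n : nat).
Hypothesis hkn : (k <= n)%N.
Implicit Types (A B : 'M[R]_(k, n)) (J : {set 'I_n}) (V : {vspace 'rV[R]_n}).
Implicit Types (lam : partition_in k (n - k)) (i : 'I_k) (j : 'I_(n - k)).
Notation vl := (vlab hkn).
Notation VL := (@vertical_labels k n).

(** If [f p < g p], then at the threshold [f p] the function [f] has at least one more value than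
    [g]: the index [p] counts for [f] only, later indices do not count for [g], and earlier ones all
    count for [f]. *)
Lemma incr_cnt_le (f g : 'I_k -> 'I_n) :
  (forall i j : 'I_k, (i < j)%N -> (f i < f j)%N) ->
  (forall i j : 'I_k, (i < j)%N -> (g i < g j)%N) ->
  (forall c : nat, \sum_i (f i <= c) <= \sum_i (g i <= c))%N ->
  forall i, (g i <= f i)%N.
Proof.
move=> fi gi fg p; rewrite leqNgt; apply/negP => fp.
have := fg (f p); rewrite leqNgt => /negP; apply.
have le1 : (\sum_(i < k | i != p) (g i <= f p) <= \sum_(i < k | i != p) (f i <= f p))%N.
  apply: leq_sum => i ip; case: (ltngtP i p) => ii.
  - by rewrite (ltnW (fi _ _ ii)); exact: leq_b1.
  - by rewrite [X in (nat_of_bool X <= _)%N]leqNgt (ltn_trans fp (gi _ _ ii)).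
  - by rewrite (val_inj ii) eqxx in ip.
rewrite (bigD1 p) //= [X in (_ < X)%N](bigD1 p) //= leqnn.
by rewrite [(g p <= f p)%N]leqNgt fp add0n add1n ltnS.
Qed.

Lemma cnt_sof J (hJ : #|J| = k) c : cnt J c = (\sum_i (sof hJ i <= c))%N.
Proof.
have JE : J = sof hJ @: 'I_k.
  apply/setP => y; apply/idP/imsetP => [/(sof_onto hJ)[j <-]|[j _ ->]].
    by exists j.
  exact: sof_in.
by rewrite {1}JE /cnt big_imset //= => i j _ _; exact: sof_inj.
Qed.

Lemma lexi_nth (s t : seq 'I_n) (x0 : 'I_n) : size s = size t ->
  (forall p, (p < size s)%N -> (nth x0 s p <= nth x0 t p)%N) ->
  (s <= t :> seqlexi 'I_n)%O.
Proof.
elim: s t => [|x s IH] [|y t] //= [st] H.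
rewrite Order.SeqLexiOrder.Exports.lexi_cons; apply/andP; split; first exact: (H 0%N).
by apply/implyP => _; apply: IH => // p ps; exact: (H p.+1).
Qed.

Lemma cnt_lexi (I J : {set 'I_n}) : #|I| = k -> #|J| = k -> (forall c, cnt J c <= cnt I c)%N ->
  (enum I <= enum J :> seqlexi 'I_n)%O.
Proof.
move=> hI hJ JI.
have H := @incr_cnt_le (sof hJ) (sof hI) (@sof_lt _ _ _ hJ) (@sof_lt _ _ _ hI).
have {}H : forall i, (sof hI i <= sof hJ i)%N.
  by apply: H => c; rewrite -!cnt_sof.
have sz : size (enum I) = size (enum J) by rewrite -!cardE hI.
have [I0|[x0 x0I]] := set_0Vmem I.
  have J0 : enum J = [::] by apply/size0nil; rewrite -sz I0 -cardE cards0.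
  have I0' : enum I = [::] by apply/size0nil; rewrite I0 -cardE cards0.
  by rewrite I0' J0.
apply: (lexi_nth (x0 := x0)) => // p; rewrite -cardE hI => pk.
have := H (Ordinal pk).
by rewrite !(sof_nth x0).
Qed.

Lemma vertical_labels_inj : injective VL.
Proof.
move=> lam mu E.
have le nu1 nu2 : VL nu1 = VL nu2 -> forall i, (vl nu1 i <= vl nu2 i)%N.
  move=> En; apply: incr_cnt_le; [exact: vlab_lt|exact: vlab_lt|move=> c].
  by rewrite -!cnt_vlab En.
have Ev i : vlabel lam i = vlabel mu i.
  by apply/eqP; rewrite eqn_leq (le _ _ E) (le _ _ (esym E)).
apply/val_inj/ffunP => i; apply/val_inj.
have /addnI El := Ev i.
by rewrite -[LHS](subKn (partition_bound lam i)) El subKn // partition_bound.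
Qed.

Lemma gale_Schubert lam A V : represents A V -> gale lam A -> Schubert_cell R lam V.
Proof.
move=> AV [A0 Ag]; split.
- exact: represents_Gr AV.
- by rewrite (matroid_represents _ AV) (card_vlab hkn) eqxx.
- move=> J; rewrite (matroid_represents _ AV) => /andP[/eqP hJ J0].
  by apply: cnt_lexi => //; [exact: card_vlab|exact: Ag].
Qed.

Lemma Schubert_inj lam mu V :
  Schubert_cell R lam V -> Schubert_cell R mu V -> lam = mu.
Proof.
move=> [_ l1 l2] [_ m1 m2]; apply: vertical_labels_inj.
have E : enum (VL lam) = enum (VL mu).
  by apply: (@le_anti _ (seqlexi 'I_n)); rewrite l2 // m2.
by apply/setP => c; rewrite -mem_enum E mem_enum.
Qed.

Lemma exists_labels J : #|J| = k -> exists lam, VL lam = J.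
Proof.
move=> hJ; pose s := sof hJ.
have sl (i j : 'I_k) : (i < j)%N -> (s i < s j)%N by exact: sof_lt.
have lo (m : nat) (mk : (m < k)%N) : (m <= s (Ordinal mk))%N.
  elim: m mk => // m IH mk; apply: leq_ltn_trans (IH (ltnW mk)) _.
  exact: sl.
have hi (d : nat) : forall i : 'I_k, (i + d < k)%N -> (s i + d < n)%N.
  elim: d => [|d IH] i; first by rewrite !addn0.
  move=> id; have ik : (i.+1 < k)%N by move: id; lia.
  have := IH (Ordinal ik); rewrite /= addSnnS => /(_ id).
  have := sl i (Ordinal ik) (leqnn _); lia.
have lo' i : (i <= s i)%N by case: i => m mk; exact: lo.
have hi' i : (s i - i <= n - k)%N.
  have := hi (k - i.+1)%N i; have := ltn_ord i; have := lo' i; lia.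
have mono i i' : (i <= i')%N -> (s i - i <= s i' - i')%N.
  move=> ii; have step (d : nat) : forall j : 'I_k, (j : nat) = (i + d)%N ->
      (s i - i <= s j - j)%N.
    elim: d => [|d IH] j jd; first by rewrite (_ : j = i) //; apply: val_inj; rewrite /= jd addn0.
    have idk : (i + d < k)%N by have := ltn_ord j; rewrite jd; lia.
    apply: leq_trans (IH (Ordinal idk) erefl) _.
    have := sl (Ordinal idk) j; have := lo' (Ordinal idk); rewrite /= jd; lia.
  by apply: (step (i' - i)%N); rewrite subnKC.
have Hl i : (n - k - (s i - i) < (n - k).+1)%N by rewrite ltnS leq_subr.
(* The number [s i - i] of labels outside [J] before [s i] is the number of horizontal steps
   preceding the [i]-th vertical step. *)
pose f : {ffun 'I_k -> 'I_(n - k).+1} := [ffun i => Ordinal (Hl i)].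
have fP : [forall i : 'I_k, forall i' : 'I_k, (i <= i')%N ==> (f i' <= f i)%N].
  apply/forallP => i; apply/forallP => i'; apply/implyP => ii; rewrite !ffunE /=.
  exact: leq_sub2l (mono _ _ ii).
exists (exist _ f fP); apply/setP => c; rewrite (vlabE hkn).
have vE i : vl (exist _ f fP) i = s i.
  apply: val_inj; rewrite /= /vlabel /= ffunE /=.
  by have := lo' i; have := hi' i; lia.
apply/imsetP/idP => [[i _ ->]|/(sof_onto hJ)[i <-]]; first by rewrite vE sof_in.
by exists i.
Qed.

(* A base minimizing the sum of its labels. *)
Lemma exists_gale A J : #|J| = k -> minor A J != 0 -> exists lam, gale lam A.
Proof.
move=> hJ0 mJ0.
have P0 : (fun J => (#|J| == k) && (minor A J != 0)) J by rewrite hJ0 eqxx.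
case: (@arg_minnP _ J (fun J => (#|J| == k) && (minor A J != 0))
  (fun J => \sum_(c in J) (c : nat))%N P0) => I /andP[/eqP hI mI] Imin.
have [lam IE] := exists_labels hI; exists lam.
rewrite -IE in hI mI Imin; have d0 : dtf A (vl lam) != 0 by rewrite -minor_vlab.
apply/(gale_mulmx hkn lam A (G := invmx (\matrix_(i < k, j < k) A i (vl lam j)))).
  by rewrite unitmx_inv; exact: dtf_unit.
apply: (echelon_gale (hkn := hkn)); split=> [i c ci|i]; last first.
  by rewrite -/(nrm A (vl lam)) nrmE // eqxx oner_neq0.
apply/eqP; apply: contraTT ci => Bc.
have [/predU1P[->|cI] mc] := nrm_neq0_minor mI Bc; first by rewrite ltnn.
(* Exchanging the pivot for an earlier column would lower the sum of the labels. *)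
have := Imin (c |: VL lam :\ vl lam i); rewrite mc card_exchange ?vlab_in // hI eqxx.
move=> /(_ isT); rewrite (big_setD1 (vl lam i)) ?vlab_in //= big_setU1 /=.
  by rewrite leq_add2r leqNgt.
by rewrite in_setD1 (negbTE cI) andbF.
Qed.

End Schubert.

(** * Cells *)

Section PolynomialExpressions.
Local Open Scope ring_scope.
Variables (R : realType) (d : nat).
Implicit Types (p q : mpoly d int) (v : 'I_d -> R).

Lemma peval0 v : peval (0 : mpoly d int) v = 0.
Proof. exact: mmap0. Qed.

Lemma peval1 v : peval (1 : mpoly d int) v = 1.
Proof. exact: rmorph1. Qed.

Lemma pevalD p q v : peval (p + q) v = peval p v + peval q v.
Proof. exact: mmapD. Qed.

Lemma pevalM p q v : peval (p * q) v = peval p v * peval q v.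
Proof. exact: rmorphM. Qed.

Lemma pevalX (i : 'I_d) v : peval (mpolyX int (mnm1 i)) v = v i.
Proof. by rewrite /peval mmapX mmap1U. Qed.

Lemma nonneg_coeffs0 : nonneg_coeffs (0 : mpoly d int).
Proof. by move=> m; rewrite mcoeff0. Qed.

Lemma nonneg_coeffs1 : nonneg_coeffs (1 : mpoly d int).
Proof. by move=> m; rewrite mcoeff1. Qed.

Lemma nonneg_coeffsX (i : 'I_d) : nonneg_coeffs (mpolyX int (mnm1 i)).
Proof. by move=> m; rewrite mcoeffX. Qed.

Lemma nonneg_coeffsD p q :
  nonneg_coeffs p -> nonneg_coeffs q -> nonneg_coeffs (p + q).
Proof. by move=> p0 q0 m; rewrite mcoeffD addr_ge0. Qed.

Lemma nonneg_coeffsM p q :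
  nonneg_coeffs p -> nonneg_coeffs q -> nonneg_coeffs (p * q).
Proof.
by move=> p0 q0 m; rewrite mcoeffM; apply: sumr_ge0 => i _; apply: mulr_ge0.
Qed.

Lemma peval_neq0 p v : peval p v != 0 -> p != 0.
Proof. by apply: contraNneq => ->; rewrite peval0. Qed.

End PolynomialExpressions.

Section Cells.
Local Open Scope ring_scope.
Local Open Scope classical_set_scope.
Variables (R : realType) (k n : nat).
Hypothesis hkn : (k <= n)%N.
Implicit Types (A B : 'M[R]_(k, n)) (J : {set 'I_n}) (M : {set {set 'I_n}}).
Implicit Types (T : tableau k n R) (V : {vspace 'rV[R]_n}) (D : Le k n).
Implicit Types (lam : partition_in k (n - k)).
Notation vl := (vlab hkn).
Notation VL := (@vertical_labels k n).

Lemma polf_peval D (F : tableau k n R -> R) : polf F ->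
  exists2 p : mpoly #|Le_ones D| int, nonneg_coeffs p &
    forall x : 'rV[R]_#|Le_ones D|, F (tableau_of x) = peval p (x 0).
Proof.
elim=> [||b|F1 F2 _ [p1 h1 e1] _ [p2 h2 e2]|F1 F2 _ [p1 h1 e1] _ [p2 h2 e2]].
- by exists 0 => [|x]; [exact: nonneg_coeffs0|rewrite peval0].
- by exists 1 => [|x]; [exact: nonneg_coeffs1|rewrite peval1].
- have [bD|bD] := boolP (b \in Le_ones D).
    exists (mpolyX int (mnm1 (enum_rank_in bD b))) => [|x].
      exact: nonneg_coeffsX.
    by rewrite pevalX -tableau_of_enum_val enum_rankK_in.
  exists 0 => [|x]; first exact: nonneg_coeffs0.
  by rewrite peval0 tableau_of_out.
- by exists (p1 + p2) => [|x]; [exact: nonneg_coeffsD|rewrite pevalD e1 e2].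
- by exists (p1 * p2) => [|x]; [exact: nonneg_coeffsM|rewrite pevalM e1 e2].
Qed.

(** Minors outside [M] vanish on the stratum and become 0, so only the coordinates of [M] remain as
    variables. *)
Lemma sff_peval lam M (F : 'M[R]_(k, n) -> R) : sff (stratum lam M) F ->
  exists p q : mpoly #|M| int, [/\ nonneg_coeffs p, nonneg_coeffs q &
    forall A, stratum lam M A -> let v s := minor A (enum_val s) in
      peval q v != 0 /\ F A = peval p v / peval q v].
Proof.
elim=> [||J hJ|F1 F2 _ [p1 [q1 [hp1 hq1 e1]]] _ [p2 [q2 [hp2 hq2 e2]]]
  |F1 F2 _ [p1 [q1 [hp1 hq1 e1]]] _ [p2 [q2 [hp2 hq2 e2]]]
  |F1 F2 _ [p1 [q1 [hp1 hq1 e1]]] _ [p2 [q2 [hp2 hq2 e2]]] F20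
  |F1 F2 _ [p1 [q1 [hp1 hq1 e1]]] E].
- exists 0, 1; split; [exact: nonneg_coeffs0|exact: nonneg_coeffs1|].
  by move=> A _ /=; rewrite peval0 peval1 mul0r oner_neq0.
- exists 1, 1; split; [exact: nonneg_coeffs1|exact: nonneg_coeffs1|].
  by move=> A _ /=; rewrite peval1 divr1 oner_neq0.
- have [JM|JM] := boolP (J \in M).
    exists (mpolyX int (mnm1 (enum_rank_in JM J))), 1.
    split; [exact: nonneg_coeffsX|exact: nonneg_coeffs1|move=> A _ /=].
    by rewrite peval1 divr1 oner_neq0 pevalX enum_rankK_in.
  exists 0, 1; split; [exact: nonneg_coeffs0|exact: nonneg_coeffs1|].
  move=> A [_ _ AM] /=; rewrite peval0 peval1 mul0r oner_neq0; split=> //.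
  by apply/eqP; rewrite -[_ == _]negbK AM.
- exists (p1 * q2 + p2 * q1), (q1 * q2); split.
  + by apply: nonneg_coeffsD; exact: nonneg_coeffsM.
  + exact: nonneg_coeffsM.
  move=> A YA /=; have [h1 ->] := e1 A YA; have [h2 ->] := e2 A YA.
  by rewrite pevalD !pevalM mulf_neq0 // addf_div.
- exists (p1 * p2), (q1 * q2); split; [exact: nonneg_coeffsM|exact: nonneg_coeffsM|].
  move=> A YA /=; have [h1 ->] := e1 A YA; have [h2 ->] := e2 A YA.
  by rewrite !pevalM mulf_neq0 // mulf_div.
- exists (p1 * q2), (q1 * p2); split; [exact: nonneg_coeffsM|exact: nonneg_coeffsM|].
  move=> A YA /=; have [h1 ->] := e1 A YA; have [h2 E2] := e2 A YA.
  have := F20 A YA; rewrite E2 mulf_eq0 invr_eq0 (negbTE h2) orbF => p20.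
  by rewrite !pevalM mulf_neq0 // invf_div mulf_div.
- exists p1, q1; split=> // A YA; rewrite -E //; exact: e1.
Qed.

Lemma Le_isLe D : is_Le (Le_shape D) (Le_ones D).
Proof. exact: (valP D). Qed.

Lemma ones_tab (D : {set 'I_k * 'I_(n - k)}) :
  tab D [ffun b => (b \in D)%:R : R].
Proof.
move=> b; rewrite ffunE; split; first by rewrite ler0n.
by rewrite ltr0n lt0b.
Qed.

Lemma tnn_Gr_tnn lam A : gale lam A -> tnn lam A -> Gr_tnn k (rowspan A).
Proof.
move=> [A0 _] At; have d0 : dtf A (vl lam) != 0 by rewrite -minor_vlab.
exists (nrm A (vl lam)).
have Gu : invmx (\matrix_(i < k, j < k) A i (vl lam j)) \in unitmx.
  by rewrite unitmx_inv; exact: dtf_unit.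
have minE J : #|J| = k -> minor (nrm A (vl lam)) J = minor A J / minor A (VL lam).
  move=> hJ; rewrite minor_mulmx // det_inv mulrC; congr (_ / _).
  by rewrite (minor_vlab hkn).
split; last first.
  move=> J hJ; rewrite minE //.
  have := At J hJ; rewrite -(pmulr_lge0 _ (_ : 0 < (minor A (VL lam)) ^- 2)).
    by rewrite expr2 invfM mulrA mulfK.
  by rewrite invr_gt0 exprn_even_gt0.
split; last by rewrite rowspan_mulmx.
apply: (minor_row_free (card_vlab hkn lam)).
by rewrite minE ?(card_vlab hkn) // divff // oner_neq0.
Qed.

Lemma Le_cell_matrices D : exists (P : {set 'I_n} -> tableau k n R -> R) M
    (F : 'I_k * 'I_(n - k) -> 'M[R]_(k, n) -> R),
  [/\ forall J, polf (P J),
      forall J, J \in M -> #|J| = k,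
      forall T, tab (Le_ones D) T -> exists A,
        [/\ stratum (Le_shape D) M A, represents A (Meas_Le D T) &
          forall J, #|J| = k -> minor A J = P J T * minor A (VL (Le_shape D))],
      forall b, sff (stratum (Le_shape D) M) (F b) &
      forall A, stratum (Le_shape D) M A -> let T := [ffun b => F b A] in
        [/\ tab (Le_ones D) T, represents A (Meas_Le D T) &
         forall T', tab (Le_ones D) T' -> represents A (Meas_Le D T') -> T' = T]].
Proof.
set lam := Le_shape D; have hD := Le_isLe D.
have [P [Pp Pr]] := forward R hkn hD.
pose M : {set {set 'I_n}} := finset (fun J => (#|J| == k) &&
  `[< forall T, tab (Le_ones D) T -> P J T != 0 >]).
have Pge0 J T : tab (Le_ones D) T -> 0 <= P J T.
  by move=> TD; case: (polf_sign (Le_ones D) (Pp J)) => H; rewrite ?H // ltW ?H.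
have rs T A : tab (Le_ones D) T -> realizes hkn lam (Le_ones D) P T A -> stratum lam M A.
  move=> TD [_ Ag Am _]; have A0 : minor A (VL lam) != 0 by case: Ag.
  split=> // J hJ; rewrite Am //.
    by rewrite -mulrA mulr_ge0 ?Pge0 // -expr2 sqr_ge0.
  rewrite mulf_eq0 negb_or A0 andbT inE hJ eqxx /=.
  case: (polf_sign (Le_ones D) (Pp J)) => H.
    rewrite H // eqxx; apply/esym/negbTE/negP => /asboolP/(_ T TD).
    by rewrite H // eqxx.
  by rewrite gt_eqF ?H //; apply/esym/asboolP => T' /H; rewrite lt_neqAle eq_sym => /andP[].
pose T0 : tableau k n R := [ffun b => (b \in Le_ones D)%:R].
have T0D : tab (Le_ones D) T0 by exact: ones_tab.
have [A0 A0r] := Pr _ T0D; have Y0 := rs _ _ T0D A0r.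
have [|D2 [F [hD2 Fs FP]]] := @parametrize R k n hkn lam M; first by exists A0.
(* One matrix suffices: that of [T0] has a tableau for each of the two diagrams, [MR_inj] identifies
   the tableaux, and a diagram is the support of its tableaux. *)
have D2E : D2 = Le_ones D.
  have [t2 m2] := FP _ Y0.
  have E := MR_inj hD2 hD t2 T0D m2 (realizes_MR A0r).
  apply/setP => b; have := tab_eq0 b t2; rewrite E (tab_eq0 b T0D).
  by move=> /negb_inj ->.
exists P, M, F; split=> //.
- by move=> J; rewrite inE => /andP[/eqP].
- move=> T TD; have [A Ar] := Pr _ TD; exists A; split.
  + exact: rs Ar.
  + by apply: MR_represents; case: Ar.
  + by case: Ar.
- move=> A YA /=; have [t m] := FP _ YA; rewrite D2E in t; split=> //.
    exact: MR_represents m.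
  move=> T' TD' [Af AT']; have [B Br] := Pr _ TD'.
  have [Bf BT'] := MR_represents (realizes_MR Br).
  have [G Gu AE] := rowspan_eq Bf Af (etrans BT' (esym AT')).
  apply: (MR_inj hD hD TD' t _ m); rewrite AE.
  by apply/MR_mulmx => //; exact: realizes_MR Br.
Qed.

(** The Gale condition depends only on the matroid, so a single matrix of the stratum supplies it
    for every point of the cell. *)
Lemma tnn_cell_stratum lam M V : (exists A, stratum lam M A) ->
  (forall J, J \in M -> #|J| = k) ->
  tnn_cell R k M V <-> exists A, represents A V /\ stratum lam M A.
Proof.
move=> [A0 [[A00 A0g] A0t A0M]] Mk; split; last first.
  move=> [A [AV [Ag At AM]]]; split; first by case: AV => _ <-; exact: tnn_Gr_tnn Ag At.
  apply/setP => J; rewrite (matroid_represents _ AV).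
  case: eqP => [hJ|hJ]; first by rewrite AM.
  by apply/esym/negbTE/negP => /Mk.
move=> [[A [AV Age0]] VM]; exists A; split=> //.
have AM J : #|J| = k -> (minor A J != 0) = (J \in M).
  by move=> hJ; rewrite -VM (matroid_represents _ AV) hJ eqxx.
have hI := card_vlab hkn lam.
split=> //.
  split; first by rewrite AM // -A0M.
  by move=> J hJ; rewrite AM // -A0M //; exact: A0g.
by move=> J hJ; rewrite mulr_ge0 // Age0.
Qed.

End Cells.

(** * Continuity, and the topology of the cells *)

Section Continuity.
Local Open Scope ring_scope.
Local Open Scope classical_set_scope.
Variables (R : realType) (X : topologicalType).
Implicit Types f g : X -> R.

Lemma continuous_sum_fun (I : Type) (r : seq I) (P : pred I) (F : I -> X -> R) :
  (forall i, continuous (F i)) -> continuous (fun x => \sum_(i <- r | P i) F i x).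
Proof. by move=> Fc; apply: continuous_big => //; exact: add_continuous. Qed.

Lemma continuous_prod_fun (I : Type) (r : seq I) (P : pred I) (F : I -> X -> R) :
  (forall i, continuous (F i)) -> continuous (fun x => \prod_(i <- r | P i) F i x).
Proof. by move=> Fc; apply: continuous_big => //; exact: mul_continuous. Qed.

Lemma continuous_mul_fun f g : continuous f -> continuous g ->
  continuous (fun x => f x * g x).
Proof. by move=> fc gc x; apply: continuousM; [exact: fc|exact: gc]. Qed.

Lemma continuous_exp_fun f (m : nat) : continuous f -> continuous (fun x => f x ^+ m).
Proof.
move=> fc; elim: m => [|m IH].
  rewrite (_ : (fun x => _) = fun=> 1); first exact: cst_continuous.
  by apply/funext => x; rewrite expr0.
rewrite (_ : (fun x => _) = fun x => f x * f x ^+ m).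
  exact: continuous_mul_fun.
by apply/funext => x; rewrite exprS.
Qed.

Lemma continuous_peval (d : nat) (p : mpoly d int) (v : X -> 'I_d -> R) :
  (forall i, continuous (v ^~ i)) -> continuous (fun x => peval p (v x)).
Proof.
move=> vc; rewrite /peval /mmap; apply: continuous_sum_fun => m.
apply: continuous_mul_fun; first exact: cst_continuous.
by apply: continuous_prod_fun => i; apply: continuous_exp_fun; exact: vc.
Qed.

Lemma continuous_matrix_at (m n : nat) (F : X -> 'M[R]_(m, n)) (x : X) :
  (forall i j, {for x, continuous (fun x => F x i j)}) -> {for x, continuous F}.
Proof.
move=> Fc B /= [P PF PB].
rewrite /nbhs /=; apply: (@filterS _ _ _ [set y | forall i j, P i j (F y i j)]).
  by move=> y Py; apply: PB.
apply: filter_forall => i; apply: filter_forall => j.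
exact: (Fc i j _ (PF i j)).
Qed.

End Continuity.

Section ContinuousMinors.
Local Open Scope ring_scope.
Local Open Scope classical_set_scope.
Variables (R : realType) (k n : nat).

Lemma continuous_minor (J : {set 'I_n}) : #|J| = k ->
  continuous (fun A : 'M[R]_(k, n) => minor A J).
Proof.
move=> hJ; rewrite (_ : (fun A => _) = fun A : 'M[R]_(k, n) =>
  \sum_(s : {perm 'I_k}) (-1) ^+ s * \prod_i A i (sof hJ (s i))); last first.
  apply/funext => A; rewrite (minor_sof A hJ) /dtf /determinant.
  apply: eq_bigr => s _; congr (_ * _); apply: eq_bigr => i _.
  by rewrite mxE.
apply: continuous_sum_fun => s; apply: continuous_mul_fun; first exact: cst_continuous.
by apply: continuous_prod_fun => i; exact: coord_continuous.
Qed.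

Lemma continuous_mulmx (G : 'M[R]_k) : continuous (fun A : 'M[R]_(k, n) => G *m A).
Proof.
move=> B; apply: continuous_matrix_at => i j; move: B.
rewrite (_ : (fun A => _) = fun A : 'M[R]_(k, n) => \sum_a G i a * A a j); last first.
  by apply/funext => A; rewrite mxE.
apply: continuous_sum_fun => a; apply: continuous_mul_fun; first exact: cst_continuous.
exact: coord_continuous.
Qed.

Lemma continuous_polf (D : Le k n) (F : tableau k n R -> R) : polf F ->
  continuous (fun x : 'rV[R]_#|Le_ones D| => F (tableau_of x)).
Proof.
move=> /(polf_peval D)[p _ pE]; rewrite (funext pE).
by apply: continuous_peval => i; exact: coord_continuous.
Qed.

(** The inverse formulas make sense on an open set of matrices, not only on those of the cell, so
    the preimage of an open set under the chart is open among all matrices. *)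
Lemma open_chart (M : {set {set 'I_n}}) (d : nat) (p q : 'I_d -> mpoly #|M| int)
    (O : set 'rV[R]_d) : (forall J, J \in M -> #|J| = k) -> open O ->
  let v (A : 'M[R]_(k, n)) t := minor A (enum_val t) in
  let r A s := peval (p s) (v A) / peval (q s) (v A) in
  open [set A | (forall s, peval (q s) (v A) != 0 /\ 0 < r A s) /\
    O (\row_s ln (r A s))].
Proof.
move=> hM Oo v r.
have vc t : continuous (fun A => v A t).
  by apply: continuous_minor; apply: hM; exact: enum_valP.
have pc (w : mpoly #|M| int) : continuous (fun A => peval w (v A)).
  exact: continuous_peval.
rewrite openE => A [WA OA].
have rc s : {for A, continuous (fun A => r A s)}.
  apply: continuousM; first exact: pc.
  by apply: continuousV; [case: (WA s)|exact: pc].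
have Lc : {for A, continuous (fun A => \row_s ln (r A s))}.
  apply: continuous_matrix_at => i s.
  rewrite (_ : (fun B => _) = (@ln R) \o (fun B => r B s)); last first.
    by apply/funext => B; rewrite mxE.
  apply: (@continuous_comp _ _ _ (fun B => r B s) (@ln R) A); first exact: rc.
  by apply: continuous_ln; case: (WA s).
have Wn : \forall B \near A, forall s, peval (q s) (v B) != 0 /\ 0 < r B s.
  apply: (@filter_forall _ _ (fun s (B : 'M[R]_(k, n)) =>
    peval (q s) (v B) != 0 /\ 0 < r B s) (nbhs A)) => s; apply: filterI.
    exact: (cvgr_neq0 _ (pc (q s) A) (WA s).1).
  exact: (cvgr_gt _ (rc s) _ (WA s).2).
have On : \forall B \near A, O (\row_s ln (r B s)).
  by apply: Lc; apply: open_nbhs_nbhs.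
exact: filterI.
Qed.

End ContinuousMinors.

Section LeCells.
Local Open Scope ring_scope.
Local Open Scope classical_set_scope.
Variables (R : realType) (k n : nat).
Hypothesis hkn : (k <= n)%N.
Variable D : Le k n.
Implicit Types (I J : {set 'I_n}).
Let lam := Le_shape D.
Let d := #|Le_ones D|.
Notation vl := (vlab hkn).
Notation VL := (@vertical_labels k n).
Variables (P : {set 'I_n} -> tableau k n R -> R) (M : {set {set 'I_n}}).
Variable F : 'I_k * 'I_(n - k) -> 'M[R]_(k, n) -> R.
Hypothesis hP : forall J, polf (P J).
Hypothesis hM : forall J, J \in M -> #|J| = k.
Hypothesis hA : forall T, tab (Le_ones D) T -> exists A,
  [/\ stratum lam M A, represents A (Meas_Le D T) &
      forall J, #|J| = k -> minor A J = P J T * minor A (VL lam)].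
Hypothesis hF : forall b, sff (stratum lam M) (F b).
Hypothesis hT : forall A, stratum lam M A -> let T := [ffun b => F b A] in
  [/\ tab (Le_ones D) T, represents A (Meas_Le D T) &
   forall T', tab (Le_ones D) T' -> represents A (Meas_Le D T') -> T' = T].

Let hI : #|VL lam| = k := card_vlab hkn lam.

Lemma represents_mulmx (G : 'M[R]_k) (A : 'M[R]_(k, n)) V : G \in unitmx ->
  represents A V -> represents (G *m A) V.
Proof.
move=> Gu [Af AV]; split; last by rewrite rowspan_mulmx.
by rewrite -row_leq_rank mxrankMfree // row_leq_rank row_free_unit.
Qed.

Lemma stratum_represents T (A : 'M[R]_(k, n)) : tab (Le_ones D) T ->
  represents A (Meas_Le D T) -> stratum lam M A.
Proof.
move=> TD [Af AV]; have [B [BY [Bf BV] _]] := hA TD.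
have [G Gu ->] := rowspan_eq Bf Af (etrans BV (esym AV)).
exact: stratum_mulmx.
Qed.

Lemma F_represents T (A : 'M[R]_(k, n)) b : tab (Le_ones D) T ->
  represents A (Meas_Le D T) -> F b A = T b.
Proof.
move=> TD AV; have [_ _ /(_ T TD AV) ->] := hT (stratum_represents TD AV).
by rewrite ffunE.
Qed.

Lemma ex_stratum : exists A : 'M[R]_(k, n), stratum lam M A.
Proof.
have [A [AY _ _]] := hA (ones_tab R (Le_ones D)).
by exists A.
Qed.

Lemma tnn_cellP V : tnn_cell R k M V <-> exists2 T, tab (Le_ones D) T & Meas_Le D T = V.
Proof.
rewrite (tnn_cell_stratum hkn V ex_stratum hM); split.
  move=> [A [AV AY]]; have [TD AT _] := hT AY.
  by exists [ffun b => F b A] => //; case: AV => _ <-; case: AT => _ <-.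
move=> [T TD <-]; have [A [AY AV _]] := hA TD.
by exists A.
Qed.

Lemma tab_tableau_of (x : 'rV[R]_d) : orthant x -> tab (Le_ones D) (tableau_of x).
Proof. by have [h _ _] := tableau_of_bij R D; exact: h. Qed.

Lemma Le_cell_tnn_cell : Le_cell R D = tnn_cell R k M.
Proof.
apply/seteqP; split=> V.
  by move=> [T TD <-]; apply/tnn_cellP; exists T.
by move=> /tnn_cellP[T TD <-]; exists T.
Qed.

Lemma Meas_coord_bij : set_bij (@orthant R d) (tnn_cell R k M) (Meas_coord R D).
Proof.
have [h1 h2 h3] := tableau_of_bij R D; split.
- by move=> x xp; apply/tnn_cellP; exists (tableau_of x) => //; exact: tab_tableau_of.
- move=> x y; rewrite !in_setE => xp yp xy; apply: h2; rewrite ?in_setE //.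
  have tx := tab_tableau_of xp; have ty := tab_tableau_of yp.
  have [A [AY Ax _]] := hA tx; apply/ffunP => b.
  rewrite -(F_represents b tx Ax); apply: (F_represents b ty).
  by rewrite -[Meas_Le D (tableau_of y)]xy.
- move=> V /tnn_cellP[T TD <-]; have [x xp xT] := h3 T TD.
  by exists x => //; rewrite -xT.
Qed.

Lemma plucker_ratioP (x : 'rV[R]_d) I J : orthant x -> #|I| = k -> #|J| = k ->
  plucker k (Meas_coord R D x) J / plucker k (Meas_coord R D x) I =
  P J (tableau_of x) / P I (tableau_of x).
Proof.
move=> xp hI' hJ; have [A [[[A0 _] _ _] AV AP]] := hA (tab_tableau_of xp).
by rewrite (plucker_ratio AV) // (AP J hJ) (AP I hI') invfM mulrACA divff // mulr1.
Qed.

Lemma P_neq0 (x : 'rV[R]_d) J : orthant x -> J \in M -> P J (tableau_of x) != 0.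
Proof.
move=> xp JM; have [A [[_ _ AM] _ AP]] := hA (tab_tableau_of xp).
by move: (AM J (hM JM)); rewrite JM (AP J (hM JM)) mulf_eq0 negb_or => /andP[].
Qed.

Lemma vertical_labels_in : VL lam \in M.
Proof. by have [A [[A0 _] _ <-]] := ex_stratum. Qed.

Lemma P_vertical_labels (x : 'rV[R]_d) : orthant x -> P (VL lam) (tableau_of x) = 1.
Proof.
move=> xp; have [A [[[A0 _] _ _] _ AP]] := hA (tab_tableau_of xp).
by apply: (mulIf A0); rewrite -(AP _ hI) mul1r.
Qed.

Lemma orthant1 : orthant (const_mx 1 : 'rV[R]_d).
Proof. by move=> i; rewrite mxE ltr01. Qed.

Lemma Meas_coord_inverse : exists p q : 'I_d -> mpoly #|M| int,
  forall s, [/\ nonneg_coeffs (p s), nonneg_coeffs (q s), q s != 0 &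
    forall x, orthant x -> forall A : 'M[R]_(k, n), represents A (Meas_coord R D x) ->
      let v t := minor A (enum_val t) in
      peval (q s) v != 0 /\ x 0 s = peval (p s) v / peval (q s) v].
Proof.
have [pq pqP] : exists pq : 'I_d -> mpoly #|M| int * mpoly #|M| int,
    forall s, [/\ nonneg_coeffs (pq s).1, nonneg_coeffs (pq s).2, (pq s).2 != 0 &
    forall x, orthant x -> forall A : 'M[R]_(k, n), represents A (Meas_coord R D x) ->
      let v t := minor A (enum_val t) in
      peval (pq s).2 v != 0 /\ x 0 s = peval (pq s).1 v / peval (pq s).2 v].
  apply: (@fin_all_exists _ (fun=> (mpoly #|M| int * mpoly #|M| int)%type)
    (fun s pq => [/\ nonneg_coeffs pq.1, nonneg_coeffs pq.2, pq.2 != 0 &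
    forall x, orthant x -> forall A : 'M[R]_(k, n), represents A (Meas_coord R D x) ->
      let v t := minor A (enum_val t) in
      peval pq.2 v != 0 /\ x 0 s = peval pq.1 v / peval pq.2 v])) => s.
  have [p [q [hp hq pqE]]] := sff_peval (hF (enum_val s)).
  exists (p, q); split=> //=.
    have [A AY] := ex_stratum; have [q0 _] := pqE A AY.
    exact: peval_neq0 q0.
  move=> x xp A AV; have tx := tab_tableau_of xp.
  have [q0 E] := pqE A (stratum_represents tx AV); split=> //.
  by rewrite -E (F_represents _ tx AV) tableau_of_enum_val.
by exists (fun s => (pq s).1), (fun s => (pq s).2).
Qed.

Lemma Le_sf_parametrization : sf_parametrization k M (Meas_coord R D).
Proof.
split; first exact: Meas_coord_bij.
- move=> I J IM JM.
  have [p hp pE] := polf_peval D (hP J); have [q hq qE] := polf_peval D (hP I).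
  exists p, q; split=> //.
    apply: (@peval_neq0 R _ _ ((const_mx 1 : 'rV[R]_d) 0)); rewrite -qE.
    by apply: P_neq0 => //; exact: orthant1.
  by move=> x xp; rewrite plucker_ratioP ?hM // pE qE.
- move=> s; have [p [q pqP]] := Meas_coord_inverse; exists (p s), (q s); exact: pqP.
Qed.

Lemma Le_polynomial_parametrization :
  polynomial_parametrization k (VL lam) M (Meas_coord R D).
Proof.
split; [exact: Le_sf_parametrization|exact: vertical_labels_in|move=> J JM].
have [p hp pE] := polf_peval D (hP J); exists p; split=> // x xp.
by rewrite (plucker_ratioP xp hI (hM JM)) (P_vertical_labels xp) divr1 pE.
Qed.

(* The entries of the representative which is the identity on the columns of
   [VL lam] are polynomials in [x], by Cramer's rule. *)
Definition standard_mx (x : 'rV[R]_d) : 'M[R]_(k, n) :=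
  \matrix_(i, c) if c \in VL lam then (c == vl lam i)%:R
    else cramer_sign R hkn lam i c * P (c |: VL lam :\ vl lam i) (tableau_of x).

Lemma standard_mx_represents (x : 'rV[R]_d) : orthant x ->
  represents (standard_mx x) (Meas_coord R D x).
Proof.
move=> xp; have [A [[[A0 _] _ _] AV AP]] := hA (tab_tableau_of xp).
suff -> : standard_mx x = nrm A (vl lam).
  apply: represents_mulmx AV; rewrite unitmx_inv; apply: dtf_unit.
  by rewrite -minor_vlab.
apply/matrixP => i c; rewrite mxE nrm_cramer //; case: ifP => // /negbT cI.
by rewrite (AP (c |: VL lam :\ vl lam i)) ?card_exchange ?vlab_in // mulfK.
Qed.

Lemma continuous_standard_mx : continuous standard_mx.
Proof.
move=> x; apply: continuous_matrix_at => i c; move: x.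
have [cI|cI] := boolP (c \in VL lam).
  rewrite (_ : (fun x => _) = fun=> (c == vl lam i)%:R); first exact: cst_continuous.
  by apply/funext => x; rewrite mxE cI.
rewrite (_ : (fun x => _) = fun x => cramer_sign R hkn lam i c *
   P (c |: VL lam :\ vl lam i) (tableau_of x)); last first.
  by apply/funext => x; rewrite mxE (negbTE cI).
by apply: continuous_mul_fun; [exact: cst_continuous|exact: continuous_polf].
Qed.

Definition exp_row (y : 'rV[R]_d) : 'rV[R]_d := \row_s expR (y 0 s).

Lemma exp_row_orthant y : orthant (exp_row y).
Proof. by move=> s; rewrite mxE expR_gt0. Qed.

Lemma continuous_exp_row : continuous exp_row.
Proof.
move=> y; apply: continuous_matrix_at => i s.
rewrite (_ : (fun x => _) = (@expR R) \o (fun x : 'rV[R]_d => x 0 s)); last first.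
  by apply/funext => x; rewrite mxE.
apply: (@continuous_comp _ _ _ (fun x : 'rV[R]_d => x 0 s) (@expR R) y).
  exact: coord_continuous.
exact: continuous_expR.
Qed.

(** The parametrization composed with exponentials is injective, and logarithms of the inverse
    formulas recover its argument from any representative. Images of open sets are handled by
    [open_chart], preimages by the continuity of [standard_mx]. *)
Lemma Le_cell_dim : cell_dim k (Le_cell R D) d.
Proof.
have [p [q pqP]] := Meas_coord_inverse.
pose v (A : 'M[R]_(k, n)) (t : 'I_#|M|) := minor A (enum_val t).
pose r A s := peval (p s) (v A) / peval (q s) (v A).
pose g y := Meas_coord R D (exp_row y).
have [c1 c2 c3] := Meas_coord_bij.
have rE y A s : represents A (g y) -> peval (q s) (v A) != 0 /\ r A s = expR (y 0 s).
  move=> AV; have [_ _ _ H] := pqP s.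
  by have [h1 h2] := H _ (exp_row_orthant y) A AV; split=> //; rewrite /r /v -h2 mxE.
have gE y A : represents A (g y) -> \row_s ln (r A s) = y.
  move=> AV; apply/rowP => s; rewrite mxE; have [_ ->] := rE y A s AV.
  exact: expRK.
have Nr y : represents (standard_mx (exp_row y)) (g y).
  exact/standard_mx_represents/exp_row_orthant.
have g_inj y y' : g y = g y' -> y = y'.
  by move=> E; rewrite -(gE y _ (Nr y)); apply: gE; rewrite -E.
exists g; split.
  rewrite Le_cell_tnn_cell; split.
  - by move=> y _; apply: c1; exact: exp_row_orthant.
  - by move=> y y' _ _; exact: g_inj.
  - move=> V /c3[x xp <-]; exists (\row_s ln (x 0 s)) => //.
    by rewrite /g; congr (Meas_coord R D _); apply/rowP => s; rewrite !mxE lnK ?posrE.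
move=> O; split=> [Oo|[U [UG /open_subspaceP[W Wo WU]] gO]].
  pose C := [set A | (forall s, peval (q s) (v A) != 0 /\ 0 < r A s) /\
    O (\row_s ln (r A s))].
  have Co : open C by exact: (@open_chart _ _ _ _ _ p q _ hM Oo).
  exists [set V | exists2 A, represents A V & C A].
    split; first by move=> V [A AV _]; exact: represents_Gr AV.
    (* The preimage of the open set of subspaces is the saturation of [C] under GL_k, which is open
       because left multiplication is continuous. *)
    apply/open_subspaceP; exists [set A | exists2 G : 'M[R]_k, G \in unitmx & C (G *m A)].
      rewrite openE => A [G Gu CA].
      have : \forall B \near A, C (G *m B).
        by have := @continuous_mulmx _ _ _ G A; apply; apply: open_nbhs_nbhs.
      by apply: filterS => B CB; exists G.
    apply/seteqP; split=> A [H Af]; split=> //.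
      case: H => G Gu CA; exists (G *m A) => //.
      by apply: represents_mulmx.
    case: H => B [Bf BV] CB; have [G Gu BE] := rowspan_eq Af Bf (esym BV).
    by exists G => //; rewrite -BE.
  rewrite Le_cell_tnn_cell; apply/seteqP; split=> V.
    move=> [y Oy <-]; split; first by apply: c1; exact: exp_row_orthant.
    exists (standard_mx (exp_row y)); first exact: Nr.
    split=> [s|]; last by rewrite (gE y _ (Nr y)).
    by have [h ->] := rE y _ s (Nr y); rewrite expR_gt0.
  move=> [/c3[x xp <-] [A AV [_ OA]]].
  have xE : x = exp_row (\row_s ln (x 0 s)).
    by apply/rowP => s; rewrite !mxE lnK ?posrE.
  exists (\row_s ln (x 0 s)); last by rewrite /g -xE.
  by rewrite xE in AV; rewrite -(gE _ A AV).
(* By injectivity of [g], the set [O] consists of the points whose standard matrix lies in the open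
   set [W]. *)
have OE : O = (standard_mx \o exp_row) @^-1` W.
  apply/seteqP; split=> y.
    move=> Oy; have : (Le_cell R D `&` U) (g y) by rewrite -gO; exists y.
    move=> [_ Uy]; have [Nf NV] := Nr y.
    by have : ([set A | U (rowspan A)] `&` [set A | row_free A]) (standard_mx (exp_row y));
      [split=> //=; rewrite NV|rewrite -WU => -[]].
  move=> Wy; have [Nf NV] := Nr y.
  have : (W `&` [set A | row_free A]) (standard_mx (exp_row y)) by [].
  rewrite WU => -[/= UN _]; rewrite NV in UN.
  have : (Le_cell R D `&` U) (g y).
    split=> //; rewrite Le_cell_tnn_cell; apply: c1; exact: exp_row_orthant.
  by rewrite -gO => -[y' Oy' /g_inj <-].
rewrite OE; apply: open_comp => // y _.
apply: continuous_comp; first exact: continuous_exp_row.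
exact: continuous_standard_mx.
Qed.

End LeCells.

(** * The bijection between Le-diagrams and cells *)

Section LeBijection.
Local Open Scope ring_scope.
Local Open Scope classical_set_scope.
Variables (R : realType) (k n : nat).
Hypothesis hkn : (k <= n)%N.
Implicit Types (D : Le k n) (lam : partition_in k (n - k)).
Implicit Types (T : tableau k n R) (V : {vspace 'rV[R]_n}).

Lemma MR_Meas_Le D T : tab (Le_ones D) T -> exists A : 'M[R]_(k, n),
  [/\ represents A (Meas_Le D T), gale (Le_shape D) A & MR hkn (Le_shape D) T A].
Proof.
move=> TD; have [P [_ /(_ _ TD)[A [Am Ag _ _]]]] := forward R hkn (Le_isLe D).
by exists A; split=> //; exact: MR_represents.
Qed.

Lemma Le_cell_neq0 D : Le_cell R D !=set0.
Proof.
by exists (Meas_Le D [ffun b => (b \in Le_ones D)%:R]); eexists; first exact: ones_tab.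
Qed.

Lemma Le_cell_Schubert D : Le_cell R D `<=` Schubert_cell R (Le_shape D).
Proof.
move=> V [T TD <-]; have [A [AV Ag _]] := MR_Meas_Le TD.
exact: (gale_Schubert hkn AV Ag).
Qed.

(** A common point first fixes the shape, through its Schubert cell; then [MR_inj] gives equal
    tableaux, hence equal supports. *)
Lemma Le_cell_inj D1 D2 V : Le_cell R D1 V -> Le_cell R D2 V -> D1 = D2.
Proof.
move=> V1 V2.
have E := Schubert_inj hkn (Le_cell_Schubert V1) (Le_cell_Schubert V2).
case: V1 V2 => [T1 T1D <-] [T2 T2D VE].
have [A1 [[A1f A1V] _ M1]] := MR_Meas_Le T1D.
have [A2 [[A2f A2V] _ M2]] := MR_Meas_Le T2D.
have [G Gu AE] := rowspan_eq A1f A2f (etrans A1V (esym (etrans A2V VE))).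
have h1 := Le_isLe D1; have h2 := Le_isLe D2.
rewrite -E in M2 h2.
have TE : T1 = T2.
  by apply: (MR_inj h1 h2 T1D T2D _ M2); rewrite AE; exact/MR_mulmx.
apply: val_inj; rewrite [val D1]surjective_pairing [val D2]surjective_pairing.
congr (_, _) => //; apply/setP => b.
by apply: negb_inj; rewrite -(tab_eq0 b T1D) TE (tab_eq0 b T2D).
Qed.

Lemma row_free_minor (A : 'M[R]_(k, n)) : row_free A ->
  exists2 J : {set 'I_n}, #|J| = k & minor A J != 0.
Proof.
move=> Af; have Af' : row_full A^T by rewrite /row_full mxrank_tr.
pose s := fullrankfun Af'.
have s0 : dtf A s != 0.
  rewrite /dtf -det_tr -unitfE -unitmxE.
  rewrite (_ : _^T = rowsub s A^T); first exact: fullrowsub_unit.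
  by apply/matrixP => i j; rewrite !mxE.
exists (s @: 'I_k); first by rewrite card_imset ?card_ord //; exact: (dtf_neq0_inj s0).
exact: dtf_neq0_minor.
Qed.

Lemma Gr_tnn_stratum V : Gr_tnn k V -> exists lam A,
  represents A V /\ stratum lam (matroid k V) A.
Proof.
move=> [A [AV Age0]]; have [J hJ J0] := row_free_minor AV.1.
have [lam Ag] := exists_gale hkn hJ J0; exists lam, A; split=> //; split=> //.
  by move=> I hI; rewrite mulr_ge0 ?Age0 ?card_vlab.
by move=> I hI; rewrite (matroid_represents _ AV) hI eqxx.
Qed.

Lemma Le_cell_onto V : Gr_tnn k V -> exists D, Le_cell R D V.
Proof.
move=> /Gr_tnn_stratum[lam [A [[Af AV] YA]]].
have [|D [F [hD _ /(_ _ YA)[TD TA]]]] := @parametrize R k n hkn lam (matroid k V).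
  by exists A.
exists (exist _ (lam, D) hD); exists [ffun b => F b A] => //.
by have [_ VE] := MR_represents TA; rewrite -AV VE.
Qed.

Lemma Le_cell_facts D : exists M : {set {set 'I_n}},
  [/\ Le_cell R D = tnn_cell R k M, sf_parametrization k M (Meas_coord R D),
      cell_dim k (Le_cell R D) #|Le_ones D| &
      polynomial_parametrization k (vertical_labels (Le_shape D)) M (Meas_coord R D)].
Proof.
have [P [M [F [hP hM hA hF hT]]]] := Le_cell_matrices R hkn D; exists M.
split.
- exact: Le_cell_tnn_cell hM hA hT.
- exact: Le_sf_parametrization hP hM hA hF hT.
- exact: Le_cell_dim hP hM hA hF hT.
- exact: Le_polynomial_parametrization hP hM hA hF hT.
Qed.

End LeBijection.

Local Open Scope classical_set_scope.

Theorem theorem6p5 (R : realType) (k n : nat) (hkn : (k <= n)%N) :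
  [/\ forall D : Le k n,
        exists M : {set {set 'I_n}},
          [/\ tnn_cell R k M !=set0, Le_cell R D = tnn_cell R k M,
              sf_parametrization k M (Meas_coord R D),
              cell_dim k (Le_cell R D) #|Le_ones D| &
              polynomial_parametrization k (vertical_labels (Le_shape D)) M
                (Meas_coord R D)],
      set_bij [set: Le k n] [set C | is_tnn_cell k C] (Le_cell R) &
      forall (D : Le k n) (lam : partition_in k (n - k)),
        Le_shape D = lam <-> Le_cell R D `<=` Schubert_cell R lam].
Proof.
split=> [D||D lam].
- have [M [hM ? ? ?]] := Le_cell_facts R hkn D; exists M; split=> //.
  by rewrite -hM; exact: Le_cell_neq0.
- split.
  + move=> D _; split; first exact: Le_cell_neq0.
    by have [M [hM _ _ _]] := Le_cell_facts R hkn D; exists M.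
  + move=> D1 D2 _ _ E; have [V DV] := Le_cell_neq0 R D1.
    by apply: (Le_cell_inj hkn DV); rewrite -E.
  (* A cell is determined by the matroid of any of its points, so it is enough that some diagram
     reaches [V]. *)
  + move=> C [[V CV] [M CM]]; move: CV; rewrite CM => -[Vtnn VM].
    have [D DV] := Le_cell_onto hkn Vtnn; exists D => //.
    have [M' [DM _ _ _]] := Le_cell_facts R hkn D.
    by move: DV; rewrite DM => -[_ <-]; rewrite VM.
split=> [<-|H]; first exact: Le_cell_Schubert.
have [V DV] := Le_cell_neq0 R D.
exact: (Schubert_inj hkn (Le_cell_Schubert hkn DV) (H _ DV)).
Qed.
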